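(* Let $(\mathcal U,\varphi,T)$ be a state preserving $C^*$-dynamical system over $L_0$. Then there exists a measurable bundle of $C^*$-algebras $(X,L)$ over $\Omega$ and a measurable bundle of $C^*$-dynamical systems $\{(X(\omega),\varphi_\omega,T_\omega):\omega\in\Omega\}$ such that (i) $\mathcal U$ is isometrically and $*$-isomorphic to $L_0(\Omega,X)$; and, identifying $\mathcal U$ with $L_0(\Omega,X)$ via this isomorphism, (ii) $T=\widehat{T_\omega}$, i.e. $T\widehat x$ is the class of $\omega\mapsto T_\omega x(\omega)$ for every $x\in M(\Omega,X)$; (iii) $\varphi=\widehat{\varphi_\omega}$, i.e. $\varphi(\widehat x)$ is the class of $\omega\mapsto\varphi_\omega(x(\omega))$ for every $x\in M(\Omega,X)$.
   Context: $(\Omega,\Sigma,\lambda)$ is a measure space with finite complete measure $\lambda$; $M(\Omega)$ is the set of measurable complex functions on $\Omega$ (defined a.e.); $L_0=L_0(\Omega)$ is the algebra of a.e.-equivalence classes of measurable complex functions, with the a.e. order on real elements and unit $\mathbf 1$. $C^*$-algebras over $L_0$: an $L_0$-valued norm on a complex vector space $E$ is a map $\|\cdot\|:E\to L_0$ with $\|x\|\ge0$, $\|x\|=0\iff x=0$, $\|\lambda x\|=|\lambda|\|x\|$ ($\lambda\in\mathbb C$), $\|x+y\|\le\|x\|+\|y\|$. $E$ is $d$-decomposable if whenever $\|x\|=e_1+e_2$ with disjoint positive $e_1,e_2\in L_0$ there are $x_1,x_2\in E$ with $x=x_1+x_2$, $\|x_i\|=e_i$. A net $(x_\alpha)$ $(bo)$-converges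 to $x$ if $\|x_\alpha-x\|\to0$ in order in $L_0$; $(bo)$-fundamental nets are those for which $(x_\alpha-x_\beta)_{(\alpha,\beta)}$ $(bo)$-converges to $0$. $E$ is a Banach–Kantorovich space over $L_0$ if it is $d$-decomposable and every $(bo)$-fundamental net $(bo)$-converges; it then carries an $L_0$-module structure with $\|\lambda u\|=|\lambda|\|u\|$ for $\lambda\in L_0$. A $C^*$-algebra over $L_0$ is a complex $*$-algebra $\mathcal U$ that is an $L_0$-module with $(\lambda u)v=\lambda(uv)=u(\lambda v)$ and $(\lambda u)^*=\bar\lambda u^*$ ($\lambda\in L_0$), equipped with an $L_0$-valued norm making it a Banach–Kantorovich space over $L_0$ with this module structure ($\|\lambda u\|=|\lambda|\|u\|$), and such that $\|uv\|\le\|u\|\|v\|$ and $\|u\|^2=\|u^*u\|$. It is unital if it has a unit $e$ with $\|e\|=\mathbf 1$. An element $x\in\mathcal U$ is positive, $x\ge0$, if $x=yy^*$ for some $y\in\mathcal U$. An isometric $*$-isomorphism of $C^*$-algebras over $L_0$ is an $L_0$-linear multiplicative $*$-preserving bijection preserving the $L_0$-valued norms. An $L_0$-state on $\mathcal U$ is an $L_0$-linear map $f:\mathcal U\to L_0$ with $f(xx^* )\ge0$ for all $x$ which is $L_0$-bounded ($|f(x)|\le c\|x\|$ for some $c\in L_0$ and all $x$) with $\|f\|:=\sup\{|f(x)|:\|x\|\le\mathbf 1\}=\mathbf 1$. A Markov operator on a unital $\mathcal U$ is an $L_0$-linear operator $T:\mathcal U\to\mathcal U$ with $Tx\ge0$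 whenever $x\ge0$ and $Te=e$. A state preserving $C^*$-dynamical system over $L_0$ is a triple $(\mathcal U,\varphi,T)$ of a unital $C^*$-algebra $\mathcal U$ over $L_0$, an $L_0$-state $\varphi$ on $\mathcal U$ and a Markov operator $T$ on $\mathcal U$ with $\varphi\circ T=\varphi$. A state preserving $C^*$-dynamical system (over $\mathbb C$) is a triple $(A,\varphi,T)$ of a unital $C^*$-algebra $A$, a state $\varphi$ on $A$, and a Markov operator (positive unital linear map) $T:A\to A$ with $\varphi\circ T=\varphi$. Measurable bundle of $C^*$-algebras: $X$ assigns to each $\omega\in\Omega$ a $C^*$-algebra $X(\omega)\ne\{0\}$. A section is a function $u$ defined a.e. on $\Omega$ with $u(\omega)\in X(\omega)$ on its domain. $(X,L)$, with $L$ a set of sections, is a measurable bundle of $C^*$-algebras if: $L$ is closed under complex linear combinations, products and involution (pointwise on intersections of domains); for each $c\in L$ the function $\omega\mapsto\|c(\omega)\|_{X(\omega)}$ is measurable; and for every $\omega$ the set $\{c(\omega):c\in L,\ \omega\in\mathrm{dom}(c)\}$ is dense in $X(\omega)$. A section $s$ is simple if $s(\omega)=\sum_{i=1}^n\chi_{A_i}(\omega)c_i(\omega)$ for a.e. $\omega$, $c_i\in L$, $A_i\in\Sigma$; a section is measurable if it is an a.e. pointwise norm limit of a sequence of simple sections. $M(\Omega,X)$ is the set of measurable sections; $L_0(\Omega,X)$ is its quotient by a.e. equality; $\widehat u$ is the class of $u$; $\|\widehat u\|\in L_0$ is the class of $\omega\mapsto\|u(\omega)\|_{X(\omega)}$.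 With pointwise operations $L_0(\Omega,X)$ is a $C^*$-algebra over $L_0$. A family of states $\varphi_\omega$ on $X(\omega)$ is a measurable bundle of states if $\omega\mapsto\varphi_\omega(x(\omega))$ is in $M(\Omega)$ for all $x\in M(\Omega,X)$. A family of operators $T_\omega:X(\omega)\to X(\omega)$ is a measurable bundle of Markov operators if $\omega\mapsto T_\omega u(\omega)$ is in $M(\Omega,X)$ for all $u\in M(\Omega,X)$ and $T_\omega$ is a Markov operator for almost all $\omega$. A collection of state preserving $C^*$-dynamical systems $\{(X(\omega),\varphi_\omega,T_\omega):\omega\in\Omega\}$ is a measurable bundle of $C^*$-dynamical systems if $\{T_\omega\}$ is a measurable bundle of Markov operators and $\{\varphi_\omega\}$ is a measurable bundle of states. *)

(* Defs.v *)
From HB Require Import structures.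
From mathcomp Require Import all_boot all_order all_algebra.
From mathcomp Require Import generic_quotient complex.
From mathcomp Require Import all_classical all_reals all_analysis.
From mathcomp Require Import measurable_realfun.

Set Implicit Arguments.
Unset Strict Implicit.
Unset Printing Implicit Defensive.

Import Order.TTheory GRing.Theory Num.Theory.
Import numFieldNormedType.Exports.

Local Open Scope classical_set_scope.
Local Open Scope ring_scope.

Section complex_measurable.
Context (R : realType) (d : measure_display) (T : measurableType d).

Definition cmeasurable (D : set T) (f : T -> R[i]) : Prop :=
  measurable_fun D (fun w => complex.Re (f w)) /\
  measurable_fun D (fun w => complex.Im (f w)).

Record cmfun := CMfun {
  cmfun_fun :> T -> R[i] ;
  cmfunP : cmeasurable setT cmfun_fun }.

HB.instance Definition _ := gen_eqMixin cmfun.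
HB.instance Definition _ := gen_choiceMixin cmfun.

Lemma cmeasurable_cst (c : R[i]) : cmeasurable setT (fun=> c).
Proof. by split; exact: measurable_cst. Qed.

Lemma cmeasurableD (f g : cmfun) : cmeasurable setT (fun w => f w + g w).
Proof.
case: f g => [f [rf jf]] [g [rg jg]]; split => /=.
- rewrite [X in measurable_fun _ X](_ : _ = (fun w => complex.Re (f w) + complex.Re (g w))).
    exact: measurable_funD.
  by apply/funext => w; case: (f w) (g w) => [? ?] [].
- rewrite [X in measurable_fun _ X](_ : _ = (fun w => complex.Im (f w) + complex.Im (g w))).
    exact: measurable_funD.
  by apply/funext => w; case: (f w) (g w) => [? ?] [].
Qed.

Lemma cmeasurableN (f : cmfun) : cmeasurable setT (fun w => - f w).
Proof.
case: f => [f [rf jf]]; split => /=.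
- rewrite [X in measurable_fun _ X](_ : _ = (fun w => - complex.Re (f w))).
    exact: measurable_funN.
  by apply/funext => w; case: (f w).
- rewrite [X in measurable_fun _ X](_ : _ = (fun w => - complex.Im (f w))).
    exact: measurable_funN.
  by apply/funext => w; case: (f w).
Qed.

Lemma cmeasurableM (f g : cmfun) : cmeasurable setT (fun w => f w * g w).
Proof.
case: f g => [f [rf jf]] [g [rg jg]]; split => /=.
- rewrite [X in measurable_fun _ X](_ : _ = (fun w =>
    complex.Re (f w) * complex.Re (g w) - complex.Im (f w) * complex.Im (g w))).
    by apply: measurable_funB; exact: measurable_funM.
  by apply/funext => w; case: (f w) (g w) => [? ?] [].
- rewrite [X in measurable_fun _ X](_ : _ = (fun w =>
    complex.Re (f w) * complex.Im (g w) + complex.Im (f w) * complex.Re (g w))).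
    by apply: measurable_funD; exact: measurable_funM.
  by apply/funext => w; case: (f w) (g w) => [? ?] [].
Qed.

Lemma cmeasurable_conj (f : cmfun) : cmeasurable setT (fun w => conjc (f w)).
Proof.
case: f => [f [rf jf]]; split => /=.
- rewrite [X in measurable_fun _ X](_ : _ = (fun w => complex.Re (f w))) //.
  by apply/funext => w; case: (f w).
- rewrite [X in measurable_fun _ X](_ : _ = (fun w => - complex.Im (f w))).
    exact: measurable_funN.
  by apply/funext => w; case: (f w).
Qed.

Lemma cmeasurable_norm (f : cmfun) : cmeasurable setT (fun w => `|f w|).
Proof.
case: f => [f [rf jf]]; split => /=; last exact: measurable_cst.
rewrite [X in measurable_fun _ X](_ : _ =
  Num.sqrt \o (fun w => complex.Re (f w) ^+ 2 + complex.Im (f w) ^+ 2)).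
  apply: measurableT_comp.
    by apply: continuous_measurable_fun; exact: sqrt_continuous.
  by apply: measurable_funD; exact: measurable_funX.
by apply/funext => w /=; case: (f w).
Qed.

End complex_measurable.

Section L0.
Context (R : realType) (d : measure_display) (T : measurableType d).
Variable mu : {measure set T -> \bar R}.

Local Notation cmfun := (cmfun R T).

Definition ae_eq_cmfun (f g : cmfun) : bool :=
  `[< \forall w \ae mu, f w = g w >].

Lemma ae_eq_cmfun_refl : reflexive ae_eq_cmfun.
Proof. by move=> f; apply/asboolP/aeW. Qed.

Lemma ae_eq_cmfun_sym : symmetric ae_eq_cmfun.
Proof.
move=> f g; apply/idP/idP => /asboolP h; apply/asboolP; move: h;
  by apply: filterS.
Qed.

Lemma ae_eq_cmfun_trans : transitive ae_eq_cmfun.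
Proof.
move=> g f h /asboolP fg /asboolP gh; apply/asboolP; move: fg gh.
by apply: filterS2 => w -> ->.
Qed.

Canonical ae_eq_cmfun_equiv :=
  EquivRel ae_eq_cmfun ae_eq_cmfun_refl ae_eq_cmfun_sym ae_eq_cmfun_trans.

Local Open Scope quotient_scope.

(* Since mu is complete in the sequel, taking total measurable functions here
   instead of a.e.-defined ones does not change the quotient. *)
Definition L0 : Type := {eq_quot ae_eq_cmfun}.
HB.instance Definition _ := Choice.on L0.
HB.instance Definition _ := EqQuotient.on L0.

Definition L0_fun (u : L0) : T -> R[i] := repr u.
Coercion L0_fun : L0 >-> Funclass.

Definition L0_class (f : cmfun) : L0 := \pi_L0 f.

Lemma L0_classE (f : cmfun) : \forall w \ae mu, L0_class f w = f w.
Proof.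
by have /eqquotP/asboolP := reprK (L0_class f).
Qed.

Lemma L0_eqP (u v : L0) : u = v <-> \forall w \ae mu, u w = v w.
Proof.
split=> [->|uv]; first exact: aeW.
by rewrite -(reprK u) -(reprK v); apply/eqquotP/asboolP.
Qed.

Definition L0_cst (c : R[i]) : L0 := L0_class (CMfun (cmeasurable_cst T c)).
Definition L0_add (u v : L0) : L0 :=
  L0_class (CMfun (cmeasurableD (repr u) (repr v))).
Definition L0_opp (u : L0) : L0 := L0_class (CMfun (cmeasurableN (repr u))).
Definition L0_mul (u v : L0) : L0 :=
  L0_class (CMfun (cmeasurableM (repr u) (repr v))).
Definition L0_conj (u : L0) : L0 :=
  L0_class (CMfun (cmeasurable_conj (repr u))).
Definition L0_abs (u : L0) : L0 :=
  L0_class (CMfun (cmeasurable_norm (repr u))).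

Lemma L0_cstE c : \forall w \ae mu, L0_cst c w = c.
Proof. exact: L0_classE. Qed.
Lemma L0_addE u v : \forall w \ae mu, L0_add u v w = u w + v w.
Proof. exact: L0_classE. Qed.
Lemma L0_oppE u : \forall w \ae mu, L0_opp u w = - u w.
Proof. exact: L0_classE. Qed.
Lemma L0_mulE u v : \forall w \ae mu, L0_mul u v w = u w * v w.
Proof. exact: L0_classE. Qed.
Lemma L0_conjE u : \forall w \ae mu, L0_conj u w = conjc (u w).
Proof. exact: L0_classE. Qed.
Lemma L0_absE u : \forall w \ae mu, L0_abs u w = `|u w|.
Proof. exact: L0_classE. Qed.

Lemma L0_addA : associative L0_add.
Proof.
move=> u v w; apply/L0_eqP; near=> x.
rewrite (near (L0_addE u (L0_add v w)) x)// (near (L0_addE v w) x)//.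
by rewrite (near (L0_addE (L0_add u v) w) x)// (near (L0_addE u v) x)// addrA.
Unshelve. all: by end_near. Qed.

Lemma L0_addC : commutative L0_add.
Proof.
move=> u v; apply/L0_eqP; near=> x.
by rewrite (near (L0_addE u v) x)// (near (L0_addE v u) x)// addrC.
Unshelve. all: by end_near. Qed.

Lemma L0_add0 : left_id (L0_cst 0) L0_add.
Proof.
move=> u; apply/L0_eqP; near=> x.
by rewrite (near (L0_addE _ u) x)// (near (L0_cstE 0) x)// add0r.
Unshelve. all: by end_near. Qed.

Lemma L0_addN : left_inverse (L0_cst 0) L0_opp L0_add.
Proof.
move=> u; apply/L0_eqP; near=> x.
rewrite (near (L0_addE _ u) x)// (near (L0_oppE u) x)//.
by rewrite (near (L0_cstE 0) x)// addNr.
Unshelve. all: by end_near. Qed.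

Lemma L0_mulA : associative L0_mul.
Proof.
move=> u v w; apply/L0_eqP; near=> x.
rewrite (near (L0_mulE u (L0_mul v w)) x)// (near (L0_mulE v w) x)//.
by rewrite (near (L0_mulE (L0_mul u v) w) x)// (near (L0_mulE u v) x)// mulrA.
Unshelve. all: by end_near. Qed.

Lemma L0_mulC : commutative L0_mul.
Proof.
move=> u v; apply/L0_eqP; near=> x.
by rewrite (near (L0_mulE u v) x)// (near (L0_mulE v u) x)// mulrC.
Unshelve. all: by end_near. Qed.

Lemma L0_mul1 : left_id (L0_cst 1) L0_mul.
Proof.
move=> u; apply/L0_eqP; near=> x.
by rewrite (near (L0_mulE _ u) x)// (near (L0_cstE 1) x)// mul1r.
Unshelve. all: by end_near. Qed.

Lemma L0_mulDl : left_distributive L0_mul L0_add.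
Proof.
move=> u v w; apply/L0_eqP; near=> x.
rewrite (near (L0_mulE (L0_add u v) w) x)// (near (L0_addE u v) x)//.
rewrite (near (L0_addE (L0_mul u w) (L0_mul v w)) x)//.
by rewrite (near (L0_mulE u w) x)// (near (L0_mulE v w) x)// mulrDl.
Unshelve. all: by end_near. Qed.

HB.instance Definition _ :=
  GRing.isZmodule.Build L0 L0_addA L0_addC L0_add0 L0_addN.
(* "Pz": the ring L0 is trivial when mu = 0. *)
HB.instance Definition _ :=
  GRing.Zmodule_isComPzRing.Build L0 L0_mulA L0_mulC L0_mul1 L0_mulDl.

(* On R[i], [x <= y] means that y - x is real and nonnegative. *)
Definition L0_le (u v : L0) : bool := `[< \forall w \ae mu, u w <= v w >].

Lemma L0_le_refl : reflexive L0_le.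
Proof. by move=> u; apply/asboolP/aeW. Qed.

Lemma L0_le_anti : antisymmetric L0_le.
Proof.
move=> u v /andP[/asboolP uv /asboolP vu]; apply/L0_eqP; move: uv vu.
by apply: filterS2 => w uv vu; apply/eqP; rewrite eq_le uv.
Qed.

Lemma L0_le_trans : transitive L0_le.
Proof.
move=> v u w /asboolP uv /asboolP vw; apply/asboolP; move: uv vw.
by apply: filterS2 => x; exact: le_trans.
Qed.

HB.instance Definition _ := Order.Le_isPOrder.Build ring_display L0
  L0_le_refl L0_le_anti L0_le_trans.

End L0.

Record directed (A : Type) (le : A -> A -> Prop) : Prop := {
  directed_inh : inhabited A ;
  directed_refl : forall a, le a a ;
  directed_trans : forall a b c, le a b -> le b c -> le a c ;
  directed_ub : forall a b, exists c, le a c /\ le b c }.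

Section banach_kantorovich.
Context (R : realType) (d : measure_display) (T : measurableType d).
Variable mu : {measure set T -> \bar R}.
Local Notation L0 := (L0 mu).

(* Order convergence of nets in a vector lattice: the dominating net g
   decreases to 0 and may have its own index set. *)
Definition o_cvg (A : Type) (le : A -> A -> Prop) (e : A -> L0) (l : L0) :=
  exists (B : Type) (leB : B -> B -> Prop) (g : B -> L0),
    [/\ directed leB,
        (forall b b', leB b b' -> g b' <= g b),
        infimums (range g) 0 &
        forall b, exists a0, forall a, le a0 a -> L0_abs (e a - l) <= g b].

Definition L0_disjoint (e1 e2 : L0) : Prop :=
  infimums [set e1; e2] 0.

Section L0_normed.
Variables (E : lmodType L0) (nrm : E -> L0).

Record L0_norm : Prop := {
  L0_norm_ge0 : forall x, 0 <= nrm x ;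
  L0_norm_eq0 : forall x, nrm x = 0 <-> x = 0 ;
  L0_normZ : forall (a : L0) x, nrm (a *: x) = L0_abs a * nrm x ;
  L0_normD : forall x y, nrm (x + y) <= nrm x + nrm y }.

Definition d_decomposable : Prop :=
  forall (x : E) (e1 e2 : L0), 0 <= e1 -> 0 <= e2 -> L0_disjoint e1 e2 ->
    nrm x = e1 + e2 ->
    exists x1 x2, [/\ x = x1 + x2, nrm x1 = e1 & nrm x2 = e2].

Definition bo_cvg (A : Type) (le : A -> A -> Prop) (x : A -> E) (l : E) :=
  o_cvg le (fun a => nrm (x a - l)) 0.

Definition bo_fundamental (A : Type) (le : A -> A -> Prop) (x : A -> E) :=
  bo_cvg (fun p q : A * A => le p.1 q.1 /\ le p.2 q.2)
         (fun p => x p.1 - x p.2) 0.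

Record is_banach_kantorovich : Prop := {
  BK_norm : L0_norm ;
  BK_decomposable : d_decomposable ;
  BK_complete : forall (A : Type) (le : A -> A -> Prop) (x : A -> E),
    directed le -> bo_fundamental le x -> exists l, bo_cvg le x l }.

End L0_normed.
End banach_kantorovich.

(* No unit is assumed, so the product cannot be that of a mathcomp algebra. *)
Record is_star_algebra (K : comPzRingType) (cj : K -> K) (V : lmodType K)
    (mul : V -> V -> V) (star : V -> V) : Prop := {
  sa_mulA : associative mul ;
  sa_mulDl : left_distributive mul +%R ;
  sa_mulDr : right_distributive mul +%R ;
  sa_scaleAl : forall (a : K) x y, a *: mul x y = mul (a *: x) y ;
  sa_scaleAr : forall (a : K) x y, a *: mul x y = mul x (a *: y) ;
  sa_starK : involutive star ;
  sa_starD : {morph star : x y / x + y} ;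
  sa_starZ : forall (a : K) x, star (a *: x) = cj a *: star x ;
  sa_starM : forall x y, star (mul x y) = mul (star y) (star x) }.

Section star_algebra_notions.
Context (K : comPzRingType) (V : lmodType K).
Variables (mul : V -> V -> V) (star : V -> V).

Definition is_unit (e : V) : Prop := forall x, mul e x = x /\ mul x e = x.

Definition positive (x : V) : Prop := exists y, x = mul y (star y).

Definition is_markov (f : {linear V -> V}) : Prop :=
  (forall x, positive x -> positive (f x)) /\ exists2 e, is_unit e & f e = e.

End star_algebra_notions.

Record cstar_algebra (R : realType) := CStarAlgebra {
  cs_sort :> completeNormedModType R[i] ;
  cs_mul : cs_sort -> cs_sort -> cs_sort ;
  cs_star : cs_sort -> cs_sort ;
  cs_star_algebra : is_star_algebra (@conjc R) cs_mul cs_star ;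
  cs_normM : forall x y, `|cs_mul x y| <= `|x| * `|y| ;
  cs_normV : forall x, `|x| ^+ 2 = `|cs_mul (cs_star x) x| }.

(* The complex vector space structure is the restriction of the L0-module
   structure to constant functions. *)
Record cstar_algebra_L0 (R : realType) (d : measure_display)
    (T : measurableType d) (mu : {measure set T -> \bar R}) := CStarAlgebraL0 {
  csL_sort :> lmodType (L0 mu) ;
  csL_mul : csL_sort -> csL_sort -> csL_sort ;
  csL_star : csL_sort -> csL_sort ;
  csL_norm : csL_sort -> L0 mu ;
  csL_star_algebra : is_star_algebra (@L0_conj R d T mu) csL_mul csL_star ;
  csL_BK : is_banach_kantorovich csL_norm ;
  csL_normM : forall x y, csL_norm (csL_mul x y) <= csL_norm x * csL_norm y ;
  csL_normV : forall x, csL_norm x ^+ 2 = csL_norm (csL_mul (csL_star x) x) }.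

Section systems.
Context (R : realType) (A : cstar_algebra R).

Definition is_state (f : {scalar A}) : Prop :=
  (forall x, 0 <= f (cs_mul x (cs_star x))) /\
  supremums [set `|f x| | x in [set x | `|x| <= 1]] 1.

Definition is_state_preserving_system (phi : {scalar A})
    (t : {linear A -> A}) : Prop :=
  [/\ exists e : A, is_unit (@cs_mul _ A) e, is_state phi,
      is_markov (@cs_mul _ A) (@cs_star _ A) t &
      forall x, phi (t x) = phi x].

End systems.

Section systems_L0.
Context (R : realType) (d : measure_display) (T : measurableType d).
Context (mu : {measure set T -> \bar R}) (U : cstar_algebra_L0 mu).

Definition is_L0_state (f : {scalar U}) : Prop :=
  [/\ forall x, 0 <= f (csL_mul x (csL_star x)),
      exists c : L0 mu, forall x, L0_abs (f x) <= c * csL_norm x &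
      supremums [set L0_abs (f x) | x in [set x | csL_norm x <= 1]] 1].

Definition is_L0_state_preserving_system (phi : {scalar U})
    (t : {linear U -> U}) : Prop :=
  [/\ exists2 e : U, is_unit (@csL_mul _ _ _ _ U) e & csL_norm e = 1,
      is_L0_state phi,
      is_markov (@csL_mul _ _ _ _ U) (@csL_star _ _ _ _ U) t &
      forall x, phi (t x) = phi x].

End systems_L0.

Definition olift2 (A B C : Type) (f : A -> B -> C) (x : option A)
    (y : option B) : option C :=
  if x is Some a then if y is Some b then Some (f a b) else None else None.

Section partial_functions.
Context (R : realType) (d : measure_display) (T : measurableType d).
Variable mu : {measure set T -> \bar R}.

(* A function u defined on a part of T is encoded as a total option-valued
   function, equal to None exactly outside the domain of u. *)
Definition ae_defined (Y : T -> Type) (u : forall w, option (Y w)) : Prop :=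
  \forall w \ae mu, isSome (u w).

Definition in_M (g : T -> option R[i]) : Prop :=
  ae_defined g /\ cmeasurable [set w | isSome (g w)] (fun w => odflt 0 (g w)).

Definition represents_L0 (g : T -> option R[i]) (a : L0 mu) : Prop :=
  in_M g /\ \forall w \ae mu, g w = Some (a w).

End partial_functions.

Section bundle.
Context (R : realType) (d : measure_display) (T : measurableType d).
Variables (mu : {measure set T -> \bar R}) (X : T -> cstar_algebra R).

(* Those that are [ae_defined] are the sections. *)
Definition psection := forall w, option (X w).

Definition sec_add (u v : psection) : psection :=
  fun w => olift2 (fun x y => x + y) (u w) (v w).
Definition sec_scale (a : R[i]) (u : psection) : psection :=
  fun w => omap (fun x => a *: x) (u w).
Definition sec_mul (u v : psection) : psection :=
  fun w => olift2 (fun x y => cs_mul x y) (u w) (v w).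
Definition sec_star (u : psection) : psection :=
  fun w => omap (fun x => cs_star x) (u w).
Definition sec_norm (u : psection) : T -> option R[i] :=
  fun w => omap (fun x => `|x|) (u w).

Variable L : set psection.

Record measurable_bundle : Prop := {
  mb_neq0 : forall w, exists x : X w, x <> 0 ;
  mb_section : forall c, L c -> ae_defined mu c ;
  mb_add : forall c c', L c -> L c' -> L (sec_add c c') ;
  mb_scale : forall a c, L c -> L (sec_scale a c) ;
  mb_mul : forall c c', L c -> L c' -> L (sec_mul c c') ;
  mb_star : forall c, L c -> L (sec_star c) ;
  mb_norm : forall c, L c -> in_M mu (sec_norm c) ;
  mb_dense : forall w, dense [set x : X w | exists2 c, L c & c w = Some x] }.

(* The c i being defined a.e., the default value 0 plays no role. *)
Definition simple_section (s : psection) : Prop :=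
  exists (n : nat) (A : 'I_n -> set T) (c : 'I_n -> psection),
    [/\ forall i, measurable (A i), forall i, L (c i) &
        \forall w \ae mu,
          s w = Some (\sum_(i < n) \1_(A i) w *: odflt 0 (c i w))].

Definition measurable_section (u : psection) : Prop :=
  exists s : nat -> psection,
    (forall n, simple_section (s n)) /\
    \forall w \ae mu, exists2 x : X w, u w = Some x &
      (fun n => odflt 0 (s n w)) @ \oo --> x.

Record msection := MSection {
  msection_fun :> forall w, option (X w) ;
  msectionP : measurable_section msection_fun }.

HB.instance Definition _ := gen_eqMixin msection.
HB.instance Definition _ := gen_choiceMixin msection.

Definition ae_eq_msection (u v : msection) : bool :=
  `[< \forall w \ae mu, u w = v w >].

Lemma ae_eq_msection_refl : reflexive ae_eq_msection.
Proof. by move=> f; apply/asboolP/aeW. Qed.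

Lemma ae_eq_msection_sym : symmetric ae_eq_msection.
Proof.
move=> f g; apply/idP/idP => /asboolP h; apply/asboolP; move: h;
  by apply: filterS.
Qed.

Lemma ae_eq_msection_trans : transitive ae_eq_msection.
Proof.
move=> g f h /asboolP fg /asboolP gh; apply/asboolP; move: fg gh.
by apply: filterS2 => w -> ->.
Qed.

Canonical ae_eq_msection_equiv := EquivRel ae_eq_msection
  ae_eq_msection_refl ae_eq_msection_sym ae_eq_msection_trans.

Definition L0_sections : Type := {eq_quot ae_eq_msection}%qT.
HB.instance Definition _ := Choice.on L0_sections.
HB.instance Definition _ := EqQuotient.on L0_sections.

Definition L0_sections_class (u : msection) : L0_sections :=
  (\pi_L0_sections u)%qT.

Definition represents (u : psection) (a : L0_sections) : Prop :=
  exists2 v : msection, (v : psection) = u & L0_sections_class v = a.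

Definition measurable_bundle_of_states (phi : forall w, {scalar X w}) : Prop :=
  (forall w, is_state (phi w)) /\
  forall x, measurable_section x ->
    in_M mu (fun w => omap (phi w) (x w)).

Definition measurable_bundle_of_markov (t : forall w, {linear X w -> X w}) :
    Prop :=
  (forall u, measurable_section u ->
     measurable_section (fun w => omap (t w) (u w))) /\
  \forall w \ae mu, is_markov (@cs_mul _ (X w)) (@cs_star _ (X w)) (t w).

Definition measurable_bundle_of_systems (phi : forall w, {scalar X w})
    (t : forall w, {linear X w -> X w}) : Prop :=
  [/\ forall w, is_state_preserving_system (phi w) (t w),
      measurable_bundle_of_markov t & measurable_bundle_of_states phi].

(* The operations and the norm of L0(T, X) are the pointwise ones, computed on
   arbitrary representatives. *)
Record isometric_star_isomorphism (U : cstar_algebra_L0 mu)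
    (J : U -> L0_sections) : Prop := {
  iso_bij : bijective J ;
  iso_add : forall x y u v, represents u (J x) -> represents v (J y) ->
    represents (sec_add u v) (J (x + y)) ;
  iso_scale : forall (a : L0 mu) x g u,
    represents_L0 g a -> represents u (J x) ->
    represents (fun w => olift2 (fun z y => z *: y) (g w) (u w)) (J (a *: x)) ;
  iso_mul : forall x y u v, represents u (J x) -> represents v (J y) ->
    represents (sec_mul u v) (J (csL_mul x y)) ;
  iso_star : forall x u, represents u (J x) ->
    represents (sec_star u) (J (csL_star x)) ;
  iso_norm : forall x u, represents u (J x) ->
    represents_L0 (sec_norm u) (csL_norm x) }.

End bundle.

(* Main.v *)
(** A von Neumann-Maharam lifting of the measure gives at each point w an ultrafilter
    G w of subsets of Omega that contains the conull sets and along which every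
    measurable function f tends to f(w), for almost every w. On the elements x of U
    whose L0-norm is essentially bounded, the limit of |x| along G w is a C*-seminorm;
    it is complete because U is, and its quotient is the fiber X(w). An arbitrary x is
    divided by 1 + |x| before taking its class in X(w), which is then rescaled: this
    turns x into a measurable section with pointwise norm |x| almost everywhere, and
    every measurable section arises in this way. Both phi and T descend to the fibers as
    soon as they are bounded. For phi this is part of the definition, and phi(e) = 1
    follows from the Cauchy-Schwarz inequality. For T it follows from positivity: if x is
    self-adjoint and |x| < 1 then e - x and e + x are squares, so that e - Tx and
    e + Tx are positive, and an order interval of a C*-algebra is bounded. If the measure
    is zero, the fibers cannot be obtained from U, and any nonzero C*-algebra will do. *)

Require Import Defs.
From HB Require Import structures.
From mathcomp Require Import all_boot all_order all_algebra.
From mathcomp Require Import generic_quotient complex.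
From mathcomp Require Import all_classical all_reals all_analysis.
From mathcomp Require Import measurable_realfun ring lra.

Set Implicit Arguments.
Unset Strict Implicit.
Unset Printing Implicit Defensive.

Import Order.TTheory GRing.Theory Num.Theory.
Import numFieldNormedType.Exports.

Local Open Scope classical_set_scope.
Local Open Scope ring_scope.

(** Fibers, states and Markov operators must satisfy their axioms at every point, while relations in
    [U] hold only almost everywhere. Ultrafilters containing all conull sets bridge this gap: an
    inequality valid almost everywhere passes to the limit at every point, and null sets reappear
    only when an element is compared with its own section.

    The lifting comes from Zorn's lemma applied to lower densities on sub-sigma-algebras. Lower
    densities, rather than liftings, are extended because they survive countable increasing limits,
    by martingale convergence; complements are recovered at the end by the ultrafilters.

    Bounding an order interval is delicate because positive means of the form yy*: without spectral
    theory, even excluding that -cc* is positive for a nonzero c takes work. All is drawn from an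
    iterative square root of 1 - x, |x| < 1, and from polynomial identities. The bound on T is
    proved inside the fibers, which are C*-algebras over the complex numbers, and only then does T
    descend to them. *)

Lemma sa_starN (K : comPzRingType) (cj : K -> K) (V : lmodType K)
    (mul : V -> V -> V) (star : V -> V) :
  is_star_algebra cj mul star -> {morph star : x / - x}.
Proof.
move=> h x; have s0 : star 0 = 0 by apply: (addrI (star 0)); rewrite -(sa_starD h) !addr0.
by apply: (addrI (star x)); rewrite -(sa_starD h) !subrr s0.
Qed.

Record unital_cstar (R : realType) := UnitalCstar {
  uc_alg :> cstar_algebra R ;
  uc_one : uc_alg ;
  uc_unit : is_unit (@cs_mul R uc_alg) uc_one ;
  uc_neq0 : uc_one != 0 }.

(** A copy of the carrier on which the bare product [cs_mul] becomes a ring and algebra structure,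
    so that the notations and lemmas of rings apply. *)
Definition ualg (R : realType) (B : unital_cstar R) : Type := B.

Section ualg_instances.
Context (R : realType) (B : unital_cstar R).
Local Notation A := (ualg B).

HB.instance Definition _ := CompleteNormedModule.on A.

Let mul1 : left_id (uc_one B : A) (@cs_mul R B).
Proof. by move=> x; have [] := @uc_unit R B x. Qed.
Let mulr1 : right_id (uc_one B : A) (@cs_mul R B).
Proof. by move=> x; have [] := @uc_unit R B x. Qed.
HB.instance Definition _ := GRing.Zmodule_isNzRing.Build A
  (sa_mulA (cs_star_algebra B)) mul1 mulr1 (sa_mulDl (cs_star_algebra B))
  (sa_mulDr (cs_star_algebra B)) (uc_neq0 B).
HB.instance Definition _ := GRing.Lmodule_isLalgebra.Build R[i] A
  (sa_scaleAl (cs_star_algebra B)).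
HB.instance Definition _ := GRing.Lalgebra_isAlgebra.Build R[i] A
  (sa_scaleAr (cs_star_algebra B)).
End ualg_instances.

(** * Square roots by iteration *)

Section geometric_iteration.
Context (R : realType).

Lemma geometric_small (K q e : R) : 0 <= q < 1 -> 0 < e ->
  exists n, K * q ^+ n < e.
Proof.
move=> /andP[q0 q1] e0.
have /cvgrPdist_lt : K * q ^+ n @[n --> \oo] --> (0 : R).
  rewrite -(mulr0 K); apply: cvgMr; apply: cvg_expr; by rewrite ger0_norm.
move=> /(_ e e0)[n _ /(_ n (leqnn n))] /=.
by rewrite sub0r normrN => /(le_lt_trans (ler_norm _)) h; exists n.
Qed.

Section sqrt_iteration.
Variables (V : zmodType) (mul : V -> V -> V) (half star : V -> V).
(** [bnd x r] stands for |x| <= r. It is abstract because the iteration is run twice: with the norm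
    of a C*-algebra, and in [U], where a bound means an almost everywhere bound on the L0-norm. The
    factor 2 in [bnd_complete] makes room for [U], whose completeness is used with a single majorant
    of all |u p - u q|, p, q >= n. *)
Variable bnd : V -> R -> Prop.
Hypothesis mulDl : left_distributive mul +%R.
Hypothesis mulDr : right_distributive mul +%R.
Hypothesis mulA : associative mul.
Hypothesis halfD : {morph half : x y / x + y}.
Hypothesis half2 : forall x, half x + half x = x.
Hypothesis mul_halfl : forall x y, mul (half x) y = half (mul x y).
Hypothesis mul_halfr : forall x y, mul x (half y) = half (mul x y).
Hypothesis starD : {morph star : x y / x + y}.
Hypothesis starM : forall x y, star (mul x y) = mul (star y) (star x).
Hypothesis star_half : forall x, star (half x) = half (star x).
Hypothesis bnd_le : forall x r s, r <= s -> bnd x r -> bnd x s.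
Hypothesis bnd0 : bnd 0 0.
Hypothesis bndN : forall x r, bnd x r -> bnd (- x) r.
Hypothesis bndD : forall x y r s, bnd x r -> bnd y s -> bnd (x + y) (r + s).
Hypothesis bndM : forall x y r s, 0 <= r -> 0 <= s ->
  bnd x r -> bnd y s -> bnd (mul x y) (r * s).
Hypothesis bnd_half : forall x r, bnd x r -> bnd (half x) (r / 2).
Hypothesis bnd_star : forall x r, bnd x r -> bnd (star x) r.
Hypothesis bnd_eq0 : forall x, (forall e, 0 < e -> bnd x e) -> x = 0.
Hypothesis bnd_complete : forall (u : nat -> V) (C q : R), 0 <= C -> 0 <= q < 1 ->
  (forall n, bnd (u n.+1 - u n) (C * q ^+ n)) ->
  exists l, forall n, bnd (u n - l) (2 * (C * q ^+ n / (1 - q))).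

Let mulNl x y : mul (- x) y = - mul x y.
Proof.
apply: (addrI (mul x y)); rewrite -mulDl !subrr.
by apply: (addrI (mul 0 y)); rewrite -mulDl !addr0.
Qed.
Let mulNr x y : mul x (- y) = - mul x y.
Proof.
apply: (addrI (mul x y)); rewrite -mulDr !subrr.
by apply: (addrI (mul x 0)); rewrite -mulDr !addr0.
Qed.
Let mul0l y : mul 0 y = 0.
Proof. by apply: (addrI (mul 0 y)); rewrite -mulDl !addr0. Qed.
Let mulr0' y : mul y 0 = 0.
Proof. by apply: (addrI (mul y 0)); rewrite -mulDr !addr0. Qed.
Let star0 : star 0 = 0.
Proof. by apply: (addrI (star 0)); rewrite -starD !addr0. Qed.
Let starN x : star (- x) = - star x.
Proof. by apply: (addrI (star x)); rewrite -starD !subrr star0. Qed.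
Let half0 : half 0 = 0.
Proof. by apply: (addrI (half 0)); rewrite -halfD !addr0. Qed.
Let halfN x : half (- x) = - half x.
Proof. by apply: (addrI (half x)); rewrite -halfD !subrr half0. Qed.

Let geom_eq0 x (K q : R) : 0 <= q < 1 -> (forall n, bnd x (K * q ^+ n)) -> x = 0.
Proof.
move=> q01 h; apply: bnd_eq0 => e e0.
by have [n /ltW Kn] := geometric_small K q01 e0; exact: bnd_le (h n).
Qed.

(* The fixed point y of y = (x + y^2)/2 is 1 - sqrt (1 - x). *)
Lemma sqrt_iteration x (s : R) : 0 < s <= 1 -> bnd x (1 - s ^+ 2) -> star x = x ->
  exists y, [/\ y + y = x + mul y y, star y = y &
    forall z r, 0 <= r -> bnd z r -> mul x z = mul z x -> mul y z = mul z y].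
Proof.
move=> /andP[s0 s1] bx sx.
pose f y := half (x + mul y y).
pose u n := iter n f 0.
(* The ball of radius rho is invariant, since (1 - s^2 + rho^2) / 2 = rho, and f contracts it by the
   factor rho. *)
pose rho := 1 - s.
have rho0 : 0 <= rho by rewrite /rho; lra.
have rho01 : 0 <= rho < 1 by rewrite /rho; lra.
have bu n : bnd (u n) rho.
  elim: n => [|n IH]; first exact: bnd_le bnd0.
  rewrite [u _]/= -/(u n) /f.
  apply: bnd_le (bnd_half (bndD bx (bndM rho0 rho0 IH IH))).
  by rewrite /rho; lra.
have su n : star (u n) = u n.
  elim: n => [|n IH]; first exact: star0.
  by rewrite [u _]/= -/(u n) /f star_half starD starM IH sx.
have cu z : mul x z = mul z x -> forall n, mul (u n) z = mul z (u n).
  move=> xz; elim=> [|n IH]; first by rewrite mul0l mulr0'.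
  rewrite [u _]/= -/(u n) /f mul_halfl mul_halfr mulDl mulDr xz.
  by rewrite -mulA IH mulA IH mulA.
have diff n : u n.+2 - u n.+1 = half (mul (u n.+1) (u n.+1 - u n) +
                                      mul (u n.+1 - u n) (u n)).
  rewrite [u n.+2]/= [u n.+1 in LHS]/= -/(u n) -/(u n.+1) /f.
  rewrite -halfN -halfD; congr half.
  rewrite mulDr mulDl mulNr mulNl [u n.+1]/= -/(u n) -/(f (u n)).
  by rewrite addrA subrK opprD addrACA subrr add0r.
have bd n : bnd (u n.+1 - u n) (rho * rho ^+ n).
  elim: n => [|n IH]; first by rewrite expr0 mulr1 subr0; exact: bu.
  rewrite diff.
  have e0 : 0 <= rho * rho ^+ n by rewrite mulr_ge0// exprn_ge0.
  apply: bnd_le (bnd_half (bndD (bndM rho0 e0 (bu n.+1) IH) (bndM e0 rho0 IH (bu n)))).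
  by rewrite exprS; lra.
have [y hy] := bnd_complete rho0 rho01 bd.
pose K := 2 * (rho / (1 - rho)).
have K0 : 0 <= K by rewrite mulr_ge0// divr_ge0// /rho; lra.
have {}hy n : bnd (u n - y) (K * rho ^+ n).
  by apply: bnd_le (hy n); rewrite /K -mulrA; lra.
have hy' n : bnd (y - u n) (K * rho ^+ n).
  by rewrite -opprB; apply: bndN.
have e0 n : 0 <= K * rho ^+ n by rewrite mulr_ge0// exprn_ge0.
have by_ : bnd y (K + rho).
  have := bndD (hy' 0%N) (bu 0%N); by rewrite subrK expr0 mulr1.
have K1 : 0 <= K + rho by exact: addr_ge0.
exists y; split.
- apply/eqP; rewrite -subr_eq0; apply/eqP.
  apply: (@geom_eq0 _ (K * rho + K * rho + ((K + rho) * K + K * rho)) rho) => // n.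
  have -> : y + y - (x + mul y y) = ((y - u n.+1) + (y - u n.+1)) -
      (mul y (y - u n) + mul (y - u n) (u n)).
    have -> : mul y (y - u n) + mul (y - u n) (u n) = mul y y - mul (u n) (u n).
      by rewrite mulDr mulDl mulNr mulNl addrA subrK.
    have h2 : u n.+1 + u n.+1 = x + mul (u n) (u n) by rewrite /u /= /f half2.
    by rewrite (addrACA y) -opprD h2 -[RHS]addrA -opprD addrACA subrr addr0.
  apply: bnd_le (bndD (bndD (hy' n.+1) (hy' n.+1))
    (bndN (bndD (bndM K1 (e0 n) by_ (hy' n)) (bndM (e0 n) rho0 (hy' n) (bu n))))).
  by rewrite exprS; lra.
- apply/eqP; rewrite -subr_eq0; apply/eqP.
  apply: (@geom_eq0 _ (K + K) rho) => // n.
  have -> : star y - y = star (y - u n) + (u n - y).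
    by rewrite starD starN su addrA subrK.
  by rewrite mulrDl; apply: bndD => //; exact: bnd_star.
- move=> z r r0 bz xz.
  apply/eqP; rewrite -subr_eq0; apply/eqP.
  apply: (@geom_eq0 _ (K * r + r * K) rho) => // n.
  have -> : mul y z - mul z y = mul (y - u n) z + mul z (u n - y).
    by rewrite mulDl mulDr mulNl mulNr cu// addrA subrK.
  apply: bnd_le (bndD (bndM (e0 n) r0 (hy' n) bz) (bndM r0 (e0 n) bz (hy n))).
  by lra.
Qed.
End sqrt_iteration.
End geometric_iteration.

(** * Liftings of a finite complete measure *)

Section lower_density.
Context (R : realType) (d : measure_display) (T : measurableType d).
Variable mu : {finite_measure set T -> \bar R}.
Hypothesis mu_complete : measure_is_complete mu.
Implicit Types A B C E : set T.

Definition aesub A B := mu.-negligible (A `\` B).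

Lemma aesub_refl A : aesub A A.
Proof. by rewrite /aesub setDv; exact: negligible_set0. Qed.

Lemma aesub_measurable A B : measurable A -> aesub A B -> aesub B A -> measurable B.
Proof.
move=> mA AB BA.
have -> : B = (A `\` (A `\` B)) `|` (B `\` A).
  apply/seteqP; split=> x /= => [Bx|[[Ax]|[]//]].
    by have [Ax|Ax] := pselect (A x); [left; split=> // -[]|right].
  by move=> h; apply: contrapT => Bx; apply: h.
by apply: measurableU; [apply: measurableD => //|]; exact: mu_complete.
Qed.

Definition fmu A : R := fine (mu A).

Lemma fmuE A : measurable A -> mu A = (fmu A)%:E.
Proof. by move=> mA; rewrite fineK// fin_num_measure. Qed.

Lemma fmu_ge0 A : 0 <= fmu A.
Proof. exact: fine_ge0. Qed.

Lemma fmu_eq0 A : measurable A -> mu.-negligible A <-> fmu A = 0.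
Proof.
move=> mA; split=> [h|h]; first by rewrite /fmu (measure_negligible mA h).
by apply/negligibleP => //; have e := fmuE mA; rewrite h in e; exact: e.
Qed.

Lemma fmu_le A B : measurable A -> measurable B -> A `<=` B -> fmu A <= fmu B.
Proof. by move=> mA mB AB; rewrite -lee_fin -!fmuE// le_measure// inE. Qed.

Lemma fmuDI A B : measurable A -> measurable B -> fmu A = fmu (A `\` B) + fmu (A `&` B).
Proof.
move=> mA mB; apply: EFin_inj; rewrite EFinD -!fmuE//; [exact: measureDI|exact: measurableI|exact: measurableD].
Qed.

Lemma fmu_aesub A B : measurable A -> measurable B -> aesub A B -> fmu A <= fmu B.
Proof.
move=> mA mB; have mD : measurable (A `\` B) by exact: measurableD.
rewrite /aesub (fmu_eq0 mD) => AB; rewrite (fmuDI mA mB) AB add0r.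
by apply: fmu_le => //; exact: measurableI.
Qed.

Lemma fmuU2 A B : measurable A -> measurable B -> fmu (A `|` B) <= fmu A + fmu B.
Proof.
move=> mA mB; have mAB := measurableU _ _ mA mB.
by rewrite -lee_fin EFinD -!fmuE//; exact: measureU2.
Qed.

Lemma fmu_bigcup_cvg (F : (set T)^nat) : (forall n, measurable (F n)) ->
  fmu (\big[setU/set0]_(i < n.+1) F i) @[n --> \oo] --> fmu (\bigcup_n F n).
Proof.
move=> mF; have mS n : measurable (\big[setU/set0]_(i < n.+1) F i).
  exact: bigsetU_measurable.
rewrite -bigcup_bigsetU_bigcup.
have mU : measurable (\bigcup_n \big[setU/set0]_(i < n.+1) F i) by exact: bigcupT_measurable.
apply: (@fine_cvg _ _ _ eventually_filter (fun n => mu (\big[setU/set0]_(i < n.+1) F i))).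
rewrite -fmuE//; apply: (nondecreasing_cvg_mu mS mU).
by move=> m n mn; apply/subsetPset; apply: subset_bigsetU.
Qed.

Lemma fmu_bigcup_le (F : (set T)^nat) (r : R) : (forall n, measurable (F n)) ->
  (forall n, fmu (\big[setU/set0]_(i < n) F i) <= r) -> fmu (\bigcup_n F n) <= r.
Proof.
move=> mF h; have c := fmu_bigcup_cvg mF; rewrite -(cvg_lim _ c)//.
by apply: limr_le; [apply/cvg_ex; exists (fmu (\bigcup_n F n))|exact: nearW].
Qed.

Lemma fmu_bigcup_tail (F : (set T)^nat) (e : R) : (forall n, measurable (F n)) -> 0 < e ->
  exists n, fmu ((\bigcup_n F n) `\` \big[setU/set0]_(i < n) F i) < e.
Proof.
move=> mF e0; have /cvgrPdist_lt/(_ e e0)[n _ /(_ n (leqnn n))/= h] := fmu_bigcup_cvg mF.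
exists n.+1.
have mU : measurable (\bigcup_n F n) by exact: bigcupT_measurable.
have mS : measurable (\big[setU/set0]_(i < n.+1) F i) by exact: bigsetU_measurable.
apply: le_lt_trans h; apply: le_trans (ler_norm _).
rewrite (fmuDI mU mS) lerBDr lerD2l; apply: fmu_le => //; first exact: measurableI.
move=> x Sx; split => //; move: Sx; rewrite -bigcup_mkord => -[i _ Fix_]; by exists i.
Qed.

Record sigma_sub (B : set (set T)) : Prop := {
  ss_meas : forall A, B A -> measurable A ;
  ss_C : forall A, B A -> B (~` A) ;
  ss_bigcup : forall F : (set T)^nat, (forall n, B (F n)) -> B (\bigcup_n F n) ;
  ss_null : forall A, mu.-negligible A -> B A }.

Section sigma_sub_theory.
Variables (F : set (set T)) (sF : sigma_sub F).
Lemma ss0 : F set0.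
Proof. by apply: (ss_null sF); exact: negligible_set0. Qed.
Lemma ssT : F setT.
Proof. by rewrite -setC0; apply: (ss_C sF); exact: ss0. Qed.
Lemma ssU A B : F A -> F B -> F (A `|` B).
Proof.
move=> FA FB; rewrite -bigcup2E; apply: (ss_bigcup sF) => -[|[|n]] //=; exact: ss0.
Qed.
Lemma ssI A B : F A -> F B -> F (A `&` B).
Proof.
by move=> FA FB; rewrite -(setCK (_ `&` _)) setCI; apply/(ss_C sF)/ssU; exact/(ss_C sF).
Qed.
Lemma ssD A B : F A -> F B -> F (A `\` B).
Proof. by move=> FA FB; rewrite setDE; apply: ssI => //; exact/(ss_C sF). Qed.

(* Hahn decomposition of [mu (A & -) - q mu] on the sub-sigma-algebra F. *)
Lemma ss_hahn A (q : R) : measurable A -> exists P, [/\ F P,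
  forall C, F C -> C `<=` P -> q * fmu C <= fmu (A `&` C) &
  forall C, F C -> C `<=` ~` P -> fmu (A `&` C) <= q * fmu C].
Proof.
move=> mA.
pose nu := cadd (charge_of_finite_measure (mrestr mu mA))
  (cscale (- q) (charge_of_finite_measure mu)).
(* The space is given the measurable structure F and [nu] is pushed forward along the identity, so
   that the Hahn set lies in F. *)
pose T' := g_sigma_algebraType F.
have FE : (measurable : set (set T')) = F.
  apply: sigma_algebra_id; split; first exact: ss0.
    by move=> B FB; rewrite setTD; exact: (ss_C sF).
  exact: (ss_bigcup sF).
have mid : measurable_fun setT (id : T -> T').
  by move=> _ B; rewrite setTI FE; exact: (ss_meas sF).
have [P [N [[mP pP] [mN nN] PN0 PN]]] := Hahn_decomposition (pushforward nu (id : T -> T')).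
have nuE C : F C -> pushforward nu (id : T -> T') C = (fmu (A `&` C) - q * fmu C)%:E.
  move=> FC; have mC := ss_meas sF FC.
  have mAC : measurable (A `&` C) by exact: measurableI.
  have -> : pushforward nu (id : T -> T') C = (mu (A `&` C) + (- q)%:E * mu C)%E.
    by rewrite (setIC A).
  by rewrite (fmuE mC) (fmuE mAC) -EFinM -EFinD mulNr.
exists P; split; first by rewrite -FE.
- move=> C FC CP; have mC : measurable (C : set T') by rewrite FE.
  have h : (0 <= pushforward nu (id : T -> T') C)%E := pP C mC CP.
  by rewrite nuE// lee_fin subr_ge0 in h.
- move=> C FC CP; have mC : measurable (C : set T') by rewrite FE.
  suff CN : C `<=` N.
    have h : (pushforward nu (id : T -> T') C <= 0)%E := nN C mC CN.
    by rewrite nuE// lee_fin subr_le0 in h.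
  move=> x Cx.
  have : (P `|` N) x by rewrite PN0.
  by case=> // Px; have := CP x Cx.
Qed.
End sigma_sub_theory.

(** A lower density: [th] depends only on the class of a set, since it is monotone for almost
    everywhere inclusion, and it respects intersections but not necessarily complements. *)
Record density (B : set (set T)) (th : set T -> set T) : Prop := {
  den_ss : sigma_sub B ;
  den_ge : forall A, B A -> aesub A (th A) ;
  den_le : forall A, B A -> aesub (th A) A ;
  den_mono : forall A A', B A -> B A' -> aesub A A' -> th A `<=` th A' ;
  den_I : forall A A', B A -> B A' -> th A `&` th A' `<=` th (A `&` A') ;
  den_0 : th set0 = set0 ;
  den_T : th setT = setT }.

Section adjunction.
Variables (F : set (set T)) (th : set T -> set T) (dF : density F th).
Variable E : set T.
Hypothesis mE : measurable E.
Let sF := den_ss dF.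

(* The complement of the F-measurable hull of E. *)
Lemma ss_hull : exists D, [/\ F D, mu.-negligible (D `&` E) &
  forall C, F C -> mu.-negligible (C `&` E) -> mu.-negligible (C `\` D)].
Proof.
have /choice[P hP] : forall k : nat, exists P, [/\ F P,
  forall C, F C -> C `<=` P -> 2^-1 ^+ k * fmu C <= fmu (E `&` C) &
  forall C, F C -> C `<=` ~` P -> fmu (E `&` C) <= 2^-1 ^+ k * fmu C].
  by move=> k; exact: ss_hahn.
(* D is where the conditional expectation of 1_E given F vanishes; off D it is at least 2^-k for
   some k. *)
pose D := ~` \bigcup_k P k.
have FU : F (\bigcup_k P k) by apply: (ss_bigcup sF) => k; have [] := hP k.
have FD : F D by exact: (ss_C sF).
exists D; split => //.
- have mDE : measurable (D `&` E) by apply: measurableI => //; exact: (ss_meas sF).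
  apply/(fmu_eq0 mDE)/eqP; rewrite eq_le fmu_ge0 andbT; apply/ler_addgt0Pr => e e0.
  have [k hk] := @geometric_small R (fmu D) 2^-1 e ltac:(lra) e0.
  have [_ _ /(_ D FD)] := hP k; rewrite setIC mulrC => h.
  by rewrite add0r; apply: le_trans (ltW hk); apply: h => x Dx Px; apply: Dx; exists k.
- move=> C FC CE; have mC := ss_meas sF FC.
  have -> : C `\` D = \bigcup_k (C `&` P k).
    by rewrite setDE setCK setI_bigcupr.
  apply: negligible_bigcup => k; have [FP hP1 _] := hP k.
  have FCP : F (C `&` P k) by exact: ssI.
  apply/(fmu_eq0 (ss_meas sF FCP))/eqP; rewrite eq_le fmu_ge0 andbT.
  have q0 : 0 < (2^-1 : R) ^+ k by rewrite exprn_gt0.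
  rewrite -(pmulr_rle0 _ q0); apply: le_trans (hP1 _ FCP _) _ => //.
  have mECP : measurable (E `&` (C `&` P k)) by apply: measurableI => //; exact: (ss_meas sF).
  suff /(fmu_eq0 mECP) -> : mu.-negligible (E `&` (C `&` P k)) by [].
  by apply: negligibleS CE => x [? []].
Qed.

End adjunction.

(** The sets generated by F and E are the [glue A B], equal to A on E and to B off E. The pair is
    not unique: A may be changed on D, off the hull of E. Taking B there, as [inn] does, fixes the
    choice up to null sets, since almost all of D lies outside E, where the glued set is B. The set
    [out] plays the same part for the complement of E. *)
Lemma density_extend F th E : density F th -> measurable E ->
  exists F' th', [/\ density F' th', F `<=` F', forall A, F A -> th A = th' A & F' E].
Proof.
move=> dF mE; have sF := den_ss dF.
have [D [FD DE hD]] := ss_hull dF mE.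
have [D' [FD' DE' hD']] := ss_hull dF (measurableC mE).
pose glue A B := (A `&` E) `|` (B `\` E).
pose inn A B := (A `\` D) `|` (B `&` D).
pose out A B := (B `\` D') `|` (A `&` D').
have Finn A B : F A -> F B -> F (inn A B).
  by move=> FA FB; apply: (ssU sF); [exact: ssD|exact: ssI].
have Fout A B : F A -> F B -> F (out A B).
  by move=> FA FB; apply: (ssU sF); [exact: ssD|exact: ssI].
have mglue A B : F A -> F B -> measurable (glue A B).
  move=> /(ss_meas sF) mA /(ss_meas sF) mB.
  by apply: measurableU; [exact: measurableI|exact: measurableD].
have inn_mono A B A' B' : F A -> F B -> F A' -> F B' ->
    aesub (glue A B) (glue A' B') -> aesub (inn A B) (inn A' B').
  move=> FA FB FA' FB' h.
  have h1 : mu.-negligible ((A `\` A') `\` D).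
    apply: hD; first exact: ssD.
    apply: negligibleS h => x [[Ax A'x] Ex]; split; first by left.
    by case=> -[].
  have h2 : mu.-negligible (((B `\` B') `&` D) `\` D').
    apply: hD'; first by apply: ssI => //; exact: ssD.
    apply: negligibleS h => x [[[Bx B'x] Dx] Ex]; split; first by right.
    by case=> -[].
  have h3 : mu.-negligible (D `&` D').
    apply: negligibleS (negligibleU DE DE') => x [Dx D'x].
    by have [Ex|Ex] := pselect (E x); [left|right].
  apply: negligibleS (negligibleU h1 (negligibleU h2 h3)) => x [inx inx'].
  case: inx => [[Ax Dx]|[Bx Dx]].
    by left; split => //; split => // A'x; apply: inx'; left.
  right; have [D'x|D'x] := pselect (D' x); first by right.
  by left; split => //; split => //; split => // B'x; apply: inx'; right.
have out_mono A B A' B' : F A -> F B -> F A' -> F B' ->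
    aesub (glue A B) (glue A' B') -> aesub (out A B) (out A' B').
  move=> FA FB FA' FB' h.
  have h1 : mu.-negligible ((B `\` B') `\` D').
    apply: hD'; first exact: ssD.
    apply: negligibleS h => x [[Bx B'x] Ex]; split; first by right.
    by case=> -[].
  have h2 : mu.-negligible (((A `\` A') `&` D') `\` D).
    apply: hD; first by apply: ssI => //; exact: ssD.
    apply: negligibleS h => x [[[Ax A'x] Dx] Ex]; split; first by left.
    by case=> -[].
  have h3 : mu.-negligible (D `&` D').
    apply: negligibleS (negligibleU DE DE') => x [Dx D'x].
    by have [Ex|Ex] := pselect (E x); [left|right].
  apply: negligibleS (negligibleU h1 (negligibleU h2 h3)) => x [inx inx'].
  case: inx => [[Bx Dx]|[Ax Dx]].
    by left; split => //; split => // B'x; apply: inx'; left.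
  right; have [Dx'|Dx'] := pselect (D x); first by right.
  by left; split => //; split => //; split => // A'x; apply: inx'; right.
pose F' X := exists A B, [/\ F A, F B & X = glue A B].
(* Quantifying over all representations makes th' a function of the set alone; [thE] shows that any
   single representation computes it. *)
pose th' X := [set x | exists A B, [/\ F A, F B, X = glue A B &
  (E x /\ th (inn A B) x) \/ (~ E x /\ th (out A B) x)]].
have thE A B : F A -> F B -> th' (glue A B) =
    (th (inn A B) `&` E) `|` (th (out A B) `\` E).
  move=> FA FB; apply/seteqP; split=> x /=.
    move=> [A' [B' [FA' FB' eq h]]].
    have le : aesub (glue A' B') (glue A B) by rewrite eq; exact: aesub_refl.
    case: h => -[Ex hx]; [left|right]; split => //.
      by apply: (den_mono dF) hx; [exact: Finn|exact: Finn|exact: inn_mono].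
    by apply: (den_mono dF) hx; [exact: Fout|exact: Fout|exact: out_mono].
  by move=> [[hx Ex]|[hx Ex]]; exists A, B; split=> //; [left|right].
have glue_id A : glue A A = A.
  by rewrite /glue setDE -setIUr setUv setIT.
have inn_id A : inn A A = A.
  by rewrite /inn setUC setDE -setIUr setUv setIT.
have out_id A : out A A = A.
  by rewrite /out setUC setDE -setIUr setUv setIT.
have FF' A : F A -> F' A by move=> FA; exists A, A; rewrite glue_id.
exists F', th'; split.
- split.
  + split.
    * by move=> _ [A [B [FA FB ->]]]; exact: mglue.
    * move=> _ [A [B [FA FB ->]]]; exists (~` A), (~` B); split; [exact: (ss_C sF)..|].
      apply/seteqP; split=> x /=; rewrite /glue /=.
        move=> h; have [Ex|Ex] := pselect (E x).
          by left; split=> // Ax; apply: h; left.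
        by right; split=> // Bx; apply: h; right.
      by move=> [[Ax Ex]|[Bx Ex]] [[]|[]].
    * move=> G /choice[A /choice[B h]].
      exists (\bigcup_n A n), (\bigcup_n B n); split.
      - by apply: (ss_bigcup sF) => n; have [] := h n.
      - by apply: (ss_bigcup sF) => n; have [] := h n.
      - rewrite /glue setI_bigcupl setD_bigcupl -bigcupU.
        by apply: eq_bigcupr => n _; have [] := h n.
    * by move=> A /(ss_null sF)/FF'.
  + move=> _ [A [B [FA FB ->]]]; rewrite thE//.
    apply: negligibleS (negligibleU (negligibleU (den_ge dF (Finn _ _ FA FB)) DE)
      (negligibleU (den_ge dF (Fout _ _ FA FB)) DE')) => x [[[Ax Ex]|[Bx Ex]] hx].
    - left; have [Dx|Dx] := pselect (D x); [by right|left].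
      by split; [left|move=> ix; apply: hx; left].
    - right; have [Dx|Dx] := pselect (D' x); [by right|left].
      by split; [left|move=> ix; apply: hx; right].
  + move=> _ [A [B [FA FB ->]]]; rewrite thE//.
    apply: negligibleS (negligibleU (negligibleU (den_le dF (Finn _ _ FA FB)) DE)
      (negligibleU (den_le dF (Fout _ _ FA FB)) DE')) => x [[[hx Ex]|[hx Ex]] gx].
    - left; have [Dx|Dx] := pselect (D x); [by right|left].
      by split => // -[[Ax _]|[_ ?]] //; apply: gx; left.
    - right; have [Dx|Dx] := pselect (D' x); [by right|left].
      by split => // -[[Ax _]|[_ ?]] //; apply: gx; right.
  + move=> _ _ [A [B [FA FB ->]]] [A' [B' [FA' FB' ->]]] le; rewrite !thE//.
    move=> x [[hx Ex]|[hx Ex]]; [left|right]; split => //.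
      by apply: (den_mono dF) hx; [exact: Finn|exact: Finn|exact: inn_mono].
    by apply: (den_mono dF) hx; [exact: Fout|exact: Fout|exact: out_mono].
  + move=> _ _ [A [B [FA FB ->]]] [A' [B' [FA' FB' ->]]].
    have -> : glue A B `&` glue A' B' = glue (A `&` A') (B `&` B').
      apply/seteqP; split=> x; rewrite /glue /=; tauto.
    have FAA : F (A `&` A') by exact: ssI.
    have FBB : F (B `&` B') by exact: ssI.
    rewrite !thE// => x [h1 h2].
    have hin : th (inn A B) `&` th (inn A' B') `<=` th (inn (A `&` A') (B `&` B')).
      have -> : inn (A `&` A') (B `&` B') = inn A B `&` inn A' B'.
        by apply/seteqP; split=> y; rewrite /inn /=; tauto.
      by apply: (den_I dF); exact: Finn.
    have hout : th (out A B) `&` th (out A' B') `<=` th (out (A `&` A') (B `&` B')).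
      have -> : out (A `&` A') (B `&` B') = out A B `&` out A' B'.
        by apply/seteqP; split=> y; rewrite /out /=; tauto.
      by apply: (den_I dF); exact: Fout.
    case: h1 => -[h1 Ex]; case: h2 => -[h2 Ex'] //.
      by left; split => //; exact: hin.
    by right; split => //; exact: hout.
  + by rewrite -(glue_id set0) thE ?inn_id ?out_id ?(den_0 dF) ?set0I ?set0D ?setU0//; exact: ss0.
  + by rewrite -(glue_id setT) thE ?inn_id ?out_id ?(den_T dF) -/(glue _ _) ?glue_id//; exact: ssT.
- exact: FF'.
- by move=> A FA; rewrite -{2}(glue_id A) thE// inn_id out_id -/(glue _ _) glue_id.
- exists setT, set0; split; [exact: ssT|exact: ss0|].
  by rewrite /glue setTI set0D setU0.
Qed.

Section increasing_densities.
Variables (B : nat -> set (set T)) (th : nat -> set T -> set T).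
Hypothesis dB : forall n, density (B n) (th n).
Hypothesis BS : forall n, B n `<=` B n.+1.
Hypothesis thS : forall n A, B n A -> th n.+1 A = th n A.

Let ssB n := den_ss (dB n).

Let Bmono m n : (m <= n)%N -> B m `<=` B n.
Proof.
move=> /subnK <-; elim: (n - m)%N => [//|k IH] A /IH; rewrite addSn; exact: BS.
Qed.

Let thmono m n A : (m <= n)%N -> B m A -> th n A = th m A.
Proof.
move=> /subnK <- BA; elim: (n - m)%N => [//|k IH]; rewrite addSn thS//.
by apply: Bmono BA; exact: leq_addl.
Qed.

(** In effect the sigma-algebra generated by the [B n], described as the closure of their union for
    the measure of the symmetric difference. This is the form in which [thinf_ge] uses it. *)
Let Binf A := measurable A /\ forall e : R, 0 < e -> exists n A',
  B n A' /\ fmu (A `\` A') + fmu (A' `\` A) < e.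

Let B_Binf n : B n `<=` Binf.
Proof.
move=> A BA; split; first exact: (ss_meas (ssB n)).
by move=> e e0; exists n, A; split => //; rewrite setDv /fmu measure0 addr0.
Qed.

Let Binf_ss : sigma_sub Binf.
Proof.
split.
- by move=> A [].
- move=> A [mA hA]; split; first exact: measurableC.
  move=> e /hA [n [A' [BA' lt]]]; exists n, (~` A'); split; first exact: (ss_C (ssB n)).
  by rewrite !setDE !setCK addrC (setIC (~` A')) (setIC (~` A)) -!setDE.
- move=> F BF.
  have mF n : measurable (F n) by have [] := BF n.
  split; first exact: bigcupT_measurable.
  move=> e e0; have e2 : 0 < e / 2 by rewrite divr_gt0.
  have [N hN] := fmu_bigcup_tail mF e2.
  have [n [A' [BA' lt]]] : exists n A', B n A' /\
      fmu (\big[setU/set0]_(i < N) F i `\` A') +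
      fmu (A' `\` \big[setU/set0]_(i < N) F i) < e / 2.
    elim: N e e0 e2 {hN} => [|N IH] e e0 e2.
      exists 0%N, set0; split; first exact: (ss0 (ssB 0)).
      by rewrite big_ord0 setD0 /fmu measure0 addr0.
    have e4 : 0 < e / 2 / 2 by rewrite divr_gt0.
    have [n [A' [BA' lt]]] := IH _ e2 e4.
    have [n' [A'' [BA'' lt']]] := (BF N).2 _ e4.
    exists (maxn n n'), (A' `|` A''); split.
      by apply: (ssU (ssB _)); [apply: Bmono BA'; exact: leq_maxl|apply: Bmono BA''; exact: leq_maxr].
    rewrite big_ord_recr/=; set S := \big[setU/set0]_(i < N) _ in lt *.
    have mS : measurable S by exact: bigsetU_measurable.
    have mA' := ss_meas (ssB n) BA'; have mA'' := ss_meas (ssB n') BA''.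
    have h1 : fmu ((S `|` F N) `\` (A' `|` A'')) <= fmu (S `\` A') + fmu (F N `\` A'').
      apply: le_trans (fmuU2 _ _); [|exact: measurableD..].
      apply: fmu_le; [|by apply: measurableU; exact: measurableD|].
        by apply: measurableD; exact: measurableU.
      by move=> x [[Sx|Fx] h]; [left|right]; split => // ?; apply: h; [left|right].
    have h2 : fmu ((A' `|` A'') `\` (S `|` F N)) <= fmu (A' `\` S) + fmu (A'' `\` F N).
      apply: le_trans (fmuU2 _ _); [|exact: measurableD..].
      apply: fmu_le; [|by apply: measurableU; exact: measurableD|].
        by apply: measurableD; exact: measurableU.
      by move=> x [[Sx|Fx] h]; [left|right]; split => // ?; apply: h; [left|right].
    by lra.
  exists n, A'; split => //.
  have mA' := ss_meas (ssB n) BA'.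
  set S := \big[setU/set0]_(i < N) _ in lt hN.
  have mS : measurable S by exact: bigsetU_measurable.
  set U := \bigcup_n _ in hN *.
  have mU : measurable U by exact: bigcupT_measurable.
  have h1 : fmu (U `\` A') <= fmu (U `\` S) + fmu (S `\` A').
    apply: le_trans (fmuU2 _ _); [|exact: measurableD..].
    apply: fmu_le; [exact: measurableD|by apply: measurableU; exact: measurableD|].
    by move=> x [Ux A'x]; have [Sx|Sx] := pselect (S x); [right|left].
  have h2 : fmu (A' `\` U) <= fmu (A' `\` S).
    apply: fmu_le; [exact: measurableD..|].
    move=> x [A'x Ux]; split => // Sx; apply: Ux; move: Sx.
    by rewrite /S -bigcup_mkord => -[i _ Fi]; exists i.
  by lra.
- move=> A nA; apply: (@B_Binf 0%N); exact: (ss_null (ssB 0)).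
Qed.

Let q k : R := 1 - 2^-1 ^+ k.+1.

Let hahn_ex n k A : exists P, measurable A -> [/\ B n P,
  forall C, B n C -> C `<=` P -> q k * fmu C <= fmu (A `&` C) &
  forall C, B n C -> C `<=` ~` P -> fmu (A `&` C) <= q k * fmu C].
Proof.
have [mA|nA] := pselect (measurable A); last by exists set0.
by have [P hP] := ss_hahn (ssB n) (q k) mA; exists P.
Qed.

Let P n k A := sval (cid (hahn_ex n k A)).

Let PB n k A : measurable A -> B n (P n k A).
Proof. by move=> mA; have [] := svalP (cid (hahn_ex n k A)) mA. Qed.
Let P_ge n k A C : measurable A -> B n C -> C `<=` P n k A -> q k * fmu C <= fmu (A `&` C).
Proof. by move=> mA; have [_ h _] := svalP (cid (hahn_ex n k A)) mA; exact: h. Qed.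
Let P_le n k A C : measurable A -> B n C -> C `<=` ~` P n k A -> fmu (A `&` C) <= q k * fmu C.
Proof. by move=> mA; have [_ _ h] := svalP (cid (hahn_ex n k A)) mA; exact: h. Qed.

(* P n k A is the set where the conditional expectation of 1_A given B n is at
   least 1 - 2^-(k+1); thinf A is where these expectations tend to 1. *)
Let thinf A := \bigcap_k \bigcup_n \bigcap_m th (n + m)%N (P (n + m)%N k A).

Let q_gt0 k : 0 < q k.
Proof.
rewrite subr_gt0 exprn_ilt1 ?invr_ge0 ?invf_lt1 ?ltr1n//.
Qed.

Let q_lt1 k : q k < 1.
Proof. by rewrite gtrDl oppr_lt0 exprn_gt0. Qed.

Let qS k : q k < q k.+1.
Proof.
have : 0 < (2^-1 : R) ^+ k.+1 by rewrite exprn_gt0.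
by rewrite /q (exprS _ k.+1); lra.
Qed.

Let qSS k : q k < 2 * q k.+2 - 1.
Proof.
have : 0 < (2^-1 : R) ^+ k.+1 by rewrite exprn_gt0.
by rewrite /q 2!(exprS _ _.+1); lra.
Qed.

Let null_of_lt (C : set T) (a b : R) : measurable C -> a < b -> b * fmu C <= a * fmu C ->
  mu.-negligible C.
Proof.
move=> mC ab h; apply/(fmu_eq0 mC)/eqP; rewrite eq_le fmu_ge0 andbT leNgt; apply/negP => C0.
by move: h; rewrite ler_pM2r// leNgt ab.
Qed.

(** A Hahn set is arbitrary where the conditional expectation equals its threshold, so the
    thresholds must drop strictly: on the difference set the two bounds contradict each other unless
    it is null. *)
Let P_mono n k A A' : measurable A -> measurable A' -> aesub A A' ->
  aesub (P n k.+1 A) (P n k A').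
Proof.
move=> mA mA' AA'.
have BC : B n (P n k.+1 A `\` P n k A') by apply: (ssD (ssB n)); exact: PB.
have mC := ss_meas (ssB n) BC.
apply: (null_of_lt mC (qS k)).
apply: le_trans (P_ge mA BC _) _; first by move=> x [].
apply: le_trans _ (P_le mA' BC _); last by move=> x [].
apply: fmu_aesub; [exact: measurableI..|].
by apply: negligibleS AA' => x [[Ax Cx]] h; split => // A'x; apply: h.
Qed.

(** Where two sets both have conditional expectation at least q, their intersection has at least 2q
    - 1. Going down two levels leaves room, as q k < 2 * q k.+2 - 1. *)
Let P_I n k A A' : measurable A -> measurable A' ->
  aesub (P n k.+2 A `&` P n k.+2 A') (P n k (A `&` A')).
Proof.
move=> mA mA'; have mAA := measurableI _ _ mA mA'.
have BC : B n ((P n k.+2 A `&` P n k.+2 A') `\` P n k (A `&` A')).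
  by apply: (ssD (ssB n)); [apply: (ssI (ssB n))|]; exact: PB.
set C := _ `\` _ in BC *; have mC := ss_meas (ssB n) BC.
apply: (null_of_lt mC (qSS k)).
apply: le_trans _ (P_le mAA BC _); last by move=> x [].
have h1 : q k.+2 * fmu C <= fmu (A `&` C) by apply: (P_ge mA BC) => x [[]].
have h2 : q k.+2 * fmu C <= fmu (A' `&` C) by apply: (P_ge mA' BC) => x [[]].
have mAC : measurable (A `&` C) by exact: measurableI.
have mA'C : measurable (A' `&` C) by exact: measurableI.
have e1 := fmuDI mAC mA'C; have e2 := fmuDI mC mA'C.
have e3 : fmu (A `&` C `\` (A' `&` C)) <= fmu (C `\` (A' `&` C)).
  by apply: fmu_le; [exact: measurableD..|move=> x [[]]].
have e4 : A `&` C `&` (A' `&` C) = A `&` A' `&` C by rewrite setIACA setIid.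
have e5 : C `&` (A' `&` C) = A' `&` C by rewrite setIC -setIA setIid.
by rewrite e4 in e1; rewrite e5 in e2; lra.
Qed.

Let P_id n k A : B n A -> aesub A (P n k A) /\ aesub (P n k A) A.
Proof.
move=> BA; have mA := ss_meas (ssB n) BA.
have BC : B n (A `\` P n k A) by apply: (ssD (ssB n)) => //; exact: PB.
have BC' : B n (P n k A `\` A) by apply: (ssD (ssB n)) => //; exact: PB.
split.
- have mC := ss_meas (ssB n) BC; apply: (null_of_lt mC (q_lt1 k)); rewrite mul1r.
  apply: le_trans _ (P_le mA BC _); last by move=> x [].
  by rewrite (_ : A `&` _ = A `\` P n k A)// setDE setIA setIid.
- have mC := ss_meas (ssB n) BC'; apply: (null_of_lt mC (q_gt0 k)); rewrite mul0r.
  apply: le_trans (P_ge mA BC' _) _; first by move=> x [].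
  by rewrite (_ : A `&` _ = set0) ?/fmu ?measure0// setDE setIA setIC setIA setICl set0I.
Qed.

Let thinf_id n A : B n A -> thinf A = th n A.
Proof.
move=> BA; have e m k : (n <= m)%N -> th m (P m k A) = th n A.
  move=> nm; rewrite -(thmono nm BA); have BmA := Bmono nm BA.
  have [h1 h2] := P_id k BmA; have BP : B m (P m k A).
    by apply: PB; exact: (ss_meas (ssB n)).
  by apply/seteqP; split; apply: (den_mono (dB m)).
apply/seteqP; split=> x.
  move=> /(_ 0%N I)[m _ /(_ n I)]; by rewrite e// leq_addl.
by move=> hx k _; exists n => // m _; rewrite e// leq_addr.
Qed.

Let thinf_mono A A' : measurable A -> measurable A' -> aesub A A' -> thinf A `<=` thinf A'.
Proof.
move=> mA mA' AA' x hx k _; have [n _ hn] := hx k.+1 I; exists n => // m _.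
by apply: (den_mono (dB (n + m))) (hn m I); [exact: PB|exact: PB|exact: P_mono].
Qed.

Let thinf_I A A' : measurable A -> measurable A' -> thinf A `&` thinf A' `<=` thinf (A `&` A').
Proof.
move=> mA mA' x [hx hx'] k _; have mAA := measurableI _ _ mA mA'.
have [n _ hn] := hx k.+2 I; have [n' _ hn'] := hx' k.+2 I.
exists (n + n')%N => // m _.
have h1 := hn (n' + m)%N I; have h2 := hn' (n + m)%N I.
rewrite addnA in h1; rewrite addnCA addnA in h2.
have Bp := PB (n + n' + m) k.+2 mA; have Bp' := PB (n + n' + m) k.+2 mA'.
apply: (den_mono (dB _)) (den_I (dB _) Bp Bp' (conj h1 h2)).
- exact: (ssI (ssB _)).
- exact: PB.
- exact: P_I.
Qed.

(** Martingale convergence for 1_A. Let A' in B n approximate A. A point of A that fails level k is,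
    up to null sets, in A \ A' or in some N j, the part of A' where the expectation at time n + j is
    at most q k. The maximal inequality bounds the union of the N j by the measure of A' \ A divided
    by 1 - q k. *)
Let thinf_ge A : Binf A -> aesub A (thinf A).
Proof.
move=> [mA hA].
rewrite /aesub /thinf setDE setC_bigcap setI_bigcupr; apply: negligible_bigcup => k.
have mth m : measurable (th m (P m k A)).
  have BP := PB m k mA; have mP := ss_meas (ssB m) BP.
  by apply: (aesub_measurable mP); [exact: (den_ge (dB m))|exact: (den_le (dB m))].
set X := \bigcup_n _.
have mX : measurable X.
  by apply: bigcupT_measurable => n; apply: bigcapT_measurable => m; exact: mth.
have mAX : measurable (A `&` ~` X) by apply: measurableI => //; exact: measurableC.
(* Where the conditional expectation of 1_A is at most q k, that of its complement is at least c.
   The final estimate is (1 + c^-1) times the approximation error, whence the tolerance e / (1 +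
   c^-1). *)
pose c : R := 1 - q k; have c0 : 0 < c by rewrite subr_gt0.
have c1 : 0 < 1 + c^-1 by rewrite addr_gt0// invr_gt0.
apply/(fmu_eq0 mAX)/eqP; rewrite eq_le fmu_ge0 andbT; apply/ler_addgt0Pr => e e0.
rewrite add0r; have e1 : 0 < e / (1 + c^-1) by rewrite divr_gt0.
have [n [A' [BA' lt]]] := hA _ e1.
have mA' := ss_meas (ssB n) BA'.
have mD : measurable (A' `\` A) by exact: measurableD.
have mD' : measurable (A `\` A') by exact: measurableD.
pose N j := A' `\` P (n + j)%N k A.
have BN j : B (n + j)%N (N j).
  by apply: (ssD (ssB _)); [apply: Bmono BA'; exact: leq_addr|exact: PB].
have mN j : measurable (N j) := ss_meas (ssB _) (BN j).
have key j C : B (n + j)%N C -> C `<=` N j -> c * fmu C <= fmu ((A' `\` A) `&` C).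
  move=> BC CN; have mC := ss_meas (ssB _) BC.
  have h := P_le (n := (n + j)%N) (k := k) mA BC (fun x Cx => (CN x Cx).2).
  have e2 := fmuDI mC mA.
  have e3 : C `\` A = (A' `\` A) `&` C.
    by apply/seteqP; split=> x /= => [[Cx Ax]|[[? ?]]//]; split => //; split => //; have [] := CN _ Cx.
  by rewrite e3 (setIC C) in e2; rewrite /c; lra.
(* Doob's maximal inequality. *)
have max M : c * fmu (\big[setU/set0]_(i < M) N i) <=
    fmu ((A' `\` A) `&` \big[setU/set0]_(i < M) N i).
  elim: M => [|M IH]; first by rewrite big_ord0 setI0 /fmu measure0 mulr0.
  rewrite big_ord_recr/=; set S := \big[setU/set0]_(i < M) _ in IH *.
  have BS' : B (n + M)%N S.
    rewrite /S; elim/big_ind : _ => [|? ?|i _]; [exact: (ss0 (ssB _))|exact: (ssU (ssB _))|].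
    by apply: Bmono (BN i); rewrite leq_add2l ltnW.
  have mS := ss_meas (ssB _) BS'.
  have BNS : B (n + M)%N (N M `\` S) by apply: (ssD (ssB _)).
  have mNS := ss_meas (ssB _) BNS.
  have k1 := key M _ BNS (@subDsetl _ _ _).
  have mSN : measurable (S `|` N M) by exact: measurableU.
  have mDSN : measurable ((A' `\` A) `&` (S `|` N M)) by exact: measurableI.
  have e2 := fmuDI mSN mS; have e3 := fmuDI mDSN mS.
  rewrite (_ : (S `|` N M) `&` S = S) in e2; last by rewrite setIUl setIid setUidl//; exact: subIsetr.
  rewrite (_ : (S `|` N M) `\` S = N M `\` S) in e2; last by rewrite setDUl setDv set0U.
  rewrite (_ : _ `&` (S `|` N M) `&` S = (A' `\` A) `&` S) in e3; last first.
    by rewrite -setIA setIUl setIid (setUidl (@subIsetr _ _ _)).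
  rewrite (_ : (A' `\` A) `&` (S `|` N M) `\` S = (A' `\` A) `&` (N M `\` S)) in e3; last first.
    by rewrite setDE -setIA -setDE setDUl setDv set0U.
  by rewrite e2 e3 mulrDr lerD.
have hN : fmu (\bigcup_j N j) <= c^-1 * fmu (A' `\` A).
  apply: fmu_bigcup_le => // M; rewrite ler_pdivlMl//.
  apply: le_trans (max M) _; apply: fmu_le; [|exact: mD|exact: subIsetl].
  by apply: measurableI => //; exact: bigsetU_measurable.
have mNN : measurable (\bigcup_j N j) by exact: bigcupT_measurable.
have nPth : mu.-negligible (\bigcup_j (P (n + j)%N k A `\` th (n + j)%N (P (n + j)%N k A))).
  by apply: negligible_bigcup => j; apply: (den_ge (dB _)); exact: PB.
have sub : aesub (A `&` ~` X) ((A `\` A') `|` \bigcup_j N j).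
  apply: negligibleS nPth => x [[Ax Xx] h].
  have A'x : A' x by apply: contrapT => A'x; apply: h; left.
  have [j hj] : exists j, ~ th (n + j)%N (P (n + j)%N k A) x.
    apply: contrapT => /forallNP hh; apply: Xx; exists n => // j _.
    by apply: contrapT; exact: hh.
  exists j => //; split => //; apply: contrapT => Px; apply: h; right; by exists j.
have mR : measurable ((A `\` A') `|` \bigcup_j N j) by exact: measurableU.
apply: le_trans (fmu_aesub mAX mR sub) _.
apply: le_trans (fmuU2 mD' mNN) _.
move: lt; rewrite ltr_pdivlMr// => lt.
have a0 := fmu_ge0 (A `\` A'); have b0 := fmu_ge0 (A' `\` A).
have ci0 : 0 < c^-1 by rewrite invr_gt0.
have aci := mulr_ge0 a0 (ltW ci0); apply: le_trans (lerD (lexx _) hN) _; lra.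
Qed.

Lemma density_limit : exists F th', [/\ density F th', forall n, B n `<=` F &
  forall n A, B n A -> th n A = th' A].
Proof.
have BI A : Binf A -> measurable A by case.
have th0 : thinf set0 = set0.
  by rewrite (@thinf_id 0%N) ?(den_0 (dB 0))//; exact: (ss0 (ssB 0)).
have thT : thinf setT = setT.
  by rewrite (@thinf_id 0%N) ?(den_T (dB 0))//; exact: (ssT (ssB 0)).
exists Binf, thinf; split => //; last first.
  by move=> n A BA; rewrite (thinf_id BA).
split; [exact: Binf_ss|exact: thinf_ge| | | |exact: th0|exact: thT].
(* The upper inclusion follows from the lower one for the complement, because the densities of A and
   of its complement are disjoint. *)
- move=> A BA; have BCA := ss_C Binf_ss BA.
  apply: negligibleS (thinf_ge BCA) => x [hx Ax]; split => // hx'.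
  suff : thinf (A `&` ~` A) x by rewrite setICr th0.
  by apply: thinf_I => //; exact: BI.
- by move=> A A' BA BA'; apply: thinf_mono; exact: BI.
- by move=> A A' BA BA'; apply: thinf_I; exact: BI.
Qed.

End increasing_densities.
End lower_density.

Section lifting.
Context (R : realType) (d : measure_display) (T : measurableType d).
Variable mu : {finite_measure set T -> \bar R}.
Hypothesis mu_complete : measure_is_complete mu.
Hypothesis mu_neq0 : mu setT != 0%E.
Implicit Types A B C E : set T.

(** The starting point for Zorn's lemma: on null and conull sets, the density is everything or
    nothing. A nonzero measure ensures that the empty set is not conull. *)
Let trivial_density : exists F th, density mu F th.
Proof.
exists [set A | mu.-negligible A \/ mu.-negligible (~` A)].
exists (fun A => [set x | mu.-negligible (~` A)]).
have nT : ~ mu.-negligible [set: T].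
  by move=> /(measure_negligible measurableT)/eqP; apply/negP.
have n0 A : mu.-negligible A -> mu.-negligible (~` A) -> False.
  by move=> h1 h2; apply: nT; rewrite -(setUv A); exact: negligibleU.
split.
- split.
  + move=> A [|] /mu_complete // mA; by rewrite -(setCK A); exact: measurableC.
  + by move=> A; rewrite /= setCK => -[]; [right|left].
  + move=> F hF; have [h|/existsNP[n hn]] := pselect (forall n, mu.-negligible (F n)).
      by left; exact: negligible_bigcup.
    right; have [//|] := hF n; apply: negligibleS => x hx Fx; apply: hx.
    by exists n.
  + by move=> A; left.
- move=> A [nA|nA].
    by apply: negligibleS nA => x [].
  by rewrite /aesub (_ : _ `\` _ = set0); [exact: negligible_set0|apply/seteqP; split=> x // -[]].
- move=> A [nA|nA].
    rewrite /aesub (_ : _ `\` _ = set0); first exact: negligible_set0.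
    by apply/seteqP; split=> x // -[] /= /(n0 _ nA).
  by apply: negligibleS nA => x [].
- move=> A A' _ _ AA' x /= nA; apply: negligibleS (negligibleU nA AA') => y A'y.
  by have [Ay|Ay] := pselect (A y); [right|left].
- by move=> A A' _ _ x [/= h1 h2]; rewrite setCI; exact: negligibleU.
- by apply/seteqP; split=> x //=; rewrite setC0.
- by apply/seteqP; split=> x //= _; rewrite setCT; exact: negligible_set0.
Qed.

Let dens := {p : set (set T) * (set T -> set T) | density mu p.1 p.2}.
Let dle (p q : dens) := `[< (sval p).1 `<=` (sval q).1 /\
  forall A, (sval p).1 A -> (sval p).2 A = (sval q).2 A >].

Let dle_refl p : dle p p. Proof. by apply/asboolP; split. Qed.
Let dle_trans p q r : dle p q -> dle q r -> dle p r.
Proof.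
move=> /asboolP[pq1 pq2] /asboolP[qr1 qr2]; apply/asboolP; split.
  exact: subset_trans qr1.
by move=> A pA; rewrite pq2// qr2//; exact: pq1.
Qed.

(** A chain with a countable cofinal sequence is bounded by [density_limit]. In any other chain
    every sequence has a bound inside the chain, so the union is already closed under countable
    unions and no limit construction is needed. *)
Let chain_ub (A : set dens) : total_on A dle -> exists t, forall s, A s -> dle s t.
Proof.
move=> Atot.
have [F0 [th0 d0]] := trivial_density.
have [[a Aa]|A0] := pselect (exists a, A a); last first.
  by exists (exist _ (F0, th0) d0) => s As; case: A0; exists s.
have [[f [Af fcof]]|nocof] := pselect (exists f : nat -> dens,
    (forall n, A (f n)) /\ forall s, A s -> exists n, dle s (f n)).
  (* The running maximum of f, since [density_limit] wants an increasing sequence. *)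
  pose g := fix g n := if n is m.+1 then if dle (g m) (f n) then f n else g m else f 0%N.
  have Ag n : A (g n) by elim: n => [|n IH] /=; [exact: Af|case: ifP].
  have gS n : dle (g n) (g n.+1) by rewrite /=; case: ifP.
  have fg n : dle (f n) (g n).
    case: n => [|n] /=; first exact: dle_refl.
    case: ifP => [|h]; first by move=> _; exact: dle_refl.
    by have [|] := Atot _ _ (Af n.+1) (Ag n); rewrite ?h.
  have [n A0 h|n A0 h|F [th' [dF BF thF]]] := @density_limit R d T mu mu_complete
      (fun n => (sval (g n)).1) (fun n => (sval (g n)).2) (fun n => svalP (g n)).
  - by have /asboolP[gS1 _] := gS n; exact: gS1.
  - by have /asboolP[_ gS2] := gS n; rewrite gS2.
  - exists (exist _ (F, th') dF) => s /fcof[n /dle_trans]; apply.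
    by apply: (dle_trans (fg n)); apply/asboolP; split; [exact: BF|exact: thF].
have sub_ub (f : nat -> dens) : (forall n, A (f n)) -> exists s, A s /\ forall n, dle (f n) s.
  move=> Af; apply: contrapT => h; apply: nocof; exists f; split=> // s As.
  apply: contrapT => /forallNP hs; apply: h; exists s; split=> // n.
  by have [|//] := Atot _ _ As (Af n) => /hs.
pose F := [set B | exists2 s, A s & (sval s).1 B].
pose th B := [set x | exists s, [/\ A s, (sval s).1 B & (sval s).2 B x]].
have thE s B : A s -> (sval s).1 B -> th B = (sval s).2 B.
  move=> As sB; apply/seteqP; split=> x; last by exists s.
  move=> [s' [As' s'B]]; have [|] := Atot _ _ As As' => /asboolP[_ h]; first by rewrite h.
  by rewrite h.
have common B B' : F B -> F B' -> exists s, [/\ A s, (sval s).1 B & (sval s).1 B'].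
  move=> [s As sB] [s' As' s'B']; have [|] := Atot _ _ As As' => /asboolP[h _].
    by exists s'; split=> //; exact: h.
  by exists s; split=> //; exact: h.
have dF : density mu F th.
  split.
  - split.
    + by move=> B [s _ sB]; exact: (ss_meas (den_ss (svalP s))).
    + by move=> B [s As sB]; exists s => //; exact: (ss_C (den_ss (svalP s))).
    + move=> G hG; have /choice[f hf] : forall n, exists s, A s /\ (sval s).1 (G n).
        by move=> n; have [s As sG] := hG n; exists s.
      have [s [As fs]] := sub_ub f (fun n => (hf n).1).
      exists s => //; apply: (ss_bigcup (den_ss (svalP s))) => n.
      by have /asboolP[h _] := fs n; apply: h; exact: (hf n).2.
    + by move=> B nB; exists a => //; exact: (ss_null (den_ss (svalP a))).
  - by move=> B [s As sB]; rewrite (thE s)//; exact: (den_ge (svalP s)).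
  - by move=> B [s As sB]; rewrite (thE s)//; exact: (den_le (svalP s)).
  - move=> B B' FB FB'; have [s [As sB sB']] := common _ _ FB FB'.
    by rewrite !(thE s)//; exact: (den_mono (svalP s)).
  - move=> B B' FB FB'; have [s [As sB sB']] := common _ _ FB FB'.
    rewrite !(thE s)//; first exact: (den_I (svalP s)).
    exact: (ssI (den_ss (svalP s))).
  - by rewrite (thE a)// ?(den_0 (svalP a))//; exact: (ss0 (den_ss (svalP a))).
  - by rewrite (thE a)// ?(den_T (svalP a))//; exact: (ssT (den_ss (svalP a))).
exists (exist _ (F, th) dF) => s As; apply/asboolP; split=> /=.
  by move=> B sB; exists s.
by move=> B sB; rewrite (thE s).
Qed.

Lemma exists_lower_density : exists th, density mu measurable th.
Proof.
have [F0 [th0 d0]] := trivial_density.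
have [[[F th] /= dF] tmax] := ZL_preorder (exist _ (F0, th0) d0 : dens) dle_refl
  (fun p q r => @dle_trans p q r) chain_ub.
exists th; suff <- : F = measurable by [].
apply/seteqP; split; first exact: (ss_meas (den_ss dF)).
move=> E mE; have [F' [th' [dF' FF' thth' F'E]]] := density_extend dF mE.
have : dle (exist _ (F, th) dF) (exist _ (F', th') dF') by apply/asboolP.
by move=> /tmax/asboolP[h _]; exact: h.
Qed.

(* The von Neumann-Maharam lifting, given at each point by the ultrafilter of
   the sets whose lifting contains that point. *)
Theorem lifting : exists G : T -> set_system T, [/\ forall w, UltraFilter (G w),
  forall w A, mu.-negligible (~` A) -> G w A &
  forall A, measurable A -> \forall w \ae mu, G w A <-> A w].
Proof.
have [th dth] := exists_lower_density.
pose F w : set_system T := [set A | exists B, [/\ measurable B, B `<=` A & th B w]].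
have PF w : ProperFilter (F w).
  split.
  - move=> [B [mB B0 hB]]; move: hB; have -> : B = set0 by rewrite -subset0.
    by rewrite (den_0 dth).
  - split.
    + by exists setT; split=> //; rewrite (den_T dth).
    + move=> A A' [B [mB BA hB]] [B' [mB' BA' hB']]; exists (B `&` B'); split.
      - exact: measurableI.
      - by move=> x [Bx B'x]; split; [exact: BA|exact: BA'].
      - exact: (den_I dth).
    + by move=> A A' AA' [B [mB BA hB]]; exists B; split=> //; exact: subset_trans AA'.
(* Any ultrafilter above F w will do: almost every w of A lies in th A and almost every other w in
   the density of the complement, so that F w already decides A as w does. *)
have /choice[G hG] : forall w, exists G, UltraFilter G /\ F w `<=` G.
  by move=> w; exact: ultraFilterLemma.
exists G; split.
- by move=> w; have [] := hG w.
- move=> w A nA; have [_] := hG w; apply.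
  have mA : measurable A by rewrite -(setCK A); apply: measurableC; exact: mu_complete.
  exists A; split=> //; apply: (den_mono dth _ mA (A := setT)) => //.
    by rewrite /aesub setTD.
  by rewrite (den_T dth).
- move=> A mA; have mCA := measurableC mA.
  apply: negligibleS (negligibleU (den_ge dth mA) (den_ge dth mCA)) => w /= h.
  apply: contrapT => h'; apply: h.
  have [UG FG] := hG w.
  split=> [GA|Aw].
    apply: contrapT => nAw.
    have thw : th (~` A) w by apply: contrapT => ?; apply: h'; right.
    have GC : G w (~` A).
      apply: FG; exists (~` A); split; [exact: mCA| |exact: thw].
      by [].
    have PG : ProperFilter (G w) by exact: ultra_proper.
    have G0 : G w (A `&` ~` A) by exact: filterI.
    by move: G0; rewrite setICr; exact: (@filter_not_empty _ (G w) PG).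
  apply: FG; exists A; split=> //.
  by apply: contrapT => ?; apply: h'; left.
Qed.
End lifting.

Local Open Scope complex_scope.

(** * Order intervals of a C*-algebra are bounded *)

Section real_norm.
Context (R : realType).

(** Norms take values in R[i], where the order is partial; the real part gives access to total order
    and linear arithmetic. *)
Definition nm (V : normedZmodType R[i]) (x : V) : R := complex.Re `|x|.

Section normed.
Variable V : normedZmodType R[i].
Implicit Types x y : V.

Lemma nmE x : `|x| = (nm x)%:C.
Proof. by rewrite /nm RRe_real// ger0_real. Qed.
Lemma nm_ge0 x : 0 <= nm x.
Proof. by rewrite -ler0c -nmE. Qed.
Lemma nm0 : nm (0 : V) = 0.
Proof. by rewrite /nm normr0. Qed.
Lemma nm_eq0 x : nm x = 0 -> x = 0.
Proof. by move=> h; apply: normr0_eq0; rewrite nmE h. Qed.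
Lemma nmN x : nm (- x) = nm x.
Proof. by rewrite /nm normrN. Qed.
Lemma nmB x y : nm (x - y) = nm (y - x).
Proof. by rewrite -opprB nmN. Qed.
Lemma nmD x y : nm (x + y) <= nm x + nm y.
Proof. rewrite -lecR rmorphD/=. by rewrite -!nmE ler_normD. Qed.
End normed.

Lemma nmZ (V : normedModType R[i]) (a : R[i]) (x : V) :
  nm (a *: x) = nm a * nm x.
Proof. by apply: complexI; rewrite rmorphM/= -!nmE normrZ. Qed.

Lemma nm_real (r : R) : nm r%:C = `|r|.
Proof. by rewrite /nm normc_def /= expr0n addr0 sqrtr_sqr. Qed.

Lemma nmZr (V : normedModType R[i]) (r : R) (x : V) :
  nm (r%:C *: x) = `|r| * nm x.
Proof. by rewrite nmZ nm_real. Qed.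

(* The premise is an equation because the scaling of an algebra and that of a
   normed module are convertible but not syntactically equal. *)
Lemma nmZr_eq (V : normedModType R[i]) (r : R) (x y : V) :
  y = r%:C *: x -> nm y = `|r| * nm x.
Proof. by move=> ->; rewrite nmZr. Qed.

Lemma geometric_cvg (V : completeNormedModType R[i]) (u : nat -> V) (C q : R) :
  0 <= C -> 0 <= q < 1 -> (forall n, nm (u n.+1 - u n) <= C * q ^+ n) ->
  exists l, forall n, nm (u n - l) <= C * q ^+ n / (1 - q).
Proof.
move=> C0 q01 h; have /andP[q0 q1] := q01.
have q1' : 0 < 1 - q by rewrite subr_gt0.
have tail n k : nm (u (n + k)%N - u n) <= C * q ^+ n / (1 - q) * (1 - q ^+ k).
  elim: k => [|k IH]; first by rewrite addn0 subrr nm0 expr0 subrr mulr0.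
  rewrite addnS -[_.+1]addnS -(subrK (u (n + k)%N) (u (n + k.+1)%N)) -addrA.
  apply: le_trans (nmD _ _) _; rewrite addnS.
  apply: le_trans (lerD (h _) IH) _; rewrite exprD exprS le_eqVlt.
  apply/orP; left; apply/eqP; field; exact: lt0r_neq0.
have tail' n k : nm (u (n + k)%N - u n) <= C * q ^+ n / (1 - q).
  apply: le_trans (tail n k) _; rewrite ler_piMr//.
    by rewrite divr_ge0 ?mulr_ge0 ?exprn_ge0// ltW.
  by rewrite gerBl exprn_ge0.
have : cauchy (u @ \oo).
  apply: cauchy_exP => e e0.
  have e0' : 0 < complex.Re e by move: e0; rewrite ltcE => /andP[].
  have [n hn] := geometric_small (C / (1 - q)) q01 e0'.
  exists (u n), n => // m /= nm_.
  rewrite -ball_normE /= nmE -(subnKC nm_) nmB.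
  apply: (@lt_le_trans _ _ (complex.Re e)%:C).
    by rewrite ltcR; apply: le_lt_trans (tail' _ _) _; rewrite mulrAC.
  by rewrite RRe_real// gtr0_real.
move/cauchy_cvg/cvg_ex => [l /cvgrPdist_lt ul]; exists l => n.
apply/ler_addgt0Pr => e e0.
have e0' : (0 : R[i]) < e%:C by rewrite ltcR.
have [m _ /(_ (n + m)%N (leq_addl _ _))/=] := ul _ e0'.
rewrite nmE ltcR => /ltW lm.
rewrite -(subrK (u (n + m)%N) (u n)) -addrA.
apply: le_trans (nmD _ _) _; apply: lerD; first by rewrite nmB.
by rewrite nmB.
Qed.

Lemma nm_iC : nm (Complex 0 1 : R[i]) = 1.
Proof. by rewrite /nm normc_def /= expr0n expr1n add0r sqrtr1. Qed.

End real_norm.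

Section cstar.
Context (R : realType) (B : unital_cstar R).
Local Notation A := (ualg B).
Implicit Types x y z : A.

Definition st (x : A) : A := @cs_star R B x.

Lemma stD x y : st (x + y) = st x + st y.
Proof. exact: (sa_starD (cs_star_algebra B)). Qed.
Lemma stM x y : st (x * y) = st y * st x.
Proof. exact: (sa_starM (cs_star_algebra B)). Qed.
Lemma stK x : st (st x) = x.
Proof. exact: (sa_starK (cs_star_algebra B)). Qed.
Lemma stZ a x : st (a *: x) = conjc a *: st x.
Proof. exact: (sa_starZ (cs_star_algebra B)). Qed.
Lemma stZr (r : R) x : st (r%:C *: x) = r%:C *: st x.
Proof. by rewrite stZ conjc_real. Qed.
Lemma stN x : st (- x) = - st x.
Proof. exact: (sa_starN (cs_star_algebra B)). Qed.
Lemma st1 : st 1 = 1.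
Proof. by have := stM (st 1) 1; rewrite mulr1 stK mulr1 => <-. Qed.

Lemma nmM x y : nm (x * y) <= nm x * nm y.
Proof. by rewrite -lecR rmorphM/= -!nmE; exact: cs_normM. Qed.
Lemma nmst2 x : nm (st x * x) = nm x ^+ 2.
Proof. by apply: complexI; rewrite rmorphXn/= -!nmE; apply/esym/cs_normV. Qed.
Lemma nm_st x : nm (st x) = nm x.
Proof.
have h y : nm y <= nm (st y).
  have [->|y0] := eqVneq (nm y) 0; first exact: nm_ge0.
  have y0' : 0 < nm y by rewrite lt_def y0 nm_ge0.
  by rewrite -(ler_pM2r y0') -expr2 -nmst2 nmM.
by apply/eqP; rewrite eq_le h andbT -{2}(stK x) h.
Qed.
Lemma nm2st x : nm (x * st x) = nm x ^+ 2.
Proof. by rewrite -{1}(stK x) nmst2 nm_st. Qed.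
Lemma nm1 : nm (1 : A) = 1.
Proof.
have n0 : nm (1 : A) != 0 by apply/eqP => /nm_eq0/eqP; rewrite oner_eq0.
by apply: (mulIf n0); rewrite mul1r -expr2 -nmst2 st1 mulr1.
Qed.
Lemma nm_sq x : st x = x -> nm (x * x) = nm x ^+ 2.
Proof. by move=> sx; rewrite -nmst2 sx. Qed.

Lemma nm_scal (r : R) : nm (r%:C%:A : A) = `|r|.
Proof. by rewrite nmZr nm1 mulr1. Qed.

(** The commutation clause stands in for functional calculus: it makes products of the root with
    polynomials in x self-adjoint. *)
Lemma cstar_sqrt x (s : R) : 0 < s <= 1 -> nm x <= 1 - s ^+ 2 -> st x = x ->
  exists w, [/\ w * w = 1 - x, st w = w & forall z, x * z = z * x -> w * z = z * w].
Proof.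
move=> s01 bx sx.
have half2 y : (2^-1)%:C *: y + (2^-1)%:C *: y = y :> A.
  by rewrite -scalerDl -rmorphD/= (_ : _ + _ = 1) ?scale1r//; lra.
have [|||||||||||||||||||y [hy sy cy]] := @sqrt_iteration R A *%R
  (fun x => (2^-1)%:C *: x) st (fun x r => nm x <= r) _ _ _ _ _ _ _ _ _ _ _ _ _ _ _ _ _ _ _
  x s s01 bx sx.
- exact: mulrDl.
- exact: mulrDr.
- exact: mulrA.
- exact: scalerDr.
- exact: half2.
- by move=> ? ?; rewrite scalerAl.
- by move=> ? ?; rewrite scalerAr.
- exact: stD.
- exact: stM.
- by move=> ?; rewrite stZr.
- by move=> ? ? ? /[swap]; exact: le_trans.
- by rewrite nm0.
- by move=> ? ?; rewrite nmN.
- by move=> ? ? ? ? h1 h2; apply: le_trans (nmD _ _) _; exact: lerD.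
- by move=> ? ? ? ? _ _ h1 h2; apply: le_trans (nmM _ _) _; apply: ler_pM => //; exact: nm_ge0.
- by move=> ? ? h; rewrite nmZr gtr0_norm ?invr_gt0// mulrC ler_pM2r// invr_gt0.
- by move=> ? ?; rewrite nm_st.
- move=> z h; apply: nm_eq0; apply/eqP; rewrite eq_le nm_ge0 andbT.
  by apply/ler_addgt0Pr => e e0; rewrite add0r h.
- move=> u C q C0 q01 h; have [l hl] := geometric_cvg C0 q01 h.
  exists l => n; apply: le_trans (hl n) _; have /andP[q0 q1] := q01.
  have : 0 <= C * q ^+ n / (1 - q) by rewrite divr_ge0 ?mulr_ge0 ?exprn_ge0// subr_ge0 ltW.
  by lra.
exists (1 - y); split.
- rewrite mulrBr mulr1 mulrBl mul1r -addrA -opprD.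
  by rewrite (addrA y y) hy addrK.
- by rewrite stD stN st1 sy.
- by move=> z xz; rewrite mulrBl mulrBr mul1r mulr1 (cy _ (nm z))// nm_ge0.
Qed.

End cstar.

(** If q = 1 + e with e > 0, Bernoulli's inequality at 2^k, squared, makes q^(2^(k+1)) grow
    quadratically in 2^k, against a linear bound. Only exponents 2^k occur because the norm of a
    self-adjoint element is multiplicative along repeated squaring. *)
Lemma expr2n_le1 (R : realType) (q K : R) : 0 <= q ->
  (forall k, q ^+ (2 ^ k) <= 1 + (2 ^ k)%:R * K) -> q <= 1.
Proof.
move=> q0 h; rewrite leNgt; apply/negP => q1.
pose e := q - 1; have e0 : 0 < e by rewrite subr_gt0.
have qe : q = 1 + e by rewrite /e; lra.
have bern n : 1 + n%:R * e <= q ^+ n.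
  elim: n => [|n IH]; first by rewrite mul0r addr0 expr0.
  rewrite exprS -nat1r.
  have h1 : q * (1 + n%:R * e) <= q * q ^+ n by rewrite ler_pM2l//; lra.
  apply: le_trans h1; rewrite qe.
  have : 0 <= n%:R * (e * e) by rewrite mulr_ge0// mulr_ge0// ltW.
  by nra.
have K0 : 0 <= 1 + 2 * K.
  have := h 0%N; rewrite expn0 expr1 mul1r => hq; have : 1 <= 1 + K by lra.
  by lra.
have bd k : (2 ^ k)%:R * e ^+ 2 <= 1 + 2 * K.
  have := h k.+1; rewrite expnS mulnC exprM natrM => hk.
  have k1 : (1 : R) <= (2 ^ k)%:R by rewrite ler1n expn_gt0.
  rewrite -(@ler_pM2l _ (2 ^ k)%:R); last lra.
  have := bern (2 ^ k)%N; set p := (2 ^ k)%:R in k1 hk *; set Q := q ^+ _ in hk *.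
  move=> pQ; have : (p * e) ^+ 2 <= Q ^+ 2.
    by rewrite ler_pXn2r ?nnegrE//; nra.
  by nra.
have e2 : 0 < e ^+ 2 by rewrite exprn_gt0.
have half01 : 0 <= (2^-1 : R) < 1 by lra.
have [n] := geometric_small (1 + 2 * K) half01 e2.
rewrite exprVn -natrX ltr_pdivrMr ?ltr0n ?expn_gt0// [X in _ < X]mulrC.
by rewrite ltNge bd.
Qed.

Lemma sqrD_sqrB (S : pzRingType) (a b : S) :
  (a + b) * (a + b) + (a - b) * (a - b) = (a * a + b * b) *+ 2.
Proof.
rewrite !mulrDl !mulrDr !mulNr !mulrN opprK (addrACA (a * a + _)) (addrACA (a * a)).
by rewrite (addrACA (b * a)) !subrr addr0 add0r addrACA mulr2n.
Qed.

Section cstar_cone.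
Context (R : realType) (B : unital_cstar R).
Local Notation A := (ualg B).
Implicit Types x y z : A.

Lemma conj_iC : conjc (Complex 0 1 : R[i]) = - Complex 0 1.
Proof. by apply/eqP; rewrite eq_complex /= oppr0 !eqxx. Qed.

Lemma iC2 : (Complex 0 1 : R[i]) * Complex 0 1 = -1.
Proof. by rewrite -expr2 sqr_i. Qed.

(* With x' = x / sqrt (2t), the elements x' +- i sqrt (1 - x'^2) are unitary, and
   t - x^2 is - t/2 times the sum of their squares. *)
Lemma norm_unit_sub_sq x (t : R) : st x = x -> nm x ^+ 2 < 2 * t ->
  nm (t%:C%:A - x * x) <= t.
Proof.
move=> sx xt.
have t0 : 0 < t by have := sqr_ge0 (nm x); lra.
pose r := Num.sqrt (2 * t); have r0 : 0 < r by rewrite sqrtr_gt0; lra.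
have r2 : r ^+ 2 = 2 * t by rewrite sqr_sqrtr//; lra.
pose x' := (r^-1)%:C *: x.
have sx' : st x' = x' by rewrite stZr sx.
have nx' : nm x' ^+ 2 = nm x ^+ 2 / (2 * t).
  by rewrite nmZr ger0_norm ?invr_ge0 1?ltW// exprMn exprVn r2 mulrC.
have nx1 : nm x' ^+ 2 < 1 by rewrite nx' ltr_pdivrMr ?mul1r//; lra.
have sx'2 : st (x' * x') = x' * x' by rewrite stM sx'.
pose s := Num.sqrt (1 - nm x' ^+ 2).
have [||w [w2 sw cw]] := @cstar_sqrt R B (x' * x') s _ _ sx'2.
- rewrite sqrtr_gt0 subr_gt0 nx1/= -[leRHS]sqrtr1 ler_wsqrtr//.
  by have := sqr_ge0 (nm x'); lra.
- by rewrite sqr_sqrtr ?nm_sq//; lra.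
have {}cw : w * x' = x' * w by apply: cw; rewrite mulrA.
pose v := Complex 0 1 *: w.
have vx : v * x' = x' * v by rewrite -scalerAl cw scalerAr.
have v2 : v * v = x' * x' - 1.
  by rewrite -scalerAl -scalerAr scalerA iC2 w2 scaleN1r opprB.
have sv : st v = - v by rewrite stZ conj_iC sw scaleNr.
have su : st (x' + v) = x' - v by rewrite stD sx' sv.
have uu : (x' - v) * (x' + v) = 1.
  rewrite mulrDr !mulrBl vx v2 addrA subrK opprB addrCA subrr addr0 //.
have nu : nm (x' + v) = 1.
  have : nm (x' + v) ^+ 2 = 1 ^+ 2 by rewrite -nmst2 su uu nm1 expr1n.
  by move/eqP; rewrite eqrXn2// ?nm_ge0// => /eqP.
have nu' : nm (x' - v) = 1 by rewrite -su nm_st.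
have xx : x * x = (2 * t)%:C *: (x' * x').
  have e1 : r ^+ 2 / r / r = 1 by field; exact: lt0r_neq0.
  by rewrite /x' -scalerAl -scalerAr !scalerA -r2 -!rmorphM/= e1 scale1r.
pose y : A := (x' + v) * (x' + v) + (x' - v) * (x' - v).
have yE : t%:C%:A - x * x = (- (t / 2))%:C *: y.
  rewrite /y sqrD_sqrB v2 xx addrA -mulr2n mulrnBl -mulrnA -(scaler_nat 4) -(scaler_nat 2 (1 : A)).
  rewrite -!(rmorph_nat (real_complex R)) scalerBr !scalerA -!rmorphM/= addrC -!scaleNr.
  rewrite -!rmorphN/=; by congr (_%:C *: _ + _%:C *: _); rewrite /GRing.scale/=; field.
rewrite (nmZr_eq yE) normrN ger0_norm; last lra.
have : nm y <= 1 + 1.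
  apply: le_trans (nmD _ _) _; apply: lerD; apply: le_trans (nmM _ _) _.
    by rewrite nu mulr1.
  by rewrite nu' mulr1.
by nra.
Qed.

(* z = t + c*c and z' = t + cc* satisfy z^n c* = c* z'^n, so |z^n| grows like |z'|^n
   up to a factor linear in n, while |z^(2^k)| = |z|^(2^k) as z is self-adjoint. *)
Lemma norm_unit_add_swap (c : A) (t s : R) : 0 <= t -> t <= s -> 0 < s ->
  nm (t%:C%:A + c * st c) <= s -> nm (t%:C%:A + st c * c) <= s.
Proof.
move=> t0 ts s0 h.
set z' := (_ + _ : A) in h; set z := (_ + _ : A).
have zc n : z ^+ n * st c = st c * z' ^+ n.
  elim: n => [|n IH]; first by rewrite !expr0 mul1r mulr1.
  rewrite exprS -mulrA IH exprS !mulrA; congr (_ * _).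
  by rewrite /z /z' mulrDl mulrDr -scalerAl mul1r -scalerAr mulr1 mulrA.
have nz' n : nm (z' ^+ n) <= s ^+ n.
  elim: n => [|n IH]; first by rewrite !expr0 nm1.
  rewrite !exprS; apply: le_trans (nmM _ _) _; apply: ler_pM => //; exact: nm_ge0.
pose g := nm c ^+ 2; have g0 : 0 <= g by exact: sqr_ge0.
have nz n : nm (z ^+ n) <= s ^+ n * (1 + n%:R * (g / s)).
  elim: n => [|n IH]; first by rewrite !expr0 nm1 mul0r addr0 mulr1.
  have -> : z ^+ n.+1 = t%:C *: z ^+ n + st c * z' ^+ n * c.
    by rewrite -zc exprSr {2}/z mulrDr -scalerAr mulr1 mulrA.
  apply: le_trans (nmD _ _) _; rewrite nmZr ger0_norm//.
  have h1 : nm (st c * z' ^+ n * c) <= s ^+ n * g.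
    apply: le_trans (nmM _ _) _; rewrite /g expr2 mulrA ler_wpM2r ?nm_ge0//.
    apply: le_trans (nmM _ _) _; rewrite nm_st mulrC ler_wpM2r ?nm_ge0//.
  have h2 : t * nm (z ^+ n) <= s * (s ^+ n * (1 + n%:R * (g / s))).
    by apply: ler_pM => //; exact: nm_ge0.
  apply: le_trans (lerD h2 h1) _; rewrite exprS -nat1r le_eqVlt; apply/orP; left.
  by apply/eqP; field; exact: lt0r_neq0.
have sz : st z = z by rewrite stD stM stK stZr st1.
have nz2 k : nm (z ^+ (2 ^ k)) = nm z ^+ (2 ^ k) /\ st (z ^+ (2 ^ k)) = z ^+ (2 ^ k).
  elim: k => [|k [IH1 IH2]]; first by rewrite expn0 !expr1.
  rewrite expnS mul2n -addnn !exprD; split; last by rewrite stM IH2.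
  by rewrite nm_sq// IH1 expr2.
suff : nm z / s <= 1 by rewrite ler_pdivrMr// mul1r.
apply: (@expr2n_le1 R _ (g / s)); first by rewrite divr_ge0 ?nm_ge0 ?ltW.
move=> k; have [e1 _] := nz2 k; rewrite expr_div_n -e1 ler_pdivrMr ?exprn_gt0//.
by rewrite mulrC nz.
Qed.
End cstar_cone.

(** The identities are proved by [ring] in a commutative ring of polynomials and carried by f,
    evaluation at an element, into an algebra that need not be commutative. *)
Section polynomial_identities.
Variables (S : comPzRingType) (S' : pzRingType) (f : {rmorphism S -> S'}).

(* For J = i and a self-adjoint X the last two terms have norm at most 2 * 10^2, so
   that 3 + X and 3 - X cannot both be small when |X| = 1. *)
Lemma quartic_identity (X J : S) : J * J = -1 -> 432%:R * f X =
  (3%:R + f X) ^+ 4 - (3%:R - f X) ^+ 4 -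
  f J * ((3%:R + f J * f X) ^+ 4 - (3%:R - f J * f X) ^+ 4).
Proof.
move=> J2; have : 432%:R * X = (3%:R + X) ^+ 4 - (3%:R - X) ^+ 4 -
    J * ((3%:R + J * X) ^+ 4 - (3%:R - J * X) ^+ 4).
  have -> : (3%:R + X) ^+ 4 - (3%:R - X) ^+ 4 -
    J * ((3%:R + J * X) ^+ 4 - (3%:R - J * X) ^+ 4) =
    216%:R * X + 24%:R * X ^+ 3 - (J * J) * (216%:R * X)
      - (J * J) * (J * J) * (24%:R * X ^+ 3) by ring.
  by rewrite J2; ring.
move/(congr1 f); rewrite rmorphM rmorph_nat => ->.
by rewrite !(rmorphB, rmorphXn, rmorphM, rmorph_nat) !(rmorphD f 3%:R) rmorphM rmorph_nat.
Qed.

(* The double root of the right-hand side is the maximizer of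
   (1 - X)^2 (X + D) on [-D, 1]. *)
Lemma cubic_identity (X D : S) :
  4%:R * (1 + f D) ^+ 3 - 27%:R * ((1 - f X) * (f X + f D) * (1 - f X)) =
  (4%:R + f D - 3%:R * f X) * ((3%:R * f X - (1 - 2%:R * f D)) *
    (3%:R * f X - (1 - 2%:R * f D))).
Proof.
have : 4%:R * (1 + D) ^+ 3 - 27%:R * ((1 - X) * (X + D) * (1 - X)) =
  (4%:R + D - 3%:R * X) * ((3%:R * X - (1 - 2%:R * D)) * (3%:R * X - (1 - 2%:R * D))).
  by ring.
move/(congr1 f); rewrite rmorphB (rmorphM f 4%:R) rmorph_nat rmorphXn (rmorphD f 1) rmorph1.
rewrite (rmorphM f 27%:R) rmorph_nat !(rmorphM f) !(rmorphB f) (rmorphD f X) rmorph1 => ->.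
by rewrite (rmorphD f 4%:R) !(rmorphM f) !rmorph_nat.
Qed.

(** Recovers X from the cubic of [cubic_identity] at X and at -X. For small D these two terms will
    have norm at most about 16/27 and, for |X| = 1, the remainder about 2, which together stay below
    4. *)
Lemma cubic_difference (X D : S) : 4%:R * f X =
  (1 - f X) * (f X + f D) * (1 - f X) - (1 + f X) * (- f X + f D) * (1 + f X)
  + 2%:R * (f X * (1 - f X * f X)) + 4%:R * (f D * f X).
Proof.
have : 4%:R * X = (1 - X) * (X + D) * (1 - X) - (1 + X) * (- X + D) * (1 + X)
  + 2%:R * (X * (1 - X * X)) + 4%:R * (D * X) by ring.
move/(congr1 f); rewrite rmorphM rmorph_nat => ->.
rewrite (rmorphD f _ (4%:R * _)) (rmorphD f _ (2%:R * _)) (rmorphB f (_ * _ * _)) !rmorphM !rmorph_nat.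
by rewrite !rmorphB !(rmorphD f 1) (rmorphD f X) (rmorphD f (- X)) rmorphN rmorphM rmorph1.
Qed.
End polynomial_identities.

Lemma sqrD_subB (S : pzRingType) (a b : S) :
  (a + b) * (a + b) - (a - b) * (a - b) = (a * b + b * a) *+ 2.
Proof.
rewrite !mulrDl !mulrDr !mulNr !mulrN opprK.
rewrite opprD opprB opprD opprK addrACA (addrC (a * a) (a * b)) (addrACA (a * b)).
by rewrite (addrACA (b * a)) !subrr !addr0 mulr2n addrACA.
Qed.

Section cstar_order.
Context (R : realType) (B : unital_cstar R).
Local Notation A := (ualg B).
Implicit Types x y z : A.

Lemma nmX x n : nm (x ^+ n) <= nm x ^+ n.
Proof.
elim: n => [|n IH]; first by rewrite !expr0 nm1.
by rewrite !exprS; apply: le_trans (nmM _ _) _; apply: ler_pM => //; exact: nm_ge0.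
Qed.

Lemma norm_ge_quartic x (p : R) : st x = x -> nm x = 1 ->
  nm (3%:R + x) <= p -> nm (3%:R - x) <= p -> 432 <= 2 * p ^+ 4 + 200.
Proof.
move=> sx x1 hp hm.
pose v : A := Complex 0 1 *: x.
have J2 : (Complex 0 1 : R[i])%:P * (Complex 0 1)%:P = -1.
  by rewrite -polyCM iC2 polyCN.
have := quartic_identity (horner_alg x) 'X J2.
rewrite /= !horner_algC !horner_algX -!scalerAl !mul1r -/v.
(* Numerals are hidden behind variables so that conversion does not expand them into sums of
   ones. *)
have [p3 p3E] : exists n : A, n = 3%:R by exists 3%:R.
have [p432 p432E] : exists n : A, n = 432%:R by exists 432%:R.
rewrite -p3E -p432E => eqx; rewrite -p3E in hp hm.
have sv : st v = - v by rewrite stZ conj_iC sx scaleNr.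
have s3 : st p3 = p3 by rewrite p3E -(rmorph_nat (in_alg A)) /= -(rmorph_nat (real_complex R)) stZr st1.
have vv : v * v = - (x * x) by rewrite -scalerAl -scalerAr scalerA iC2 scaleN1r.
have n9 : nm (9%:R + x * x) <= 10.
  apply: le_trans (nmD _ _) _; rewrite nm_sq// x1 expr1n.
  by rewrite (_ : 9%:R = 9%:R%:C%:A) ?nm_scal ?ger0_norm//; [lra|rewrite rmorph_nat scaler_nat].
have h2 : st (p3 + v) * (p3 + v) = 9%:R + x * x.
  rewrite stD s3 sv mulrDr !mulrBl vv p3E !mulr_natl mulr_natr opprK addrA subrK.
  by rewrite -mulrnA.
have nv : nm (p3 + v) ^+ 4 <= 100.
  have : nm (p3 + v) ^+ 2 <= 10 by rewrite -nmst2 h2.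
  by have := sqr_ge0 (nm (p3 + v)); nra.
have nv' : nm (p3 - v) ^+ 4 <= 100.
  have -> : p3 - v = st (p3 + v) by rewrite stD s3 sv.
  by rewrite nm_st.
have n432x : nm (p432 * x : A) = 432.
  have e : (p432 * x : A) = (432%:R)%:C *: x.
    by rewrite p432E rmorph_nat scaler_nat mulr_natl.
  by rewrite (nmZr_eq e) x1 mulr1 ger0_norm.
rewrite -n432x eqx.
apply: le_trans (nmD _ _) _; rewrite nmN; apply: lerD.
  apply: le_trans (nmD _ _) _; rewrite nmN mulr_natl mulr2n; apply: lerD;
    apply: le_trans (nmX _ _) _; rewrite lerXn2r ?nnegrE ?nm_ge0//.
    by apply: le_trans hp; exact: nm_ge0.
  by apply: le_trans hp; exact: nm_ge0.
set y : A := _ - _.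
rewrite (nmZ _ y) nm_iC mul1r.
apply: le_trans (nmD _ _) _; rewrite nmN.
have := nmX (p3 + v) 4; have := nmX (p3 - v) 4; lra.
Qed.

(** A quantitative form of the fact that -cc* is positive only for c = 0. The bound passes from cc*
    to c*c by [norm_unit_add_swap]. With c = a - ib for self-adjoint a and b, one has cc* + c*c =
    2a^2 + 2b^2, which turns the bound on c*c into one on 3 - cc*, so that 3 + cc* and 3 - cc* are
    both too small for [norm_ge_quartic]. *)
Lemma norm_unit_add_ge (c : A) : nm c = 1 ->
  nm ((3 / 5)%:C%:A + c * st c) <= 3 / 5 + 1 / 4 -> False.
Proof.
move=> c1 h.
have h' : nm ((3 / 5)%:C%:A + st c * c) <= 3 / 5 + 1 / 4.
  by apply: norm_unit_add_swap h; lra.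
have sx : st (c * st c) = c * st c by rewrite stM stK.
have x1 : nm (c * st c) = 1 by rewrite nm2st c1 expr1n.
have realA (n : nat) : (n%:R : A) = (n%:R)%:C%:A by rewrite rmorph_nat scaler_nat.
have natA (n : nat) (z : A) : n%:R * z = (n%:R)%:C *: z.
  by rewrite rmorph_nat scaler_nat mulr_natl.
(* 13/4 = 12/5 + 3/5 + 1/4, here and for 3 - cc* below, and 2 * (13/4)^4 + 200 < 432. *)
have hp : nm (3%:R + c * st c) <= 13 / 4.
  have -> : 3%:R + c * st c = (12 / 5)%:C%:A + ((3 / 5)%:C%:A + c * st c).
    by rewrite addrA -scalerDl -rmorphD realA /=; congr (_%:C *: _ + _); field.
  by apply: le_trans (nmD _ _) _; rewrite nm_scal ger0_norm; lra.
pose a : A := (2^-1)%:C *: (c + st c).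
pose b : A := ((2^-1)%:C * Complex 0 1) *: (c - st c).
have na : nm a ^+ 2 < 2 * (3 / 5).
  suff : nm a <= 1 by have := nm_ge0 a; nra.
  by rewrite nmZr ger0_norm ?invr_ge0//; have := nmD c (st c); rewrite nm_st c1; lra.
have nb : nm b ^+ 2 < 2 * (3 / 5).
  suff : nm b <= 1 by have := nm_ge0 b; nra.
  rewrite /b -scalerA nmZr ger0_norm ?invr_ge0// nmZ nm_iC mul1r.
  by have := nmD c (- st c); rewrite nmN nm_st c1; lra.
have sa : st a = a by rewrite stZr stD stK addrC.
have sb : st b = b.
  have conjc_ri (r : R) : conjc (r%:C * Complex 0 1) = - (r%:C * Complex 0 1).
    by apply/eqP; rewrite eq_complex /= !(mulr0, mul0r) subrr oppr0 !eqxx.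
  by rewrite /b stZ conjc_ri scaleNr stD stN stK -scalerN opprB.
have aabb : a * a + b * b = (2^-1)%:C *: (c * st c + st c * c).
  rewrite /a /b -!scalerAl -!scalerAr !scalerA.
  have -> : (2^-1)%:C * Complex 0 1 * ((2^-1)%:C * Complex 0 1) = - ((2^-1)%:C * (2^-1)%:C) :> R[i].
    by rewrite mulrACA iC2 mulrN1.
  rewrite scaleNr -scalerBr sqrD_subB -(scaler_nat 2 (c * st c + _)) scalerA.
  by rewrite -(rmorph_nat (real_complex R)) -!rmorphM/=; congr (_%:C *: _); field.
have hm : nm (3%:R - c * st c) <= 13 / 4.
  have -> : 3%:R - c * st c = 2%:R * (((3 / 5)%:C%:A - a * a) + ((3 / 5)%:C%:A - b * b)) +
      ((3 / 5)%:C%:A + st c * c).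
    rewrite addrACA -opprD aabb -scalerDl -rmorphD/= natA scalerBr !scalerA -!rmorphM/=.
    have -> : 2%:R * 2^-1 = 1 :> R by field.
    rewrite scale1r opprD addrACA subrK -scalerDl -rmorphD/= realA.
    by congr (_%:C *: _ - _); field.
  have h1 := norm_unit_sub_sq sa na; have h2 := norm_unit_sub_sq sb nb.
  apply: le_trans (nmD _ _) _; rewrite mulr_natl mulr2n.
  set y1 := _ - a * a in h1 *; set y2 := _ - b * b in h2 *.
  have := nmD (y1 + y2) (y1 + y2); have := nmD y1 y2; lra.
have := norm_ge_quartic sx x1 hp hm; lra.
Qed.

Lemma norm_add_ge (c : A) (t : R) : nm c ^+ 2 = t -> 0 < t ->
  nm ((3 / 5 * t)%:C%:A + c * st c) <= (3 / 5 + 1 / 4) * t -> False.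
Proof.
move=> ct t0 h.
pose r := Num.sqrt t; have r0 : 0 < r by rewrite sqrtr_gt0.
have r2 : r ^+ 2 = t by rewrite sqr_sqrtr// ltW.
pose c' : A := (r^-1)%:C *: c.
apply: (@norm_unit_add_ge c').
  rewrite nmZr ger0_norm ?invr_ge0 1?ltW//.
  have -> : nm c = r; last by rewrite mulVf// lt0r_neq0.
  by apply/eqP; rewrite -(eqrXn2 (n := 2))// ?nm_ge0 ?ltW// ct r2.
pose y : A := (3 / 5 * t)%:C%:A + c * st c.
have e : (3 / 5)%:C%:A + c' * st c' = (t^-1)%:C *: y.
  rewrite scalerDr scalerA -rmorphM/= /c' stZr -scalerAl -scalerAr scalerA -rmorphM/= -invfM -expr2 r2.
  by congr (_%:C *: _ + _); field; exact: lt0r_neq0.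
by rewrite (nmZr_eq e) ger0_norm ?invr_ge0 ?(ltW t0)// ler_pdivrMl// mulrC.
Qed.

(** If eta = |c|^2 exceeded 4t, then (3/5) eta + cc* = ((3/5) eta + t) - g^2 would have norm at most
    (3/5) eta + t by [norm_unit_sub_sq], hence at most (3/5 + 1/4) eta, against [norm_add_ge]. *)
Lemma norm_le_of_sub_sq (c g : A) (t : R) : 0 <= t -> st g = g ->
  t%:C%:A - c * st c = g * g -> nm (c * st c) <= 4 * t.
Proof.
move=> t0 sg eg; rewrite nm2st leNgt; apply/negP => ht.
set eta := nm c ^+ 2 in ht.
have eta0 : 0 < eta by lra.
apply: (@norm_add_ge c eta) => //.
have ng : nm g ^+ 2 <= t + eta.
  rewrite -nm_sq// -eg; apply: le_trans (nmD _ _) _.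
  by rewrite nmN nm2st nm_scal ger0_norm.
have -> : (3 / 5 * eta)%:C%:A + c * st c = (3 / 5 * eta + t)%:C%:A - g * g.
  by rewrite -eg rmorphD/= scalerDl opprB addrA addrAC addrK.
apply: (@le_trans _ _ (3 / 5 * eta + t)); last lra.
by apply: norm_unit_sub_sq => //; lra.
Qed.

(** For c = sqrt 27 (1 - k) a, the product cc* is 27 times the cubic, and [cubic_identity] writes 4
    (1 + d)^3 - cc* as the square of a self-adjoint g, so that [norm_le_of_sub_sq] applies. *)
Lemma cubic_bound (k a : A) (d : R) : 0 <= d <= 1 / 10 -> st k = k -> nm k <= 1 ->
  a * st a = k + d%:C%:A ->
  27 * nm ((1 - k) * (k + d%:C%:A) * (1 - k)) <= 16 * (1 + d) ^+ 3.
Proof.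
move=> /andP[d0 d1] sk k1 ak.
pose D : A := d%:C%:A.
have := cubic_identity (horner_alg k) 'X (d%:C)%:P.
rewrite /= horner_algC horner_algX -/D.
have realA (n : nat) : (n%:R : A) = (n%:R)%:C%:A by rewrite rmorph_nat scaler_nat.
have natA (n : nat) (z : A) : n%:R * z = (n%:R)%:C *: z.
  by rewrite rmorph_nat scaler_nat mulr_natl.
have [n27 n27E] : exists n : A, n = 27%:R by exists 27%:R.
have [n3 n3E] : exists n : A, n = 3%:R by exists 3%:R.
rewrite -n27E -n3E => eqk.
pose q := Num.sqrt (27 : R).
pose c : A := q%:C *: ((1 - k) * a).
have q2 : q ^+ 2 = 27 by rewrite sqr_sqrtr.
have s1k : st (1 - k) = 1 - k by rewrite stD stN st1 sk.
have cc : c * st c = n27 * ((1 - k) * (k + D) * (1 - k)).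
  rewrite /c stZr stM s1k -scalerAl -scalerAr scalerA -rmorphM/= -expr2 q2.
  by rewrite n27E rmorph_nat scaler_nat mulr_natl -!mulrA (mulrA a) ak.
pose u := Num.sqrt (4 + d).
have u0 : 0 < u by rewrite sqrtr_gt0; lra.
have u2 : u ^+ 2 = 4 + d by rewrite sqr_sqrtr//; lra.
(* 4 + d - 3k = (4 + d)(1 - k') with |k'| <= 3/4 = 1 - (1/2)^2, within reach of [cstar_sqrt]. *)
pose k' : A := (3 / (4 + d))%:C *: k.
have sk' : st k' = k' by rewrite stZr sk.
have nk' : nm k' <= 1 - 2^-1 ^+ 2.
  rewrite nmZr ger0_norm; last by rewrite divr_ge0//; lra.
  have : 3 / (4 + d) <= 3 / 4 by rewrite ler_pdivrMr; lra.
  by have := nm_ge0 k; nra.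
have h01 : 0 < (2^-1 : R) <= 1 by lra.
have [w [w2 sw cw]] := cstar_sqrt h01 nk' sk'.
have {}cw : w * k = k * w by apply: cw; rewrite -scalerAl scalerAr.
pose g : A := u%:C *: (w * (n3 * k - (1 - 2%:R * D))).
have cn z : n3 * z = z * n3 by rewrite n3E mulr_natl mulr_natr.
have cD z : D * z = z * D by rewrite -scalerAl mul1r -scalerAr mulr1.
set m := n3 * k - _ in g.
have mw : w * m = m * w.
  apply: commrB; first by apply: commrM; [exact/esym/cn|exact: cw].
  apply: commrB; first exact: commr1.
  by apply: commrM; [exact: commr_nat|exact/esym/cD].
have sD : st D = D by rewrite stZr st1.
have sm : st m = m.
  rewrite /m stD stN stM stD st1 stN stM sD sk -(cD 2) n3E realA stZr st1 -realA.
  by rewrite -n3E -cn realA stZr st1.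
have sg : st g = g by rewrite stZr stM sm sw -mw.
have gg : g * g = (4%:R + D - n3 * k) * (m * m).
  rewrite -scalerAl -scalerAr scalerA -rmorphM/= -expr2 u2.
  have -> : w * m * (w * m) = w * w * (m * m) by rewrite mulrA -(mulrA w m) -mw !mulrA.
  rewrite w2 scalerAl; congr (_ * _).
  rewrite scalerBr scalerA -rmorphM/= n3E natA realA -scalerDl -rmorphD/=.
  by congr (_ - _%:C *: _); field; lra.
have tE : (4 * (1 + d) ^+ 3)%:C%:A = 4%:R * (1 + D) ^+ 3 :> A.
  have -> : 1 + D = in_alg A (1 + d)%:C by rewrite rmorphD/= scalerDl scale1r.
  by rewrite -rmorphXn natA/= scalerA -rmorphXn -rmorphM.
have ht : 0 <= 4 * (1 + d) ^+ 3 by rewrite mulr_ge0// exprn_ge0//; lra.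
have := @norm_le_of_sub_sq c g _ ht sg; rewrite tE cc gg => /(_ eqk).
pose y : A := (1 - k) * (k + D) * (1 - k).
have e : n27 * y = (27%:R)%:C *: y by rewrite n27E mulr_natl rmorph_nat scaler_nat.
by rewrite (nmZr_eq e) ger0_norm// mulrA -natrM.
Qed.

(* Positivity here means being of the form aa*, and neither sums of such elements
   nor the functional calculus are at hand; hence the weak constant 10. *)
Theorem norm_order_unit (h a b : A) : 1 + h = a * st a -> 1 - h = b * st b ->
  nm h <= 10.
Proof.
move=> ha hb; rewrite leNgt; apply/negP; set r := nm h => r10.
have r0 : 0 < r by lra.
have sh : st h = h.
  by apply: (addrI 1); rewrite ha -{1}st1 -stD ha stM stK.
pose k : A := (r^-1)%:C *: h.
have sk : st k = k by rewrite stZr sh.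
have nk : nm k = 1 by rewrite nmZr ger0_norm ?invr_ge0 1?ltW// mulVf// lt0r_neq0.
pose q := Num.sqrt r^-1.
have q2 : q ^+ 2 = r^-1 by rewrite sqr_sqrtr// invr_ge0 ltW.
have d01 : 0 <= r^-1 <= 1 / 10.
  by rewrite invr_ge0 ltW//= mul1r lef_pV2 ?posrE//; lra.
have scal z : (q%:C *: z : A) * st (q%:C *: z) = (r^-1)%:C *: (z * st z).
  by rewrite stZr -scalerAl -scalerAr scalerA -rmorphM/= -expr2 q2.
pose D : A := (r^-1)%:C%:A.
have hp : 27 * nm ((1 - k) * (k + D) * (1 - k)) <= 16 * (1 + r^-1) ^+ 3.
  by apply: (@cubic_bound k (q%:C *: a)); rewrite ?nk// scal -ha scalerDr addrC.
have hm : 27 * nm ((1 + k) * (- k + D) * (1 + k)) <= 16 * (1 + r^-1) ^+ 3.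
  rewrite -{1 3}(opprK k); apply: (@cubic_bound (- k) (q%:C *: b)).
  - by [].
  - by rewrite stN sk.
  - by rewrite nmN nk.
  - by rewrite scal -hb scalerBr addrC.
have hk : nm (1 - k * k) <= 1.
  have := @norm_unit_sub_sq _ B k 1 sk; rewrite scale1r nk; apply; lra.
set y := _ * (k + D) * _ in hp; set y' := _ * (- k + D) * _ in hm.
have realA (n : nat) : (n%:R : A) = (n%:R)%:C%:A by rewrite rmorph_nat scaler_nat.
have natA (n : nat) (z : A) : n%:R * z = (n%:R)%:C *: z.
  by rewrite rmorph_nat scaler_nat mulr_natl.
have e : (4%:R)%:C *: k = (y - y') + (2%:R)%:C *: (k * (1 - k * k)) + (4%:R)%:C *: (D * k).
  have := cubic_difference (horner_alg k) 'X (r^-1)%:C%:P.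
  by rewrite /= horner_algC horner_algX !natA.
have n4 : 4 <= nm (y - y') + 2 + 4 * r^-1.
  have e4 : (4%:R)%:C *: k = (4%:R)%:C *: k by [].
  have n4k : nm ((4%:R)%:C *: k : A) = 4 by rewrite (nmZr_eq e4) ger0_norm// nk mulr1.
  rewrite -[leLHS]n4k.
  rewrite e; set z1 : A := k * _; set z2 : A := D * k.
  have ez1 : (2%:R)%:C *: z1 = (2%:R)%:C *: z1 by [].
  have ez2 : (4%:R)%:C *: z2 = (4%:R)%:C *: z2 by [].
  have hz1 : nm z1 <= 1.
    by apply: le_trans (nmM _ _) _; rewrite nk mul1r.
  have hz2 : nm z2 <= r^-1.
    apply: le_trans (nmM _ _) _; rewrite nk mulr1 nm_scal ger0_norm//.
    by rewrite invr_ge0 ltW.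
  apply: le_trans (nmD _ _) _; apply: lerD; last first.
    by rewrite (nmZr_eq ez2) ger0_norm// ler_pM2l.
  apply: le_trans (nmD _ _) _; apply: lerD => //.
  by rewrite (nmZr_eq ez1) ger0_norm// -[leRHS]mulr1 ler_pM2l.
have := nmD y (- y'); rewrite nmN => hyy.
have d3 : (1 + r^-1) ^+ 3 <= (11 / 10) ^+ 3.
  by move/andP: d01 => [? ?]; rewrite lerXn2r ?nnegrE//; lra.
(* For r > 10 the right-hand side is at most 2 * (16/27) * (11/10)^3 + 2 + 4/10 < 4. *)
move/andP: d01 => [i0 i1]; clear -hp hm n4 hyy d3 i0 i1; lra.
Qed.
End cstar_order.

(** * The C*-algebra of a complete C*-seminorm *)

Section quotient.
Context (R : realType).

(* A *-algebra with a complete C*-seminorm; Cauchy sequences are only asked to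
   converge when their increments are summable. *)
Record pre_cstar := PreCstar {
  pc_sort :> lmodType R[i] ;
  pc_mul : pc_sort -> pc_sort -> pc_sort ;
  pc_star : pc_sort -> pc_sort ;
  pc_nrm : pc_sort -> R ;
  pc_star_algebra : is_star_algebra (@conjc R) pc_mul pc_star ;
  pc_nrmD : forall x y, pc_nrm (x + y) <= pc_nrm x + pc_nrm y ;
  pc_nrmZ : forall (a : R[i]) x, pc_nrm (a *: x) = nm a * pc_nrm x ;
  pc_nrmM : forall x y, pc_nrm (pc_mul x y) <= pc_nrm x * pc_nrm y ;
  pc_nrmV : forall x, pc_nrm x ^+ 2 = pc_nrm (pc_mul (pc_star x) x) ;
  pc_complete : forall u : nat -> pc_sort,
    (forall n, pc_nrm (u n.+1 - u n) <= 2^-1 ^+ n) ->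
    exists l, forall e, 0 < e -> exists N, forall n, (N <= n)%N ->
      pc_nrm (u n - l) <= e }.

Variable P : pre_cstar.
Local Notation nrm := (@pc_nrm P).
Local Notation mul := (@pc_mul P).
Local Notation star := (@pc_star P).
Implicit Types x y : P.

Let nrm0 : nrm 0 = 0.
Proof. by rewrite -(scale0r 0) pc_nrmZ /nm normr0 mul0r. Qed.
Let nrmN x : nrm (- x) = nrm x.
Proof. by rewrite -scaleN1r pc_nrmZ /nm normrN normr1 mul1r. Qed.
Let nrm_ge0 x : 0 <= nrm x.
Proof. by have := pc_nrmD x (- x); rewrite subrr nrm0 nrmN; lra. Qed.
Let nrmB x y : nrm (x - y) = nrm (y - x).
Proof. by rewrite -opprB nrmN. Qed.

Definition pc_ker : {pred P} := fun x => nrm x == 0.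

Let ker_closed : zmod_closed pc_ker.
Proof.
split; first by rewrite unfold_in nrm0.
move=> x y /eqP x0 /eqP y0; rewrite unfold_in eq_le nrm_ge0 andbT.
by apply: le_trans (pc_nrmD _ _) _; rewrite nrmN x0 y0 addr0.
Qed.

HB.instance Definition _ := GRing.isZmodClosed.Build P pc_ker ker_closed.

Definition pc_quot : Type := (Quotient.quot pc_ker).
HB.instance Definition _ := GRing.Zmodule.on pc_quot.

Definition pc_cls (x : P) : pc_quot := (\pi_(Quotient.quot pc_ker) x)%qT.

Lemma pc_clsP x y : pc_cls x = pc_cls y <-> nrm (x - y) = 0.
Proof.
split=> [/eqP|/eqP h]; last by apply/eqP; rewrite -Quotient.idealrBE.
by rewrite -Quotient.idealrBE => /eqP.
Qed.

Definition pc_rep (a : pc_quot) : P := repr (a : (Quotient.quot pc_ker)).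
Lemma pc_repK a : pc_cls (pc_rep a) = a. Proof. exact: reprK. Qed.

Lemma pc_clsD x y : pc_cls (x + y) = pc_cls x + pc_cls y.
Proof. by rewrite /pc_cls Quotient.pi_add. Qed.
Lemma pc_clsN x : pc_cls (- x) = - pc_cls x.
Proof. by rewrite /pc_cls Quotient.pi_opp. Qed.

Let starB x y : star (x - y) = star x - star y.
Proof.
by rewrite (sa_starD (pc_star_algebra P)) (sa_starN (pc_star_algebra P)).
Qed.
Let nrm_star x : nrm (star x) = nrm x.
Proof.
have h y : nrm y <= nrm (star y).
  have [->|y0] := eqVneq (nrm y) 0; first exact: nrm_ge0.
  have y0' : 0 < nrm y by rewrite lt_def y0 nrm_ge0.
  by rewrite -(ler_pM2r y0') -expr2 pc_nrmV pc_nrmM.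
by apply/eqP; rewrite eq_le h andbT -{2}(sa_starK (pc_star_algebra P) x) h.
Qed.

Let eq0 (r : R) : 0 <= r -> r <= 0 -> r = 0.
Proof. by move=> h1 h2; apply/eqP; rewrite eq_le h1 h2. Qed.

Let mulBr x y z : mul x (y - z) = mul x y - mul x z.
Proof.
rewrite (sa_mulDr (pc_star_algebra P)); congr (_ + _).
apply: (addrI (mul x z)); rewrite -(sa_mulDr (pc_star_algebra P)) !subrr.
by apply: (addrI (mul x 0)); rewrite -(sa_mulDr (pc_star_algebra P)) !addr0.
Qed.
Let mulBl x y z : mul (y - z) x = mul y x - mul z x.
Proof.
rewrite (sa_mulDl (pc_star_algebra P)); congr (_ + _).
apply: (addrI (mul z x)); rewrite -(sa_mulDl (pc_star_algebra P)) !subrr.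
by apply: (addrI (mul 0 x)); rewrite -(sa_mulDl (pc_star_algebra P)) !addr0.
Qed.

Definition pcq_scale (a : R[i]) (u : pc_quot) : pc_quot := pc_cls (a *: pc_rep u).
Definition pcq_mul (u v : pc_quot) : pc_quot := pc_cls (mul (pc_rep u) (pc_rep v)).
Definition pcq_star (u : pc_quot) : pc_quot := pc_cls (star (pc_rep u)).
Definition pcq_norm (u : pc_quot) : R[i] := (nrm (pc_rep u))%:C.

Let rep_cls x : nrm (pc_rep (pc_cls x) - x) = 0.
Proof. by apply/pc_clsP; rewrite pc_repK. Qed.

Let clsZ a x : pcq_scale a (pc_cls x) = pc_cls (a *: x).
Proof. by apply/pc_clsP; rewrite -scalerBr pc_nrmZ rep_cls mulr0. Qed.
Let cls_star x : pcq_star (pc_cls x) = pc_cls (star x).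
Proof. by apply/pc_clsP; rewrite -starB nrm_star rep_cls. Qed.
Let clsM x y : pcq_mul (pc_cls x) (pc_cls y) = pc_cls (mul x y).
Proof.
apply/pc_clsP; set x' := pc_rep _; set y' := pc_rep _.
have -> : mul x' y' - mul x y = mul (x' - x) y' + mul x (y' - y).
  by rewrite mulBr mulBl addrA subrK.
apply: eq0 => //; apply: le_trans (pc_nrmD _ _) _.
apply: le_trans (lerD (pc_nrmM _ _) (pc_nrmM _ _)) _.
by rewrite !rep_cls mul0r mulr0 addr0.
Qed.
Let norm_cls x : pcq_norm (pc_cls x) = (nrm x)%:C.
Proof.
rewrite /pcq_norm; congr (_%:C); set y := pc_rep _.
apply/eqP; rewrite eq_le; apply/andP; split.
  by have := pc_nrmD (y - x) x; rewrite subrK rep_cls add0r.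
by have := pc_nrmD (x - y) y; rewrite subrK nrmB rep_cls add0r.
Qed.

Let quot_ind (Q : pc_quot -> Prop) : (forall x, Q (pc_cls x)) -> forall a, Q a.
Proof. by move=> h a; rewrite -(pc_repK a). Qed.

Let scaleA a b v : pcq_scale a (pcq_scale b v) = pcq_scale (a * b) v.
Proof. by elim/quot_ind: v => x; rewrite !clsZ scalerA. Qed.
Let scale1 : left_id 1 pcq_scale.
Proof. by elim/quot_ind => x; rewrite !clsZ scale1r. Qed.
Let scaleDr : right_distributive pcq_scale +%R.
Proof.
move=> a u v; elim/quot_ind: u => x; elim/quot_ind: v => y.
by rewrite -pc_clsD !clsZ -pc_clsD scalerDr.
Qed.
Let scaleDl v : {morph pcq_scale^~ v : a b / a + b}.
Proof. by move=> a b; elim/quot_ind: v => x; rewrite !clsZ -pc_clsD scalerDl. Qed.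

HB.instance Definition _ := GRing.Zmodule_isLmodule.Build R[i] pc_quot
  scaleA scale1 scaleDr scaleDl.

Let qnormD u v : pcq_norm (u + v) <= pcq_norm u + pcq_norm v.
Proof.
elim/quot_ind: u => x; elim/quot_ind: v => y.
by rewrite -pc_clsD !norm_cls -rmorphD lecR pc_nrmD.
Qed.
Let qnormZ (l : R[i]) (u : pc_quot) : pcq_norm (l *: u) = `|l| * pcq_norm u.
Proof.
elim/quot_ind: u => x.
by rewrite [_ *: _]clsZ !norm_cls nmE -rmorphM pc_nrmZ.
Qed.
Let qnorm0 u : pcq_norm u = 0 -> u = 0.
Proof.
elim/quot_ind: u => x; rewrite norm_cls => /complexI x0.
have -> : 0 = pc_cls 0 by apply: (addrI (pc_cls 0)); rewrite -pc_clsD !addr0.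
by apply/pc_clsP; rewrite subr0.
Qed.

HB.instance Definition _ := Lmodule_isNormed.Build R[i] pc_quot
  qnormD qnormZ qnorm0.

Lemma pc_nm x : nm (pc_cls x : pc_quot) = nrm x.
Proof. by rewrite /nm [`|_|]norm_cls. Qed.

Let qcomplete (F : set_system pc_quot) : ProperFilter F -> cauchy F -> cvg F.
Proof.
move=> FF /cauchyP Fc.
(* Consecutive balls meet because both belong to F, so their centers are closer than 2^-(n+3) +
   2^-(n+2) < 2^-n, as [pc_complete] wants. *)
pose e n : R := 2^-1 ^+ n.+2; have e0 n : 0 < e n by rewrite exprn_gt0.
have /choice[x hx] : forall n, exists x : pc_quot, F (ball x (e n)%:C).
  by move=> n; apply: Fc; rewrite ltcR.
have ball_nm (y z : pc_quot) r : ball y r%:C z -> nm (y - z) < r.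
  by rewrite -ball_normE /= nmE ltcR.
pose u n := pc_rep (x n).
have ux n : pc_cls (u n) = x n by exact: pc_repK.
have hu n : nrm (u n.+1 - u n) <= 2^-1 ^+ n.
  rewrite -pc_nm pc_clsD pc_clsN !ux.
  have [z [/ball_nm z1 /ball_nm z2]] := filter_ex (filterI (hx n.+1) (hx n)).
  rewrite -(subrK z (x n.+1)) -addrA; apply: le_trans (nmD _ _) _.
  rewrite (nmB z); apply: le_trans (lerD (ltW z1) (ltW z2)) _.
  have : 0 < (2^-1 : R) ^+ n by rewrite exprn_gt0.
  by rewrite /e !exprS; lra.
have [l hl] := pc_complete hu.
apply/cvg_ex; exists (pc_cls l); apply/cvgrPdist_lt => r r0.
have r0' : 0 < complex.Re r by move: r0; rewrite ltcE => /andP[].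
have r2 : 0 < complex.Re r / 2 by rewrite divr_gt0.
have [N hN] := hl _ r2.
have half01 : 0 <= (2^-1 : R) < 1 by lra.
have [M hM] := geometric_small 1 half01 r2.
pose n := (N + M)%N.
have en : e n < complex.Re r / 2.
  apply: le_lt_trans hM; rewrite mul1r /e (_ : n.+2 = (M + N.+2)%N) ?exprD; last by rewrite !addnS addnC.
  rewrite ler_piMr ?exprn_ge0//; apply: exprn_ile1; lra.
apply: filterS (hx n) => z /ball_nm hz.
rewrite nmE -(RRe_real (gtr0_real r0)) ltcR.
rewrite -(subrK (x n) (pc_cls l)) -addrA; apply: le_lt_trans (nmD _ _) _.
have := hN n (leq_addr _ _); rewrite -pc_nm pc_clsD pc_clsN ux nmB; lra.
Qed.

HB.instance Definition _ := Uniform_isComplete.Build pc_quot qcomplete.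

Let q_star_algebra : is_star_algebra (@conjc R) pcq_mul pcq_star.
Proof.
have h := pc_star_algebra P.
split.
- move=> a b c; elim/quot_ind: a => x; elim/quot_ind: b => y; elim/quot_ind: c => z.
  by rewrite !clsM (sa_mulA h).
- move=> a b c; elim/quot_ind: a => x; elim/quot_ind: b => y; elim/quot_ind: c => z.
  by rewrite -pc_clsD !clsM -pc_clsD (sa_mulDl h).
- move=> a b c; elim/quot_ind: a => x; elim/quot_ind: b => y; elim/quot_ind: c => z.
  by rewrite -pc_clsD !clsM -pc_clsD (sa_mulDr h).
- move=> a b c; elim/quot_ind: b => y; elim/quot_ind: c => z.
  by rewrite clsM /GRing.scale /= !clsZ clsM (sa_scaleAl h).
- move=> a b c; elim/quot_ind: b => y; elim/quot_ind: c => z.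
  by rewrite clsM /GRing.scale /= !clsZ clsM (sa_scaleAr h).
- by elim/quot_ind => x; rewrite !cls_star (sa_starK h).
- move=> a b; elim/quot_ind: a => x; elim/quot_ind: b => y.
  by rewrite -pc_clsD !cls_star -pc_clsD (sa_starD h).
- move=> a b; elim/quot_ind: b => y.
  by rewrite cls_star /GRing.scale /= !clsZ cls_star (sa_starZ h).
- move=> a b; elim/quot_ind: a => x; elim/quot_ind: b => y.
  by rewrite clsM !cls_star clsM (sa_starM h).
Qed.

Let q_normM (u v : pc_quot) : `|pcq_mul u v| <= `|u| * `|v|.
Proof.
elim/quot_ind: u => x; elim/quot_ind: v => y.
by rewrite clsM !nmE !pc_nm -rmorphM lecR pc_nrmM.
Qed.
Let q_normV (u : pc_quot) : `|u| ^+ 2 = `|pcq_mul (pcq_star u) u|.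
Proof.
elim/quot_ind: u => x.
by rewrite cls_star clsM !nmE !pc_nm -rmorphXn pc_nrmV.
Qed.

Definition pc_cstar : cstar_algebra R :=
  @CStarAlgebra R pc_quot pcq_mul pcq_star q_star_algebra q_normM q_normV.

Definition pcls (x : P) : pc_cstar := pc_cls x.

Lemma pclsD x y : pcls (x + y) = pcls x + pcls y.
Proof. exact: pc_clsD. Qed.
Lemma pclsZ a x : pcls (a *: x) = a *: pcls x.
Proof. exact/esym/clsZ. Qed.
Lemma pclsM x y : pcls (mul x y) = cs_mul (pcls x) (pcls y).
Proof. exact/esym/clsM. Qed.
Lemma pcls_star x : pcls (star x) = cs_star (pcls x).
Proof. exact/esym/cls_star. Qed.
Lemma nm_pcls x : nm (pcls x) = nrm x.
Proof. exact: pc_nm. Qed.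
Lemma pcls_surj (u : pc_cstar) : exists x, pcls x = u.
Proof. by exists (pc_rep u); exact: pc_repK. Qed.

Section lift.
Variables (W : lmodType R[i]) (f : P -> W).
Hypothesis flin : forall a x y, f (a *: x + y) = a *: f x + f y.
Hypothesis fker : forall x, nrm x = 0 -> f x = 0.

Definition pc_lift (u : pc_cstar) : W := f (pc_rep u).

Lemma pc_liftE x : pc_lift (pcls x) = f x.
Proof.
apply/eqP; rewrite -subr_eq0; apply/eqP.
have -> : pc_lift (pcls x) - f x = f (pc_rep (pc_cls x) - x).
  by rewrite addrC -scaleN1r -flin scaleN1r addrC.
exact: fker.
Qed.

Let pc_lift_linear : linear pc_lift.
Proof.
move=> a u v; have [x <-] := pcls_surj u; have [y <-] := pcls_surj v.
by rewrite -pclsZ -pclsD !pc_liftE flin.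
Qed.

HB.instance Definition _ := GRing.isLinear.Build R[i] pc_cstar W *:%R pc_lift pc_lift_linear.

Definition pc_lift_lin : {linear pc_cstar -> W} := pc_lift.

Lemma pc_lift_linE x : pc_lift_lin (pcls x) = f x.
Proof. exact: pc_liftE. Qed.
End lift.

Section lift_scalar.
Variable f : P -> R[i].
Hypothesis flin : forall a x y, f (a *: x + y) = a * f x + f y.
Hypothesis fker : forall x, nrm x = 0 -> f x = 0.

Definition pc_lift_s (u : pc_cstar) : R[i] := f (pc_rep u).

Lemma pc_lift_sE x : pc_lift_s (pcls x) = f x.
Proof. exact: (@pc_liftE R[i]^o f flin fker x). Qed.

Let pc_lift_s_linear : scalar pc_lift_s.
Proof.
move=> a u v; have [x <-] := pcls_surj u; have [y <-] := pcls_surj v.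
by rewrite -pclsZ -pclsD !pc_lift_sE flin.
Qed.

HB.instance Definition _ :=
  GRing.isLinear.Build R[i] pc_cstar R[i] *%R pc_lift_s pc_lift_s_linear.

Definition pc_lift_scalar : {scalar pc_cstar} := pc_lift_s.

Lemma pc_lift_scalarE x : pc_lift_scalar (pcls x) = f x.
Proof. exact: pc_lift_sE. Qed.
End lift_scalar.
End quotient.

(** * Limits along ultrafilters *)

Section complex_limits.
Context (R : realType).

Lemma nm_le_ReIm (z : R[i]) : nm z <= `|complex.Re z| + `|complex.Im z|.
Proof.
rewrite {1}(complexE z); apply: le_trans (nmD _ _) _; rewrite nm_real lerD2l.
by rewrite -[_ * _]/(_ *: _) (nmZ (V := R[i]^o)) nm_iC mul1r nm_real.
Qed.

Lemma Re_le_nm (z : R[i]) : `|complex.Re z| <= nm z.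
Proof. by rewrite -lecR -nmE normc_ge_Re. Qed.

Lemma Im_le_nm (z : R[i]) : `|complex.Im z| <= nm z.
Proof.
have -> : complex.Im z = complex.Re (- Complex 0 1 * z).
  by case: z => a b /=; rewrite oppr0 mul0r sub0r mulN1r opprK.
apply: le_trans (Re_le_nm _) _; rewrite -[_ * _]/(_ *: _) (nmZ (V := R[i]^o)).
by rewrite nmN nm_iC mul1r.
Qed.

Lemma nmM_C (a b : R[i]) : nm (a * b) = nm a * nm b.
Proof. by rewrite -[_ * _]/(_ *: _) (nmZ (V := R[i]^o)). Qed.

Lemma nm_conj (a : R[i]) : nm (conjc a) = nm a.
Proof. by rewrite /nm normcJ. Qed.

Lemma ge0_nm (a : R[i]) : 0 <= a -> a = (nm a)%:C.
Proof. by move=> a0; rewrite -nmE ger0_norm. Qed.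

(** The limit is the supremum S of the eventual lower bounds. If f < S + e failed to hold
    eventually, the ultrafilter would make S + e an eventual lower bound. *)
Lemma ultra_cvg_real (T : Type) (F : set_system T) (f : T -> R) (M : R) :
  UltraFilter F -> (\forall x \near F, `|f x| <= M) -> cvg (f @ F).
Proof.
move=> UF bf; have PF : ProperFilter F by exact: ultra_proper.
pose S := [set r | \forall x \near F, r <= f x].
have Sub r : S r -> r <= M.
  move=> Sr; have [x [h1 h2]] := filter_ex (filterI Sr bf).
  by apply: le_trans h1 _; exact: le_trans (ler_norm _) h2.
have hS : has_sup S.
  split; last by exists M => r; exact: Sub.
  by exists (- M); apply: filterS bf => x; rewrite ler_norml => /andP[].
apply/cvg_ex; exists (sup S); apply/cvgrPdist_lt => e e0.
have h1 : \forall x \near F, sup S - e < f x.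
  have [r Sr hr] := sup_adherent e0 hS.
  by apply: filterS Sr => x; exact: lt_le_trans.
have h2 : \forall x \near F, f x < sup S + e.
  have [h|h] := in_ultra_setVsetC [set x | f x < sup S + e] UF; first exact: h.
  have : S (sup S + e) by apply: filterS h => x /= /negP; rewrite -leNgt.
  move=> /(ub_le_sup hS.2); rewrite gerDl => /(lt_le_trans e0); by rewrite ltxx.
apply: filterS2 h1 h2 => x h1 h2; rewrite distrC ltr_norml; apply/andP; split; lra.
Qed.

End complex_limits.

Section ccvg.
Context (R : realType) (T : Type) (F : set_system T).

(* Convergence in R[i]; stated by hand since R[i] has no canonical topology. *)
Definition ccvg (f : T -> R[i]) (l : R[i]) :=
  forall e : R, 0 < e -> \forall x \near F, nm (f x - l) < e.

Definition clim (f : T -> R[i]) : R[i] := xget 0 [set l | ccvg f l].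

Lemma ultra_ccvg (f : T -> R[i]) (M : R) :
  UltraFilter F -> (\forall x \near F, nm (f x) <= M) -> ccvg f (clim f).
Proof.
move=> UF bf; have PF : ProperFilter F by exact: ultra_proper.
suff [l hl] : exists l, ccvg f l by rewrite /clim; case: xgetP => [y ->//|/(_ l)].
have bR : \forall x \near F, `|complex.Re (f x)| <= M.
  by apply: filterS bf => x; exact: le_trans (Re_le_nm _).
have bI : \forall x \near F, `|complex.Im (f x)| <= M.
  by apply: filterS bf => x; exact: le_trans (Im_le_nm _).
have /cvg_ex[a /cvgrPdist_lt ha] := ultra_cvg_real UF bR.
have /cvg_ex[b /cvgrPdist_lt hb] := ultra_cvg_real UF bI.
exists (Complex a b) => e e0; have e2 : 0 < e / 2 by rewrite divr_gt0.
apply: filterS2 (ha _ e2) (hb _ e2) => x h1 h2.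
apply: le_lt_trans (nm_le_ReIm _) _; rewrite (splitr e).
by case: (f x) h1 h2 => u v /= h1 h2; rewrite distrC [X in _ + X]distrC ltrD.
Qed.

Hypothesis FF : ProperFilter F.
Implicit Types f g : T -> R[i].

Lemma ccvg_unique f a b : ccvg f a -> ccvg f b -> a = b.
Proof.
move=> fa fb; apply/eqP; rewrite -subr_eq0; apply/eqP/nm_eq0/eqP.
rewrite eq_le nm_ge0 andbT; apply/ler_addgt0Pr => e e0; rewrite add0r.
have e2 : 0 < e / 2 by rewrite divr_gt0.
have [x [h1 h2]] := filter_ex (filterI (fa _ e2) (fb _ e2)).
rewrite -(subrK (f x) a) -addrA; apply: le_trans (nmD _ _) _.
by rewrite (nmB a) [leRHS]splitr lerD// ltW.
Qed.

Lemma climE f l : ccvg f l -> clim f = l.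
Proof.
move=> fl; rewrite /clim; case: xgetP => [y -> fy|/(_ l)//].
exact: ccvg_unique fl.
Qed.

Lemma ccvg_near f g l : (\forall x \near F, f x = g x) -> ccvg f l -> ccvg g l.
Proof. by move=> fg fl e /fl; apply: filterS2 fg => x ->. Qed.

Lemma ccvg_cst c : ccvg (fun=> c) c.
Proof. by move=> e e0; apply: nearW => x; rewrite subrr nm0. Qed.

Lemma ccvgD f g a b : ccvg f a -> ccvg g b -> ccvg (fun x => f x + g x) (a + b).
Proof.
move=> fa gb e e0; have e2 : 0 < e / 2 by rewrite divr_gt0.
apply: filterS2 (fa _ e2) (gb _ e2) => x h1 h2.
by rewrite opprD addrACA (splitr e); apply: le_lt_trans (nmD _ _) _; rewrite ltrD.
Qed.

Lemma ccvgZ c f a : ccvg f a -> ccvg (fun x => c * f x) (c * a).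
Proof.
move=> fa e e0; have c1 : 0 < nm c + 1 by have := nm_ge0 c; lra.
have e1 : 0 < e / (nm c + 1) by rewrite divr_gt0.
apply: filterS (fa _ e1) => x; rewrite -mulrBr nmM_C ltr_pdivlMr// => h.
by have := nm_ge0 (f x - a); have := nm_ge0 c; nra.
Qed.

Lemma ccvgM0 f g (M : R) : ccvg f 0 -> (\forall x \near F, nm (g x) <= M) ->
  ccvg (fun x => f x * g x) 0.
Proof.
move=> fa gM e e0; have c1 : 0 < `|M| + 1 by have := normr_ge0 M; lra.
have e1 : 0 < e / (`|M| + 1) by rewrite divr_gt0.
apply: filterS2 gM (fa _ e1) => x gM; rewrite !subr0 nmM_C ltr_pdivlMr// => h.
have := nm_ge0 (f x); have := nm_ge0 (g x); have := ler_norm M; nra.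
Qed.

Lemma ccvg_bounded f a : ccvg f a -> \forall x \near F, nm (f x) <= nm a + 1.
Proof.
move=> fa; apply: filterS (fa _ (@ltr01 R)) => x h; rewrite -(subrK a (f x)) addrC.
by apply: le_trans (nmD _ _) _; rewrite lerD2l ltW.
Qed.

Lemma ccvgM f g a b : ccvg f a -> ccvg g b -> ccvg (fun x => f x * g x) (a * b).
Proof.
move=> fa gb; have fa0 : ccvg (fun x => f x - a) 0.
  by move=> e /fa; apply: filterS => x; rewrite subr0.
have h1 := ccvgM0 fa0 (ccvg_bounded gb); have h2 := ccvgZ a gb.
rewrite -(add0r (a * b)); apply: ccvg_near (ccvgD h1 h2).
by apply: nearW => x; rewrite mulrBl subrK.
Qed.

Lemma ccvg_nm f a : ccvg f a -> ccvg (fun x => (nm (f x))%:C) (nm a)%:C.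
Proof.
move=> fa e e0; apply: filterS (fa _ e0) => x; rewrite -rmorphB nm_real.
apply: le_lt_trans; rewrite ler_norml; apply/andP; split.
  by rewrite lerNl opprB lerBlDl -{1}(subrK (f x) a) addrC nmB; exact: nmD.
by rewrite lerBlDl -{1}(subrK a (f x)) addrC; exact: nmD.
Qed.

Lemma ccvg_le f g (a b : R) : ccvg f a%:C -> ccvg g b%:C ->
  (\forall x \near F, complex.Re (f x) <= complex.Re (g x)) -> a <= b.
Proof.
move=> fa gb fg; apply/ler_addgt0Pr => e e0; have e2 : 0 < e / 2 by rewrite divr_gt0.
have [x [[h1 h2] h3]] := filter_ex (filterI (filterI (fa _ e2) (gb _ e2)) fg).
have := le_lt_trans (Re_le_nm _) h1; have := le_lt_trans (Re_le_nm _) h2.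
case: (f x) (g x) h3 => u v [u' v'] /= h3.
by rewrite !ltr_norml => /andP[? ?] /andP[? ?]; lra.
Qed.

Lemma ccvg_ge0 f a : ccvg f a -> (\forall x \near F, 0 <= f x) -> 0 <= a.
Proof.
move=> fa f0; have e : a = (nm a)%:C.
  apply: (ccvg_unique fa); apply: ccvg_near (ccvg_nm fa).
  by apply: filterS f0 => x /ge0_nm <-.
by rewrite e ler0c nm_ge0.
Qed.

End ccvg.

(* At almost every point w, the ultrafilter G w converges to w for any given
   measurable function. *)
Section lifting_limits.
Context (R : realType) (d : measure_display) (T : measurableType d).
Variables (mu : {measure set T -> \bar R}) (G : T -> set_system T).
Hypothesis UG : forall w, UltraFilter (G w).
Hypothesis GA : forall A, measurable A -> \forall w \ae mu, G w A <-> A w.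

(** Only the sets where h exceeds a rational matter. They are countably many, so outside one null
    set G w decides all of them as w does. *)
Lemma ae_lifting_real (h : T -> R) : measurable_fun setT h ->
  \forall w \ae mu, forall e, 0 < e -> \forall x \near G w, `|h x - h w| < e.
Proof.
move=> mh.
pose A (q : rat) := [set x | ratr q < h x].
have mA q : measurable (A q).
  have -> : A q = setT `&` h @^-1` `]ratr q, +oo[.
    by apply/seteqP; split=> x /=; rewrite in_itv/= andbT => // -[].
  by apply: mh => //; exact: measurable_itv.
have : \forall w \ae mu, forall n : nat,
    if unpickle n is Some q then G w (A q) <-> A q w else True.
  apply/ae_foralln => n; case: (unpickle n) => [q|]; first exact: GA.
  exact: aeW.
apply: filterS => w hw e e0.
have {}hw q : G w (A q) <-> A q w by have := hw (pickle q); rewrite pickleK.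
have PG : ProperFilter (G w) by exact: ultra_proper.
have h1 : h w - e < h w by lra.
have h2 : h w < h w + e by lra.
have [q] := rat_in_itvoo h1; rewrite in_itv/= => /andP[q1 q2].
have [q'] := rat_in_itvoo h2; rewrite in_itv/= => /andP[q1' q2'].
have Gq : G w (A q) by apply/hw.
have Gq' : G w (~` A q').
  have [/hw|//] := in_ultra_setVsetC (A q') (UG w).
  by rewrite /A /= ltNge (ltW q1').
apply: filterS2 Gq Gq' => x /= hq /negP; rewrite -leNgt => hq'.
by move: hq; rewrite /A /= ltr_norml => hq; apply/andP; split; lra.
Qed.

Lemma ae_lifting (f : T -> R[i]) : cmeasurable setT f ->
  \forall w \ae mu, ccvg (G w) f (f w).
Proof.
move=> [mr mi]; apply: filterS2 (ae_lifting_real mr) (ae_lifting_real mi) => w hr hi e e0.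
have PG : ProperFilter (G w) by exact: ultra_proper.
have e2 : 0 < e / 2 by rewrite divr_gt0.
apply: filterS2 (hr _ e2) (hi _ e2) => x h1 h2.
apply: le_lt_trans (nm_le_ReIm _) _; rewrite (splitr e).
by case: (f x) (f w) h1 h2 => u v [u' v'] /= h1 h2; rewrite ltrD.
Qed.
End lifting_limits.

(** * The fibers and their sections *)

Section L0_theory.
Context (R : realType) (d : measure_display) (T : measurableType d).
Variable mu : {measure set T -> \bar R}.
Local Notation L0 := (L0 mu).
Implicit Types a b : L0.

Lemma L0_meas a : cmeasurable setT a.
Proof. exact: (cmfunP (repr a)). Qed.

Lemma L0_leP a b : (a <= b) <-> \forall w \ae mu, a w <= b w.
Proof. by split=> /asboolP. Qed.

Definition L0c (f : T -> R[i]) (mf : cmeasurable setT f) : L0 := L0_class mu (CMfun mf).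

Lemma L0cE f (mf : cmeasurable setT f) : \forall w \ae mu, L0c mf w = f w.
Proof. exact: L0_classE. Qed.

Lemma L0DE a b : \forall w \ae mu, (a + b : L0) w = a w + b w. Proof. exact: L0_addE. Qed.
Lemma L0NE a : \forall w \ae mu, (- a : L0) w = - a w. Proof. exact: L0_oppE. Qed.
Lemma L0BE a b : \forall w \ae mu, (a - b : L0) w = a w - b w.
Proof. by apply: filterS2 (L0DE a (- b)) (L0NE b) => w -> ->. Qed.
Lemma L0ME a b : \forall w \ae mu, (a * b : L0) w = a w * b w. Proof. exact: L0_mulE. Qed.
Lemma L00E : \forall w \ae mu, (0 : L0) w = 0. Proof. exact: L0_cstE. Qed.
Lemma L01E : \forall w \ae mu, (1 : L0) w = 1. Proof. exact: L0_cstE. Qed.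

Lemma L0_cstM (c c' : R[i]) : L0_cst mu (c * c') = L0_cst mu c * L0_cst mu c'.
Proof.
apply/L0_eqP; near=> w.
rewrite (near (L0ME (L0_cst mu c) (L0_cst mu c')) w)// (near (L0_cstE mu c) w)//.
by rewrite (near (L0_cstE mu c') w)// (near (L0_cstE mu (c * c')) w).
Unshelve. all: by end_near. Qed.

Lemma L0_cstD (c c' : R[i]) : L0_cst mu (c + c') = L0_cst mu c + L0_cst mu c'.
Proof.
apply/L0_eqP; near=> w.
rewrite (near (L0DE (L0_cst mu c) (L0_cst mu c')) w)// (near (L0_cstE mu c) w)//.
by rewrite (near (L0_cstE mu c') w)// (near (L0_cstE mu (c + c')) w).
Unshelve. all: by end_near. Qed.

Lemma L0_conj_cst (c : R[i]) : L0_conj (L0_cst mu c) = L0_cst mu (conjc c).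
Proof.
apply/L0_eqP; near=> w.
rewrite (near (L0_conjE (L0_cst mu c)) w)// (near (L0_cstE mu c) w)//.
by rewrite (near (L0_cstE mu (conjc c)) w).
Unshelve. all: by end_near. Qed.

Lemma cmeasurable_real (f : T -> R) : measurable_fun setT f ->
  cmeasurable setT (fun w => (f w)%:C).
Proof. by move=> mf; split=> //=; exact: measurable_cst. Qed.

Lemma measurable_nm (f : T -> R[i]) : cmeasurable setT f ->
  measurable_fun setT (fun w => nm (f w)).
Proof. by move=> mf; have [] := cmeasurable_norm (CMfun mf). Qed.

End L0_theory.

Section L0_module.
Context (R : realType) (d : measure_display) (T : measurableType d).
Context (mu : {measure set T -> \bar R}) (U : cstar_algebra_L0 mu).
Local Notation L0 := (L0 mu).
Local Notation mul := (@csL_mul _ _ _ _ U).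
Local Notation star := (@csL_star _ _ _ _ U).
Implicit Types (x y : U) (a b : L0).

(** A measurable real representative of the L0-norm, nonnegative at every point; the norm axioms
    hold for it almost everywhere. *)
Definition nrmf x (w : T) : R := nm (csL_norm x w).

Let hN : L0_norm (@csL_norm _ _ _ _ U) := BK_norm (csL_BK U).

Lemma nrmf_ge0 x w : 0 <= nrmf x w. Proof. exact: nm_ge0. Qed.

Lemma measurable_nrmf x : measurable_fun setT (nrmf x).
Proof. exact: measurable_nm (L0_meas _). Qed.

Lemma nrmfE x : \forall w \ae mu, csL_norm x w = (nrmf x w)%:C.
Proof.
have /L0_leP := L0_norm_ge0 hN x; apply: filterS2 (L00E mu) => w -> /ge0_nm; exact.
Qed.

Lemma nrmfD x y : \forall w \ae mu, nrmf (x + y) w <= nrmf x w + nrmf y w.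
Proof.
have /L0_leP h := L0_normD hN x y; near=> w.
have := near h w; rewrite (near (L0DE (csL_norm x) (csL_norm y)) w)//.
rewrite (near (nrmfE x) w)// (near (nrmfE y) w)// (near (nrmfE (x + y)) w)//.
by rewrite -rmorphD lecR; apply.
Unshelve. all: by end_near. Qed.

Lemma nrmfZ a x : \forall w \ae mu, nrmf (a *: x) w = nm (a w) * nrmf x w.
Proof.
have h := L0_normZ hN a x; near=> w; apply: complexI; rewrite rmorphM/=.
rewrite -(near (nrmfE x) w)// -(near (nrmfE (a *: x)) w)// h.
by rewrite (near (L0ME (L0_abs a) (csL_norm x)) w)// (near (L0_absE a) w)// nmE.
Unshelve. all: by end_near. Qed.

Lemma nrmfM x y : \forall w \ae mu, nrmf (mul x y) w <= nrmf x w * nrmf y w.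
Proof.
have /L0_leP h := csL_normM x y; near=> w.
have := near h w; rewrite (near (L0ME (csL_norm x) (csL_norm y)) w)//.
rewrite (near (nrmfE x) w)// (near (nrmfE y) w)// (near (nrmfE (mul x y)) w)//.
by rewrite -rmorphM lecR; apply.
Unshelve. all: by end_near. Qed.

Lemma nrmfV x : \forall w \ae mu, nrmf x w ^+ 2 = nrmf (mul (star x) x) w.
Proof.
have h := csL_normV x; near=> w; apply: complexI; rewrite rmorphXn/=.
rewrite -(near (nrmfE x) w)// -(near (nrmfE (mul (star x) x)) w)// -h !expr2.
by rewrite (near (L0ME (csL_norm x) (csL_norm x)) w).
Unshelve. all: by end_near. Qed.

Lemma nrmf_eq0 x : (\forall w \ae mu, nrmf x w = 0) -> x = 0.
Proof.
move=> h; apply/(L0_norm_eq0 hN)/L0_eqP.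
by apply: filterS3 (nrmfE x) (L00E mu) h => w -> -> ->.
Qed.

Lemma nrmf0 : \forall w \ae mu, nrmf 0 w = 0.
Proof.
have -> : 0 = (0 : L0) *: (0 : U) by rewrite scale0r.
by apply: filterS2 (nrmfZ 0 0) (L00E mu) => w -> ->; rewrite nm0 mul0r.
Qed.

Lemma nrmfN x : \forall w \ae mu, nrmf (- x) w = nrmf x w.
Proof.
rewrite -scaleN1r; near=> w.
rewrite (near (nrmfZ (- 1) x) w)// (near (L0NE (1 : L0)) w)// (near (L01E mu) w)//.
by rewrite nmN /nm normr1 mul1r.
Unshelve. all: by end_near. Qed.

Lemma nrmfB x y : \forall w \ae mu, nrmf (x - y) w = nrmf (y - x) w.
Proof. by rewrite -opprB; exact: nrmfN. Qed.

Lemma nrmf_star x : \forall w \ae mu, nrmf (star x) w = nrmf x w.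
Proof.
have key y : \forall w \ae mu, nrmf y w <= nrmf (star y) w.
  apply: filterS2 (nrmfV y) (nrmfM (star y) y) => w <- h.
  have [->|y0] := eqVneq (nrmf y w) 0; first exact: nrmf_ge0.
  have y0' : 0 < nrmf y w by rewrite lt_def y0 nrmf_ge0.
  by rewrite -(ler_pM2r y0') -expr2.
have := key (star x); rewrite (sa_starK (csL_star_algebra U)).
by apply: filterS2 (key x) => w h1 h2; apply/eqP; rewrite eq_le h1 h2.
Qed.

Lemma nrmfV' x : \forall w \ae mu, nrmf x w ^+ 2 = nrmf (mul x (star x)) w.
Proof.
have := nrmfV (star x); rewrite (sa_starK (csL_star_algebra U)).
by apply: filterS2 (nrmf_star x) => w ->.
Qed.

Lemma nrmf_cstZ (c : R[i]) x : \forall w \ae mu, nrmf (L0_cst mu c *: x) w = nm c * nrmf x w.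
Proof. by apply: filterS2 (nrmfZ (L0_cst mu c) x) (L0_cstE mu c) => w -> ->. Qed.

(** Turns order completeness for nets into a statement about functions: the classes of the D n
    decrease to 0 in L0 and witness that u is fundamental. The limit inherits the explicit error
    bound D n, whereas order convergence only provides an unknown dominating net. *)
Lemma L0_complete (u : nat -> U) (D : nat -> T -> R) :
  (forall n, measurable_fun setT (D n)) ->
  (forall n, \forall w \ae mu, forall p q, (n <= p)%N -> (n <= q)%N -> nrmf (u p - u q) w <= D n w) ->
  (forall m n, (m <= n)%N -> \forall w \ae mu, D n w <= D m w) ->
  (\forall w \ae mu, forall e, 0 < e -> exists n, D n w <= e) ->
  exists l, forall n, \forall w \ae mu, nrmf (u n - l) w <= D n w.
Proof.
move=> mD hD Dmono D0.
pose g n : L0 := L0c mu (cmeasurable_real (mD n)).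
have gE n : \forall w \ae mu, g n w = (D n w)%:C by exact: L0cE.
have D_ge0 n : \forall w \ae mu, 0 <= D n w.
  by apply: filterS (hD n) => w /(_ n n (leqnn _) (leqnn _)); apply: le_trans; exact: nrmf_ge0.
have normB x : \forall w \ae mu, L0_abs (csL_norm (x - 0) - 0 : L0) w = (nrmf x w)%:C.
  apply: filterS2 (L0_absE (csL_norm (x - 0) - 0 : L0)) (nrmfE x) => w ->.
  by rewrite !subr0 => ->; rewrite ger0_norm// ler0c nrmf_ge0.
have [||l [B [leB [h [dB hmono [hlb hglb] hub]]]]] := BK_complete (csL_BK U) (A := nat) (le := fun m n => (m <= n)%N) (x := u).
- split; [exact: (inhabits 0%N)|exact: leqnn|by move=> ? ? ?; exact: leq_trans|].
  by move=> m n; exists (maxn m n); split; [exact: leq_maxl|exact: leq_maxr].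
- exists nat, (fun m n => (m <= n)%N), g; split.
  + split; [exact: (inhabits 0%N)|exact: leqnn|by move=> ? ? ?; exact: leq_trans|].
    by move=> m n; exists (maxn m n); split; [exact: leq_maxl|exact: leq_maxr].
  + move=> m n mn; apply/L0_leP.
    by apply: filterS3 (gE m) (gE n) (Dmono _ _ mn) => w -> ->; rewrite lecR.
  + split.
    * move=> _ [n _ <-]; apply/L0_leP.
      by apply: filterS3 (L00E mu) (gE n) (D_ge0 n) => w -> ->; rewrite ler0c.
    * move=> l hl; apply/L0_leP.
      have h : \forall w \ae mu, forall n, (l : L0) w <= (D n w)%:C.
        apply/ae_foralln => n; have /L0_leP : l <= g n by apply: hl; exists n.
        by apply: filterS2 (gE n) => w ->.
      apply: filterS3 (L00E mu) h D0 => w -> lD De.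
      have := lD 0%N; rewrite !lecE /= => /andP[/eqP <- _]; rewrite eqxx /=.
      apply/ler_addgt0Pr => e /De[n Dn]; rewrite add0r.
      by have := lD n; rewrite lecE /= => /andP[_ /le_trans]; apply.
  + move=> n; exists (n, n) => -[p q] /= [np nq]; apply/L0_leP.
    apply: filterS3 (normB (u p - u q)) (gE n) (hD n) => w -> -> h.
    by rewrite lecR; exact: h.
exists l => n.
(* By the triangle inequality through a late u m, |u n - l| - D n lies below every element of the
   dominating net, whose infimum is 0. *)
suff h0 : csL_norm (u n - l) - g n <= 0.
  move/L0_leP: h0 => h0.
  have hB := L0BE (csL_norm (u n - l)) (g n).
  apply: filterS3 (filterI h0 (L00E mu)) (nrmfE (u n - l)) (filterI hB (gE n)).
  by move=> w [h1 h2] h3 [h4 h5]; rewrite -lecR -subr_le0 -h3 -h5 -h4 -h2.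
apply: hglb => _ [b _ <-]; have [a0 ha] := hub b.
have := ha (maxn a0 n) (leq_maxl _ _); rewrite subr0; set m := maxn a0 n => /L0_leP h1.
have nm_ : (n <= m)%N by exact: leq_maxr.
apply/L0_leP; apply: filterS3 (filterI h1 (filterI (L0_absE (csL_norm (u m - l))) (nrmfE (u m - l))))
  (filterI (L0BE (csL_norm (u n - l)) (g n)) (filterI (gE n) (nrmfE (u n - l))))
  (filterI (nrmfD (u n - u m) (u m - l)) (hD n)) => w [a1 [a2 a3]] [b1 [b2 b3]] [c1 c2].
rewrite b1 b2 b3; apply: le_trans a1.
rewrite a2 a3 ger0_norm ?ler0c ?nrmf_ge0// -rmorphB lecR lerBlDl.
rewrite addrA subrK in c1; apply: le_trans c1 _.
by rewrite lerD2r c2.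
Qed.

End L0_module.

Section L0_bounded.
Context (R : realType) (d : measure_display) (T : measurableType d).
Context (mu : {measure set T -> \bar R}) (U : cstar_algebra_L0 mu).
Local Notation L0 := (L0 mu).
Local Notation mul := (@csL_mul _ _ _ _ U).
Local Notation star := (@csL_star _ _ _ _ U).
Implicit Types (x y : U) (a b : L0).

Let hU := csL_star_algebra U.

Definition bnd x (r : R) := \forall w \ae mu, nrmf x w <= r.

Lemma bnd0 : bnd 0 0.
Proof. by apply: filterS (nrmf0 U) => w ->. Qed.

Lemma bndN x r : bnd x r -> bnd (- x) r.
Proof. by apply: filterS2 (nrmfN x) => w ->. Qed.

Lemma bndD x y r s : bnd x r -> bnd y s -> bnd (x + y) (r + s).
Proof.
by apply: filterS3 (nrmfD x y) => w h h1 h2; apply: le_trans h _; exact: lerD.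
Qed.

Lemma bndM x y r s : bnd x r -> bnd y s -> bnd (mul x y) (r * s).
Proof.
apply: filterS3 (nrmfM x y) => w h h1 h2; apply: le_trans h _.
by apply: ler_pM => //; exact: nrmf_ge0.
Qed.

Lemma bnd_star x r : bnd x r -> bnd (star x) r.
Proof. by apply: filterS2 (nrmf_star x) => w ->. Qed.

Lemma bnd_le x r s : r <= s -> bnd x r -> bnd x s.
Proof. by move=> rs; apply: filterS => w h; exact: le_trans rs. Qed.

Lemma bndZ a x (M r : R) : (\forall w \ae mu, nm (a w) <= M) -> bnd x r ->
  bnd (a *: x) (M * r).
Proof.
apply: filterS3 (nrmfZ a x) => w -> h1 h2; apply: ler_pM => //; first exact: nm_ge0.
exact: nrmf_ge0.
Qed.

Lemma bnd_cstZ (c : R[i]) x r : bnd x r -> bnd (L0_cst mu c *: x) (nm c * r).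
Proof. by apply: bndZ; apply: filterS (L0_cstE mu c) => w ->. Qed.

Lemma bnd_eq0 x : (forall e, 0 < e -> bnd x e) -> x = 0.
Proof.
move=> h; apply: nrmf_eq0.
have h' : \forall w \ae mu, forall n, nrmf x w <= 2^-1 ^+ n.
  by apply/ae_foralln => n; apply: h; rewrite exprn_gt0.
apply: filterS h' => w hw; apply/eqP; rewrite eq_le nrmf_ge0 andbT.
apply/ler_addgt0Pr => e e0; rewrite add0r.
have half01 : 0 <= (2^-1 : R) < 1 by lra.
have [n] := geometric_small 1 half01 e0; rewrite mul1r => /ltW; exact: le_trans.
Qed.

Lemma bnd_geometric (u : nat -> U) (C q : R) : 0 <= C -> 0 <= q < 1 ->
  (forall n, bnd (u n.+1 - u n) (C * q ^+ n)) ->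
  exists l, forall n, bnd (u n - l) (2 * (C * q ^+ n / (1 - q))).
Proof.
move=> C0 q01 h; have /andP[q0 q1] := q01.
have q1' : 0 < 1 - q by rewrite subr_gt0.
pose K := C / (1 - q); have K0 : 0 <= K by rewrite divr_ge0// ltW.
have tail n k : bnd (u (n + k)%N - u n) (K * q ^+ n * (1 - q ^+ k)).
  elim: k => [|k IH]; first by rewrite addn0 subrr expr0 subrr mulr0; exact: bnd0.
  have := bndD (h (n + k)%N) IH; rewrite addrA subrK addnS; apply: bnd_le.
  rewrite exprD exprS le_eqVlt; apply/orP; left; apply/eqP.
  by rewrite /K; field; exact: lt0r_neq0.
have tail' n k : bnd (u (n + k)%N - u n) (K * q ^+ n).
  apply: bnd_le (tail n k); apply: ler_piMr; first by rewrite mulr_ge0 ?exprn_ge0.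
  by rewrite gerBl exprn_ge0.
have [||||l hl] := @L0_complete _ _ _ _ U u (fun n _ => 2 * (K * q ^+ n)).
- by move=> n; exact: measurable_cst.
- move=> n.
  have h1 : \forall w \ae mu, forall k, nrmf (u (n + k)%N - u n) w <= K * q ^+ n.
    by apply/ae_foralln => k; exact: tail'.
  have h2 : \forall w \ae mu, forall k k', nrmf (u (n + k)%N - u (n + k')%N) w <=
      nrmf (u (n + k)%N - u n) w + nrmf (u (n + k')%N - u n) w.
    apply/ae_foralln => k; apply/ae_foralln => k'.
    have := nrmfD (u (n + k)%N - u n) (u n - u (n + k')%N); rewrite addrA subrK.
    by apply: filterS2 (nrmfB (u n) (u (n + k')%N)) => w ->.
  apply: filterS2 h1 h2 => w h1 h2 p p' np np'.
  rewrite -(subnKC np) -(subnKC np'); apply: le_trans (h2 _ _) _.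
  by rewrite mulr2n mulrDl !mul1r; exact: lerD.
- move=> m n mn; apply: aeW => w; rewrite ler_pM2l// ler_wpM2l//.
  by rewrite ler_wiXn2l// ltW.
- apply: aeW => w e e0; have [n hn] := geometric_small (2 * K) q01 e0.
  by exists n; rewrite mulrA ltW.
exists l => n; apply: bnd_le (hl n); rewrite ler_pM2l// /K le_eqVlt; apply/orP; left.
by apply/eqP; field; exact: lt0r_neq0.
Qed.

Variable e : U.
Hypothesis ue : is_unit mul e.

Lemma star_unit : star e = e.
Proof.
have := congr1 star (ue (star e)).1.
by rewrite (sa_starM hU) (sa_starK hU) (ue (star e)).1.
Qed.

Lemma L0_sqrt x (s : R) : 0 < s <= 1 -> bnd x (1 - s ^+ 2) -> star x = x ->
  exists w, mul w w = e - x /\ star w = w.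
Proof.
move=> s01 bx sx.
have half2 y : L0_cst mu (2^-1)%:C *: y + L0_cst mu (2^-1)%:C *: y = y :> U.
  rewrite -scalerDl -L0_cstD -rmorphD/= (_ : _ + _ = 1); first exact: scale1r.
  by lra.
have conj_half : L0_conj (L0_cst mu (2^-1)%:C) = L0_cst mu (2^-1)%:C.
  by rewrite L0_conj_cst conjc_real.
have [|||||||||||||||||||y [hy sy _]] := @sqrt_iteration R U mul
  (fun x => L0_cst mu (2^-1)%:C *: x) star bnd _ _ _ _ _ _ _ _ _ _ _ _ _ _ _ _ _ _ _
  x s s01 bx sx.
- exact: (sa_mulDl hU).
- exact: (sa_mulDr hU).
- exact: (sa_mulA hU).
- exact: scalerDr.
- exact: half2.
- by move=> ? ?; rewrite (sa_scaleAl hU).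
- by move=> ? ?; rewrite (sa_scaleAr hU).
- exact: (sa_starD hU).
- exact: (sa_starM hU).
- by move=> ?; rewrite (sa_starZ hU) conj_half.
- exact: bnd_le.
- exact: bnd0.
- exact: bndN.
- exact: bndD.
- by move=> ? ? ? ? _ _; exact: bndM.
- move=> z r /(bnd_cstZ (2^-1)%:C); apply: bnd_le.
  by rewrite nm_real gtr0_norm ?invr_gt0// mulrC.
- exact: bnd_star.
- exact: bnd_eq0.
- exact: bnd_geometric.
have mulN z z' : mul z (- z') = - mul z z'.
  apply: (addrI (mul z z')); rewrite -(sa_mulDr hU) !subrr.
  by apply: (addrI (mul z 0)); rewrite -(sa_mulDr hU) !addr0.
have Nmul z z' : mul (- z) z' = - mul z z'.
  apply: (addrI (mul z z')); rewrite -(sa_mulDl hU) !subrr.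
  by apply: (addrI (mul 0 z')); rewrite -(sa_mulDl hU) !addr0.
exists (e - y); split.
- rewrite (sa_mulDr hU) mulN (ue (e - y)).2 (sa_mulDl hU) Nmul (ue y).1.
  by rewrite -[LHS]addrA -opprD addrA hy addrK.
- by rewrite (sa_starD hU) star_unit (sa_starN hU) sy.
Qed.

End L0_bounded.

Section bounded_part.
Context (R : realType) (d : measure_display) (T : measurableType d).
Context (mu : {measure set T -> \bar R}) (U : cstar_algebra_L0 mu).
Local Notation mul := (@csL_mul _ _ _ _ U).
Local Notation star := (@csL_star _ _ _ _ U).
Let hU := csL_star_algebra U.

Definition ubd : {pred U} := fun x : U => `[< exists M, bnd x M >].

Lemma ubdP (x : U) : reflect (exists M, bnd x M) (x \in ubd).
Proof. exact: asboolP. Qed.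

Lemma ubd_intro (x : U) M : bnd x M -> x \in ubd.
Proof. by move=> h; apply/ubdP; exists M. Qed.

Lemma ubd_closed : zmod_closed ubd.
Proof.
split; first by apply: ubd_intro; exact: bnd0.
move=> x y /ubdP[M hM] /ubdP[N hN]; apply: ubd_intro.
by apply: bndD hM _; apply: bndN; exact: hN.
Qed.
HB.instance Definition _ := GRing.isZmodClosed.Build U ubd ubd_closed.

Lemma ubdM (x y : U) : x \in ubd -> y \in ubd -> mul x y \in ubd.
Proof.
by move=> /ubdP[M hM] /ubdP[N hN]; apply: ubd_intro; exact: bndM hM hN.
Qed.
Lemma ubd_star (x : U) : x \in ubd -> star x \in ubd.
Proof. by move=> /ubdP[M hM]; apply: ubd_intro; exact: bnd_star hM. Qed.
Lemma ubdZ (a : L0 mu) (M : R) (x : U) : (\forall w \ae mu, nm (a w) <= M) -> x \in ubd ->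
  a *: x \in ubd.
Proof. by move=> aM /ubdP[N hN]; apply: ubd_intro; exact: bndZ aM hN. Qed.
Lemma ubd_cstZ (c : R[i]) (x : U) : x \in ubd -> L0_cst mu c *: x \in ubd.
Proof. by apply: ubdZ; apply: filterS (L0_cstE mu c) => w ->. Qed.

Record bsub := Bsub { bval : U ; bvalP : bval \in ubd }.

HB.instance Definition _ := [isSub for bval].
HB.instance Definition _ := [Choice of bsub by <:].
HB.instance Definition _ := [SubChoice_isSubZmodule of bsub by <:].

Definition bscale (c : R[i]) (x : bsub) : bsub := Bsub (ubd_cstZ c (bvalP x)).

Let bscaleA a b x : bscale a (bscale b x) = bscale (a * b) x.
Proof. by apply: val_inj; rewrite /= scalerA L0_cstM. Qed.
Let bscale1 : left_id 1 bscale.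
Proof. by move=> x; apply: val_inj; exact: scale1r. Qed.
Let bscaleDr : right_distributive bscale +%R.
Proof. by move=> a x y; apply: val_inj; exact: scalerDr. Qed.
Let bscaleDl (x : bsub) : {morph bscale^~ x : a b / a + b}.
Proof. by move=> a b; apply: val_inj; rewrite /= L0_cstD; exact: scalerDl. Qed.
HB.instance Definition _ := GRing.Zmodule_isLmodule.Build R[i] bsub
  bscaleA bscale1 bscaleDr bscaleDl.

Definition bmul (x y : bsub) : bsub := Bsub (ubdM (bvalP x) (bvalP y)).
Definition bstar (x : bsub) : bsub := Bsub (ubd_star (bvalP x)).

Lemma bvalD (x y : bsub) : bval (x + y) = bval x + bval y. Proof. by []. Qed.
Lemma bvalB (x y : bsub) : bval (x - y) = bval x - bval y. Proof. by []. Qed.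
Lemma bvalZ c (x : bsub) : bval (c *: x) = L0_cst mu c *: bval x. Proof. by []. Qed.

Lemma bsub_star_algebra : is_star_algebra (@conjc R) bmul bstar.
Proof.
split.
- by move=> x y z; apply: val_inj; exact: (sa_mulA hU).
- by move=> x y z; apply: val_inj; exact: (sa_mulDl hU).
- by move=> x y z; apply: val_inj; exact: (sa_mulDr hU).
- by move=> a x y; apply: val_inj; exact: (sa_scaleAl hU).
- by move=> a x y; apply: val_inj; exact: (sa_scaleAr hU).
- by move=> x; apply: val_inj; exact: (sa_starK hU).
- by move=> x y; apply: val_inj; exact: (sa_starD hU).
- by move=> a x; apply: val_inj; rewrite /= (sa_starZ hU) L0_conj_cst.
- by move=> x y; apply: val_inj; exact: (sa_starM hU).
Qed.

Lemma indicator (A : set T) : measurable A -> exists a : L0 mu,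
  \forall w \ae mu, (A w -> a w = 1) /\ (~ A w -> a w = 0).
Proof.
move=> mA; have mI : measurable_fun setT (\1_A : T -> R) by exact/measurable_indicP.
exists (L0c mu (cmeasurable_real mI)).
apply: filterS (L0cE mu (cmeasurable_real mI)) => w ->.
by split=> Aw; rewrite indicE; [rewrite mem_set|rewrite memNset].
Qed.

Implicit Types x y v : bsub.

Section seminorm.
Variable F : set_system T.
Hypothesis UF : UltraFilter F.
Hypothesis F_ae : forall A, mu.-negligible (~` A) -> F A.

Let PF : ProperFilter F. Proof. exact: ultra_proper. Qed.
Let ae_near (P : T -> Prop) : (\forall w \ae mu, P w) -> \forall w \near F, P w.
Proof. exact: F_ae. Qed.

Definition bsnorm (x : bsub) : R := complex.Re (clim F (fun t => (nrmf (bval x) t)%:C)).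

Lemma bsnorm_ccvg x : ccvg F (fun t => (nrmf (bval x) t)%:C) (bsnorm x)%:C.
Proof.
have /ubdP[M hM] := bvalP x.
have h : ccvg F (fun t => (nrmf (bval x) t)%:C) (clim F (fun t => (nrmf (bval x) t)%:C)).
  apply: (@ultra_ccvg _ _ _ _ M) => //; apply: ae_near; apply: filterS hM => w.
  by rewrite nm_real ger0_norm ?nrmf_ge0.
rewrite /bsnorm RRe_real//; apply: ger0_real; apply: (ccvg_ge0 PF h).
by apply: nearW => t; rewrite ler0c nrmf_ge0.
Qed.

Lemma bsnorm_ge0 x : 0 <= bsnorm x.
Proof.
rewrite -ler0c; apply: (ccvg_ge0 PF (bsnorm_ccvg x)).
by apply: nearW => t; rewrite ler0c nrmf_ge0.
Qed.

Lemma bsnorm_uniq x (f : T -> R) (l : R) : (\forall w \near F, nrmf (bval x) w = f w) ->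
  ccvg F (fun t => (f t)%:C) l%:C -> bsnorm x = l.
Proof.
move=> xf fl; apply: complexI; apply: (ccvg_unique PF (bsnorm_ccvg x)).
by apply: ccvg_near fl; apply: filterS xf => w ->.
Qed.

Lemma bsnorm_le x (f : T -> R) (l : R) : (\forall w \near F, nrmf (bval x) w <= f w) ->
  ccvg F (fun t => (f t)%:C) l%:C -> bsnorm x <= l.
Proof. by move=> xf fl; apply: (ccvg_le PF (bsnorm_ccvg x) fl). Qed.

Lemma bsnorm_near x r : bsnorm x < r -> \forall w \near F, nrmf (bval x) w <= r.
Proof.
move=> xr; have e0 : 0 < r - bsnorm x by rewrite subr_gt0.
apply: filterS (bsnorm_ccvg x e0) => w; rewrite -rmorphB nm_real ltr_norml.
by move=> /andP[_ h]; lra.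
Qed.

Lemma bsnormD x y : bsnorm (x + y) <= bsnorm x + bsnorm y.
Proof.
apply: (@bsnorm_le _ (fun w => nrmf (bval x) w + nrmf (bval y) w)).
  by apply: ae_near; exact: nrmfD.
rewrite rmorphD; apply: ccvg_near (ccvgD PF (bsnorm_ccvg x) (bsnorm_ccvg y)).
by apply: nearW => w; rewrite rmorphD.
Qed.

Lemma bsnormZ (c : R[i]) x : bsnorm (c *: x) = nm c * bsnorm x.
Proof.
apply: (@bsnorm_uniq _ (fun w => nm c * nrmf (bval x) w)).
  by apply: ae_near; exact: nrmf_cstZ.
rewrite rmorphM; apply: ccvg_near (ccvgZ PF (nm c)%:C (bsnorm_ccvg x)).
by apply: nearW => w; rewrite rmorphM.
Qed.

Lemma bsnormM x y : bsnorm (bmul x y) <= bsnorm x * bsnorm y.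
Proof.
apply: (@bsnorm_le _ (fun w => nrmf (bval x) w * nrmf (bval y) w)).
  by apply: ae_near; exact: nrmfM.
rewrite rmorphM; apply: ccvg_near (ccvgM PF (bsnorm_ccvg x) (bsnorm_ccvg y)).
by apply: nearW => w; rewrite rmorphM.
Qed.

Lemma bsnormV x : bsnorm x ^+ 2 = bsnorm (bmul (bstar x) x).
Proof.
apply/esym/(@bsnorm_uniq _ (fun w => nrmf (bval x) w * nrmf (bval x) w)).
  by apply: ae_near; apply: filterS (nrmfV (bval x)) => w <-; rewrite expr2.
rewrite expr2 rmorphM; apply: ccvg_near (ccvgM PF (bsnorm_ccvg x) (bsnorm_ccvg x)).
by apply: nearW => w; rewrite rmorphM.
Qed.

Let bsnorm0P x : (\forall w \near F, nrmf (bval x) w = 0) -> bsnorm x = 0.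
Proof. by move=> h; apply: bsnorm_uniq h _; exact: ccvg_cst. Qed.

(** Multiply x by the indicator of the set where |x| <= r: this set belongs to F, so the seminorm
    does not see the change. *)
Lemma bsnorm_cut x r : bsnorm x < r -> 0 <= r -> exists v : bsub,
  bnd (bval v) r /\ bsnorm (v - x) = 0.
Proof.
move=> xr r0; pose A := [set t | nrmf (bval x) t <= r].
have mA : measurable A.
  have -> : A = setT `&` nrmf (bval x) @^-1` `]-oo, r].
    by apply/seteqP; split=> t /=; rewrite in_itv/= => // -[].
  by apply: measurable_nrmf => //; exact: measurable_itv.
have [a ha] := indicator mA.
have av : a *: bval x \in ubd.
  apply: (@ubdZ _ 1) (bvalP x); apply: filterS ha => w [h1 h2].
  have [/h1->|/h2->] := pselect (A w); rewrite ?nm0 ?ler01//.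
  by rewrite /nm normr1.
exists (Bsub av); split => /=.
  apply: filterS2 ha (nrmfZ a (bval x)) => w [h1 h2] ->.
  have [Aw|/h2->] := pselect (A w); last by rewrite nm0 mul0r.
  by rewrite h1// /nm normr1 mul1r.
apply: bsnorm0P; rewrite bvalB /=.
have -> : a *: bval x - bval x = (a - 1) *: bval x by rewrite scalerBl scale1r.
have FA : \forall w \near F, A w by exact: bsnorm_near.
apply: filterS2 FA (ae_near (filterI ha (filterI (nrmfZ (a - 1) (bval x)) (filterI (L0BE a 1) (L01E mu))))).
by move=> w Aw [[h1 _] [-> [-> ->]]]; rewrite h1// subrr nm0 mul0r.
Qed.

(* Each increment agrees up to the seminorm with one whose L0-norm is uniformly
   small (bsnorm_cut), so completeness of U applies. *)
Lemma bsnorm_complete (u : nat -> bsub) :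
  (forall n, bsnorm (u n.+1 - u n) <= 2^-1 ^+ n) ->
  exists l, forall e, 0 < e -> exists N, forall n, (N <= n)%N -> bsnorm (u n - l) <= e.
Proof.
move=> hu; have q0 n : 0 < (2^-1 : R) ^+ n by rewrite exprn_gt0.
have /choice[v hv] : forall n, exists v : bsub,
    bnd (bval v) (2 * 2^-1 ^+ n) /\ bsnorm (v - (u n.+1 - u n)) = 0.
  move=> n; apply: bsnorm_cut; last by rewrite mulr_ge0// ltW.
  by apply: le_lt_trans (hu n) _; have := q0 n; lra.
pose S := fix S n := if n is m.+1 then S m + v m else u 0%N.
have Su n : bsnorm (u n - S n) = 0.
  elim: n => [|n IH]; first by rewrite subrr -(scale0r (0 : bsub)) bsnormZ nm0 mul0r.
  apply/eqP; rewrite eq_le bsnorm_ge0 andbT.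
  have -> : u n.+1 - S n.+1 = (u n - S n) + (- 1) *: (v n - (u n.+1 - u n)).
    rewrite scaleN1r [S n.+1]/= opprB addrA (addrC (u n - S n)) (addrA _ (u n)) subrK.
    by rewrite opprD addrA.
  apply: le_trans (bsnormD _ _) _; rewrite IH bsnormZ (hv n).2; lra.
have half01 : 0 <= (2^-1 : R) < 1 by lra.
have hS n : bnd (bval (S n.+1) - bval (S n)) (2 * 2^-1 ^+ n).
  by rewrite [S n.+1]/= bvalD addrC addKr; exact: (hv n).1.
have [l hl] := bnd_geometric (ler0n R 2) half01 hS.
have bl : l \in ubd.
  have -> : l = bval (S 0%N) - (bval (S 0%N) - l) by rewrite opprB addrCA subrr addr0.
  by apply: rpredB; [exact: bvalP|exact: ubd_intro (hl 0%N)].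
exists (Bsub bl) => e e0.
(* 8 = 2 * 2 / (1 - 1/2), the constant of [bnd_geometric] for C = 2 and q = 1/2. *)
have [N hN] := geometric_small 8 half01 e0; exists N => n Nn.
have h1 : bsnorm (u n - Bsub bl) <= bsnorm (S n - Bsub bl).
  have -> : u n - Bsub bl = (u n - S n) + (S n - Bsub bl) by rewrite addrA subrK.
  by apply: le_trans (bsnormD _ _) _; rewrite Su add0r.
apply: le_trans h1 _; apply: le_trans (ltW hN).
apply: (@bsnorm_le _ (fun=> 8 * 2^-1 ^+ N)); last exact: ccvg_cst.
apply: ae_near; apply: filterS (hl n) => w /le_trans; apply.
have : (2^-1 : R) ^+ n <= 2^-1 ^+ N by apply: ler_wiXn2l => //; lra.
by rewrite (_ : 1 - 2^-1 = 2^-1) ?invrK; lra.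
Qed.

Definition bsub_pre : pre_cstar R := @PreCstar R bsub bmul bstar bsnorm
  bsub_star_algebra bsnormD bsnormZ bsnormM bsnormV bsnorm_complete.

End seminorm.
End bounded_part.

Section fibers.
Context (R : realType) (d : measure_display) (T : measurableType d).
Context (mu : {measure set T -> \bar R}) (U : cstar_algebra_L0 mu).
Local Notation L0 := (L0 mu).
Local Notation mul := (@csL_mul _ _ _ _ U).
Local Notation star := (@csL_star _ _ _ _ U).
Local Notation ubd := (@ubd _ _ _ _ U).
Implicit Types (a b : L0).
Let hU := csL_star_algebra U.

Variable G : T -> set_system T.
Hypothesis UG : forall w, UltraFilter (G w).
Hypothesis GN : forall w A, mu.-negligible (~` A) -> G w A.
Hypothesis GA : forall A, measurable A -> \forall w \ae mu, G w A <-> A w.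

Definition fiber (w : T) : cstar_algebra R := pc_cstar (bsub_pre U (UG w) (GN w)).
Local Notation X := fiber.

Definition fcls w (x : bsub U) : X w := pcls (P := bsub_pre U (UG w) (GN w)) x.

Definition fib w (x : U) : X w :=
  if pselect (x \in ubd) is left h then fcls w (Bsub h) else 0.

Lemma fibE w (x : bsub U) : fib w (bval x) = fcls w x.
Proof.
rewrite /fib; case: pselect => [h|]; last by case; exact: bvalP.
by congr fcls; exact: val_inj.
Qed.

Lemma fib_surj w (u : X w) : exists2 x, x \in ubd & fib w x = u.
Proof.
have [x <-] := @pcls_surj _ (bsub_pre U (UG w) (GN w)) u.
by exists (bval x); [exact: bvalP|rewrite fibE].
Qed.

Lemma fibD w (x y : U) : x \in ubd -> y \in ubd -> fib w (x + y) = fib w x + fib w y.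
Proof.
move=> hx hy; rewrite -[x]/(bval (Bsub hx)) -[y]/(bval (Bsub hy)) -bvalD !fibE.
exact: pclsD.
Qed.

Lemma fibZc w c (x : U) : x \in ubd -> fib w (L0_cst mu c *: x) = c *: fib w x.
Proof.
by move=> hx; rewrite -[x]/(bval (Bsub hx)) -bvalZ !fibE; exact: pclsZ.
Qed.

Lemma fibM w (x y : U) : x \in ubd -> y \in ubd ->
  fib w (mul x y) = cs_mul (fib w x) (fib w y).
Proof.
move=> hx hy; rewrite -[x]/(bval (Bsub hx)) -[y]/(bval (Bsub hy)).
rewrite -[mul _ _]/(bval (bmul (Bsub hx) (Bsub hy))) !fibE; exact: pclsM.
Qed.

Lemma fib_star w (x : U) : x \in ubd -> fib w (star x) = cs_star (fib w x).
Proof.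
move=> hx; rewrite -[x]/(bval (Bsub hx)) -[star _]/(bval (bstar (Bsub hx))) !fibE.
exact: pcls_star.
Qed.

Lemma fib0 w : fib w 0 = 0.
Proof.
have h : (0 : U) \in ubd by apply: ubd_intro; exact: bnd0.
by apply: (addrI (fib w 0)); rewrite -fibD// !addr0.
Qed.

Lemma fibN w (x : U) : x \in ubd -> fib w (- x) = - fib w x.
Proof.
move=> hx; have hN : - x \in ubd by rewrite rpredN.
by apply: (addrI (fib w x)); rewrite -fibD// !subrr fib0.
Qed.

Lemma fibB w (x y : U) : x \in ubd -> y \in ubd -> fib w (x - y) = fib w x - fib w y.
Proof.
move=> hx hy; have hN : - y \in ubd by rewrite rpredN.
by rewrite fibD// fibN.
Qed.

(** Unlike [fib_nm], this holds at every w, a constant having its own value as limit. Applied to the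
    unit, it makes every fiber nonzero. *)
Lemma nm_fib_eq w (x : U) (r : R) : (\forall t \ae mu, nrmf x t = r) -> nm (fib w x) = r.
Proof.
move=> xr; have hx : x \in ubd by apply: (@ubd_intro _ _ _ _ _ _ r); apply: filterS xr => t ->.
rewrite -[x]/(bval (Bsub hx)) fibE nm_pcls.
by apply: (bsnorm_uniq (UG w) (GN w) (f := fun=> r)); [exact: GN|exact: ccvg_cst].
Qed.

Lemma fib_nm (x : U) : x \in ubd -> \forall w \ae mu, nm (fib w x) = nrmf x w.
Proof.
move=> hx; have mx := cmeasurable_real (measurable_nrmf x).
apply: filterS (ae_lifting UG GA mx) => w hw.
rewrite -[x in LHS]/(bval (Bsub hx)) fibE nm_pcls.
by apply: (bsnorm_uniq (UG w) (GN w) (f := nrmf x)) => //; apply: nearW.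
Qed.

(** For almost every w, a - a(w) tends to 0 along G w; as x is bounded, the difference between a x
    and a(w) x has seminorm 0 at w. *)
Lemma fibZ (a : L0) (M : R) (x : U) : (\forall w \ae mu, nm (a w) <= M) -> x \in ubd ->
  \forall w \ae mu, fib w (a *: x) = a w *: fib w x.
Proof.
move=> aM hx; have hax := ubdZ aM hx.
apply: filterS (ae_lifting UG GA (L0_meas a)) => w hw.
have PG : ProperFilter (G w) by exact: ultra_proper.
have hcx := ubd_cstZ (a w) hx.
rewrite -fibZc//; apply/eqP; rewrite -subr_eq0 -fibB//; apply/eqP/nm_eq0.
rewrite -scalerBl; set c := a - _.
have hc : c *: x \in ubd.
  by rewrite scalerBl rpredB.
rewrite -[c *: x]/(bval (Bsub hc)) fibE nm_pcls.
apply: (bsnorm_uniq (UG w) (GN w) (f := fun t => nm (a t - a w) * nrmf x t)).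
  apply: GN; apply: filterS3 (nrmfZ c x) (L0BE a (L0_cst mu (a w))) (L0_cstE mu (a w)).
  by move=> t /= -> -> ->.
have h0 : ccvg (G w) (fun t => (nm (a t - a w))%:C) 0.
  by move=> e /hw; apply: filterS => t; rewrite subr0 nm_real ger0_norm ?nm_ge0.
have /ubdP[N hN] := hx.
have bN : \forall t \near G w, nm ((nrmf x t)%:C : R[i]) <= N.
  by apply: GN; apply: filterS hN => t; rewrite nm_real ger0_norm ?nrmf_ge0.
apply: ccvg_near (ccvgM0 PG h0 bN).
by apply: nearW => t; rewrite rmorphM.
Qed.

(** The inverse of f, written as the power -1 to get measurability from [measurable_powR]. *)
Definition mult_of (f : T -> R) (mf : measurable_fun setT f) : L0 :=
  L0c mu (cmeasurable_real (measurableT_comp (measurable_powR (-1)) mf)).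

Lemma mult_ofE (f : T -> R) (mf : measurable_fun setT f) : (forall t, 0 <= f t) ->
  \forall w \ae mu, mult_of mf w = ((f w)^-1)%:C.
Proof.
move=> f0; apply: filterS (L0cE mu (cmeasurable_real (measurableT_comp (measurable_powR (-1)) mf))).
by move=> w ->; rewrite /= powR_inv1.
Qed.

Definition is_mult b := \forall w \ae mu, exists r : R, [/\ b w = r%:C, 0 < r & r <= 1].

Lemma is_mult_le1 b : is_mult b -> \forall w \ae mu, nm (b w) <= 1.
Proof. by apply: filterS => w [r [-> r0 r1]]; rewrite nm_real ger0_norm// ltW. Qed.

Lemma is_multM b c : is_mult b -> is_mult c -> is_mult (b * c).
Proof.
apply: filterS3 (L0ME b c) => w -> [r [-> r0 r1]] [s [-> s0 s1]].
exists (r * s); split; [by rewrite rmorphM|exact: mulr_gt0|].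
by rewrite -[leRHS]mulr1; apply: ler_pM => //; exact: ltW.
Qed.

Let measurable_1D (f : T -> R) : measurable_fun setT f -> measurable_fun setT (fun t => 1 + f t).
Proof. by move=> mf; apply: measurable_funD => //; exact: measurable_cst. Qed.

Lemma exists_mult_fun (f : T -> R) : measurable_fun setT f -> (forall t, 0 <= f t) ->
  exists b, is_mult b /\ \forall w \ae mu, b w = ((1 + f w)^-1)%:C.
Proof.
move=> mf f0; have f1 t : 0 <= 1 + f t by have := f0 t; lra.
exists (mult_of (measurable_1D mf)); have h := mult_ofE (measurable_1D mf) f1.
split=> //; apply: filterS h => w ->; exists (1 + f w)^-1; have := f0 w => fw.
split=> //; first by rewrite invr_gt0; lra.
by rewrite invf_le1; lra.
Qed.

(** The factor 1 / (1 + |x| + |y| + |z|) makes all three elements bounded at once. Identities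
    between sections are proved after multiplication by such a factor, which [mult_inj] then
    cancels. *)
Lemma exists_mult (x y z : U) : exists b, [/\ is_mult b, b *: x \in ubd,
  b *: y \in ubd & b *: z \in ubd].
Proof.
pose f t := nrmf x t + nrmf y t + nrmf z t.
have mf : measurable_fun setT f.
  by rewrite /f; apply: measurable_funD; [apply: measurable_funD|]; exact: measurable_nrmf.
have f0 t : 0 <= f t by rewrite !addr_ge0// nrmf_ge0.
have [b [mb hb]] := exists_mult_fun mf f0.
have key (v : U) : (forall t, nrmf v t <= f t) -> b *: v \in ubd.
  move=> vf; apply: (@ubd_intro _ _ _ _ _ _ 1).
  apply: filterS2 hb (nrmfZ b v) => w -> ->.
  have := f0 w; have := vf w => h1 h2; have f1 : 0 < 1 + f w by lra.
  by rewrite nm_real ger0_norm ?invr_ge0 ?(ltW f1)// ler_pdivrMl// mulr1; lra.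
by exists b; split=> //; apply: key => t; rewrite /f;
  have := nrmf_ge0 x t; have := nrmf_ge0 y t; have := nrmf_ge0 z t; lra.
Qed.

Definition norm_mult (x : U) : L0 := mult_of (measurable_1D (measurable_nrmf x)).

Lemma norm_multE (x : U) : \forall w \ae mu, norm_mult x w = ((1 + nrmf x w)^-1)%:C.
Proof. by apply: mult_ofE => t; have := nrmf_ge0 x t; lra. Qed.

Lemma norm_mult_is (x : U) : is_mult (norm_mult x).
Proof.
apply: filterS (norm_multE x) => w ->; exists (1 + nrmf x w)^-1.
have := nrmf_ge0 x w => fw; split=> //; first by rewrite invr_gt0; lra.
by rewrite invf_le1; lra.
Qed.

Lemma norm_mult_ubd (x : U) : norm_mult x *: x \in ubd.
Proof.
apply: (@ubd_intro _ _ _ _ _ _ 1).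
apply: filterS2 (norm_multE x) (nrmfZ (norm_mult x) x) => w -> ->.
have := nrmf_ge0 x w => h; have f1 : 0 < 1 + nrmf x w by lra.
by rewrite nm_real ger0_norm ?invr_ge0 ?(ltW f1)// ler_pdivrMl// mulr1; lra.
Qed.

(* [fib] makes sense on bounded elements only; a general x is first divided by
   1 + |x|. *)
Definition sec (x : U) (w : T) : X w :=
  (1 + nrmf x w)%:C *: fib w (norm_mult x *: x).

(** The normalization in [sec] is immaterial almost everywhere: with b = [norm_mult x], the element
    a b x has a class in the fiber that [fibZ] computes in two ways, by extracting a or by
    extracting b. *)
Lemma sec_key (a : L0) (M : R) (x : U) : (\forall w \ae mu, nm (a w) <= M) ->
  a *: x \in ubd -> \forall w \ae mu, a w *: sec x w = fib w (a *: x).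
Proof.
move=> aM hax; have hb := norm_mult_ubd x.
have h1 := fibZ aM hb; have h2 := fibZ (is_mult_le1 (norm_mult_is x)) hax.
rewrite !scalerA [a * _]mulrC -scalerA in h1.
apply: filterS3 h1 h2 (norm_multE x) => w h1 h2 h3.
rewrite /sec scalerA mulrC -scalerA -h1 h2 h3 scalerA -rmorphM divff ?scale1r//.
by have := nrmf_ge0 x w => fw; apply: lt0r_neq0; lra.
Qed.

Lemma mult_inj b w (V : lmodType R[i]) (u v : V) :
  (exists r : R, [/\ b w = r%:C, 0 < r & r <= 1]) -> b w *: u = b w *: v -> u = v.
Proof.
move=> [r [-> r0 _]] /(congr1 (fun z => (r^-1)%:C *: z)).
by rewrite !scalerA -rmorphM mulVf ?lt0r_neq0// rmorph1 !scale1r.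
Qed.

Lemma sec_fib (x : U) : x \in ubd -> \forall w \ae mu, sec x w = fib w x.
Proof.
move=> hx; have h1 : \forall w \ae mu, nm ((1 : L0) w) <= 1.
  by apply: filterS (L01E mu) => w ->; rewrite /nm normr1.
have := sec_key (x := x) h1; rewrite scale1r => /(_ hx).
by apply: filterS2 (L01E mu) => w ->; rewrite scale1r.
Qed.

Lemma sec_mult b (x : U) : is_mult b -> b *: x \in ubd ->
  \forall w \ae mu, b w *: sec x w = fib w (b *: x).
Proof. by move=> /is_mult_le1; exact: sec_key. Qed.

Lemma secD (x y : U) : \forall w \ae mu, sec (x + y) w = sec x w + sec y w.
Proof.
have [b [mb bx by_ bxy]] := exists_mult x y (x + y).
apply: filterS3 (filterI (sec_mult mb bx) (sec_mult mb by_)) (sec_mult mb bxy) mb.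
move=> w [h1 h2] h3 bw; apply: (mult_inj bw).
by rewrite scalerDr h1 h2 h3 scalerDr fibD.
Qed.

Lemma secZ (a : L0) (x : U) : \forall w \ae mu, sec (a *: x) w = a w *: sec x w.
Proof.
have [b [mb bx bax _]] := exists_mult x (a *: x) 0.
(* The scalar a may be unbounded, so it needs a factor 1 / (1 + |a|) of its own. *)
have [c [mc hc]] := exists_mult_fun (measurable_nm (L0_meas a)) (fun t => nm_ge0 (a t)).
have mbc := is_multM mb mc.
have bcax : (b * c) *: (a *: x) \in ubd.
  by rewrite mulrC -scalerA; apply: (ubdZ (is_mult_le1 mc)).
have bca1 : \forall w \ae mu, nm ((b * c * a : L0) w) <= 1.
  apply: filterS3 (filterI (L0ME (b * c) a) (L0ME b c)) mb hc => w [-> ->] [r [-> r0 r1]] ->.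
  rewrite !nmM_C !nm_real (ger0_norm (ltW r0)) ger0_norm; last first.
    by rewrite invr_ge0; have := nm_ge0 (a w); lra.
  have : (1 + nm (a w))^-1 * nm (a w) <= 1.
    by rewrite ler_pdivrMl; have := nm_ge0 (a w); lra.
  have : 0 <= (1 + nm (a w))^-1 * nm (a w).
    by rewrite mulr_ge0 ?nm_ge0// invr_ge0; have := nm_ge0 (a w); lra.
  by rewrite -mulrA; nra.
have hx : (b * c * a) *: x \in ubd by rewrite -scalerA.
apply: filterS3 (filterI (sec_key bca1 hx) (L0ME (b * c) a)) (sec_mult mbc bcax) mbc.
move=> w [h1 h2] h3 bw; apply: (mult_inj bw).
by rewrite h3 scalerA -h1 h2 -!scalerA.
Qed.

Lemma secM (x y : U) : \forall w \ae mu, sec (mul x y) w = cs_mul (sec x w) (sec y w).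
Proof.
have [b [mb bx by_ _]] := exists_mult x y 0.
have mbb := is_multM mb mb.
have e : (b * b) *: mul x y = mul (b *: x) (b *: y).
  by rewrite -(sa_scaleAl hU) -(sa_scaleAr hU) scalerA.
have bxy : (b * b) *: mul x y \in ubd by rewrite e; exact: ubdM.
apply: filterS3 (filterI (sec_mult mb bx) (sec_mult mb by_)) (filterI (sec_mult mbb bxy) (L0ME b b)) mb.
move=> w [h1 h2] [h3 h4] bw; apply: (mult_inj bw); apply: (mult_inj bw).
rewrite scalerA -h4 h3 e fibM// -h1 -h2.
rewrite -(sa_scaleAl (cs_star_algebra (X w))) -(sa_scaleAr (cs_star_algebra (X w))).
by rewrite scalerA.
Qed.

Lemma sec_adjoint (x : U) : \forall w \ae mu, sec (star x) w = cs_star (sec x w).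
Proof.
have [b [mb bx bsx _]] := exists_mult x (star x) 0.
have cb : L0_conj b = b.
  by apply/L0_eqP; apply: filterS2 (L0_conjE b) mb => w -> [r [-> _ _]]; rewrite conjc_real.
apply: filterS3 (sec_mult mb bx) (sec_mult mb bsx) mb => w h1 h2 bw.
apply: (mult_inj bw); rewrite h2.
have -> : b *: star x = star (b *: x) by rewrite (sa_starZ hU) cb.
rewrite fib_star// -h1 (sa_starZ (cs_star_algebra (X w))).
by case: bw => r [-> _ _]; rewrite conjc_real.
Qed.

Lemma sec_nm (x : U) : \forall w \ae mu, nm (sec x w) = nrmf x w.
Proof.
have [b [mb bx _ _]] := exists_mult x 0 0.
apply: filterS3 (filterI (sec_mult mb bx) (fib_nm bx)) (nrmfZ b x) mb => w [h1 h2] h3 [r [br r0 _]].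
have e : nm (b w *: sec x w) = nm (b w) * nrmf x w by rewrite h1 h2 h3.
move: e; rewrite nmZ br nm_real; apply: mulfI.
by rewrite normr_eq0 lt0r_neq0.
Qed.

Lemma secB (x y : U) : \forall w \ae mu, sec (x - y) w = sec x w - sec y w.
Proof.
have h := secZ (- 1) y; rewrite scaleN1r in h.
apply: filterS3 (secD x (- y)) h (filterI (L0NE (1 : L0)) (L01E mu)) => w -> -> [-> ->].
by rewrite scaleN1r.
Qed.

End fibers.

(** * Measurable sections and the isomorphism with L0(T, X) *)

Section ae_measurable.
Context (R : realType) (d : measure_display) (T : measurableType d).
Variable mu : {measure set T -> \bar R}.
Hypothesis mu_complete : measure_is_complete mu.

Lemma ae_measurable (A : set T) : (\forall w \ae mu, A w) -> measurable A.
Proof. by move=> hA; rewrite -(setCK A); apply: measurableC; exact: mu_complete. Qed.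

Lemma measurable_fun_ae (D : set T) (f g : T -> R) : (\forall w \ae mu, f w = g w) ->
  measurable D -> measurable_fun setT f -> measurable_fun D g.
Proof.
move=> fg mD mf; apply/measurable_EFinP.
apply: (ae_measurable_fun mu_complete (f := EFin \o f)).
  by apply: filterS fg => w /= ->.
by apply/measurable_EFinP; apply: measurable_funS mf.
Qed.

Lemma in_M_ae (g : T -> option R[i]) (f : T -> R[i]) : cmeasurable setT f ->
  (\forall w \ae mu, g w = Some (f w)) -> in_M mu g.
Proof.
move=> [mr mi] gf; have gS : \forall w \ae mu, isSome (g w) by apply: filterS gf => w ->.
split=> //; have mD := ae_measurable gS.
by split; [apply: (measurable_fun_ae _ mD mr)|apply: (measurable_fun_ae _ mD mi)];
  apply: filterS gf => w ->.
Qed.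

(** Supplies the majorants that [L0_complete] asks for: D n is the supremum of f p q over p, q >= n,
    with f replaced by 0 on a null set so that this supremum is finite and measurable everywhere. *)
Lemma cauchy_dominated (f : nat -> nat -> T -> R) :
  (forall p q, measurable_fun setT (f p q)) ->
  (\forall w \ae mu, forall p q r, f p q w <= f p r w + f r q w) ->
  (\forall w \ae mu, forall e : R, 0 < e -> exists N, forall p q,
     (N <= p)%N -> (N <= q)%N -> f p q w <= e) ->
  exists D : nat -> T -> R, [/\ forall n, measurable_fun setT (D n),
    forall n, \forall w \ae mu, forall p q, (n <= p)%N -> (n <= q)%N -> f p q w <= D n w,
    forall m n, (m <= n)%N -> \forall w \ae mu, D n w <= D m w &
    \forall w \ae mu, forall e, 0 < e -> exists n, D n w <= e].
Proof.
move=> mf tf cf.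
pose E := [set w | (forall p q r, f p q w <= f p r w + f r q w) /\
  forall e : R, 0 < e -> exists N, forall p q, (N <= p)%N -> (N <= q)%N -> f p q w <= e].
have aE : \forall w \ae mu, E w by apply: filterS2 tf cf.
have mE : measurable E by exact: ae_measurable.
have mI : measurable_fun setT (\1_E : T -> R) by exact/measurable_indicP.
have I1 w : E w -> \1_E w = 1 :> R by move=> Ew; rewrite indicE mem_set.
have I0 w : ~ E w -> \1_E w = 0 :> R by move=> Ew; rewrite indicE memNset.
(* A single index k runs through all pairs above n; indices coding no pair receive the harmless
   value at (n, n). *)
pose F n k w := if (unpickle k : option (nat * nat)) is Some pq
  then \1_E w * f (n + pq.1)%N (n + pq.2)%N w else \1_E w * f n n w.
have mF n k : measurable_fun setT (F n k).
  by rewrite /F; case: (unpickle k) => [pq|]; apply: measurable_funM.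
have FE n p q w : F n (pickle (p, q)) w = \1_E w * f (n + p)%N (n + q)%N w.
  by rewrite /F pickleK.
have Fcase n k w : exists p q, F n k w = \1_E w * f (n + p)%N (n + q)%N w.
  rewrite /F; case: (unpickle k) => [[p q]|]; first by exists p, q.
  by exists 0%N, 0%N; rewrite addn0.
have bF n w : has_ubound (range (F n ^~ w)).
  have [Ew|/I0 Ew] := pselect (E w); last first.
    by exists 0 => _ [k _ <-]; have [p [q ->]] := Fcase n k w; rewrite Ew mul0r.
  have [tw cw] := Ew; have [N hN] := cw _ ltr01.
  (* f p q is at most f p N + f N q, and each of these is at most 1 past N and one of finitely many
     values before. *)
  exists ((1 + \sum_(i < N) `|f i N w|) + (1 + \sum_(i < N) `|f N i w|)) => _ [k _ <-].
  have [p [q ->]] := Fcase n k w; rewrite I1// mul1r.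
  apply: le_trans (tw _ _ N) _; apply: lerD.
    have s0 : 0 <= \sum_(i < N) `|f i N w| by exact: sumr_ge0.
    have [Np|pN] := leqP N (n + p); first by have := hN _ _ Np (leqnn N); lra.
    rewrite (bigD1 (Ordinal pN))//=.
    have : 0 <= \sum_(i < N | i != Ordinal pN) `|f i N w| by exact: sumr_ge0.
    by have := ler_norm (f (n + p)%N N w); lra.
  have s0 : 0 <= \sum_(i < N) `|f N i w| by exact: sumr_ge0.
  have [Nq|qN] := leqP N (n + q); first by have := hN _ _ (leqnn N) Nq; lra.
  rewrite (bigD1 (Ordinal qN))//=.
  have : 0 <= \sum_(i < N | i != Ordinal qN) `|f N i w| by exact: sumr_ge0.
  by have := ler_norm (f N (n + q)%N w); lra.
pose D n w := sups (F n ^~ w) 0.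
have DE n w : D n w = sup (range (F n ^~ w)).
  by rewrite /D /sups /sdrop; congr sup; apply/seteqP; split=> _ [k _ <-]; exists k.
have F_le n k w : F n k w <= D n w.
  by rewrite DE; apply: ub_le_sup; [exact: bF|exists k].
exists D; split.
- by move=> n; apply: measurable_fun_sups => [w _|k]; [exact: bF|exact: mF].
- move=> n; apply: filterS aE => w Ew p q np nq.
  apply: le_trans (F_le n (pickle ((p - n)%N, (q - n)%N)) w).
  by rewrite FE I1// mul1r !subnKC.
- move=> m n mn; apply: aeW => w; rewrite [D n w]DE; apply: ge_sup.
    by exists (F n 0%N w), 0%N.
  move=> _ [k _ <-]; have [p [q ->]] := Fcase n k w.
  rewrite -(subnKC mn) -!addnA -FE; exact: F_le.
- apply: filterS aE => w Ew e e0; have [_ cw] := Ew; have [N hN] := cw _ e0.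
  exists N; rewrite DE; apply: ge_sup; first by exists (F N 0%N w), 0%N.
  move=> _ [k _ <-]; have [p [q ->]] := Fcase N k w; rewrite I1// mul1r.
  by apply: hN; exact: leq_addr.
Qed.
End ae_measurable.

Section bundle_of_module.
Context (R : realType) (d : measure_display) (T : measurableType d).
Context (mu : {measure set T -> \bar R}) (U : cstar_algebra_L0 mu).
Hypothesis mu_complete : measure_is_complete mu.
Local Notation L0 := (L0 mu).
Local Notation mul := (@csL_mul _ _ _ _ U).
Local Notation star := (@csL_star _ _ _ _ U).
Local Notation ubd := (@ubd _ _ _ _ U).
Let hU := csL_star_algebra U.

Variable G : T -> set_system T.
Hypothesis UG : forall w, UltraFilter (G w).
Hypothesis GN : forall w A, mu.-negligible (~` A) -> G w A.
Hypothesis GA : forall A, measurable A -> \forall w \ae mu, G w A <-> A w.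

Local Notation X := (fiber U UG GN).
Local Notation fib := (fib (U := U) UG GN).
Local Notation sec := (sec (U := U) UG GN).

Variable e : U.
Hypothesis ue : is_unit mul e.
Hypothesis e1 : csL_norm e = 1.

Lemma nrmf_unit : \forall w \ae mu, nrmf e w = 1.
Proof.
apply: filterS (L01E mu) => w; rewrite /nrmf e1 => ->.
by rewrite /nm normr1.
Qed.

Lemma ubd_unit : e \in ubd.
Proof. by apply: (@ubd_intro _ _ _ _ _ _ 1); apply: filterS nrmf_unit => w ->. Qed.

Lemma nm_fib_unit w : nm (fib w e) = 1.
Proof. exact: (nm_fib_eq UG GN w nrmf_unit). Qed.

Lemma fib_unit w : is_unit (@cs_mul R (X w)) (fib w e).
Proof.
move=> u; have [x hx <-] := fib_surj u.
by rewrite -!fibM ?ubd_unit//; have [-> ->] := ue x.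
Qed.

Lemma fib_unit_neq0 w : fib w e != 0.
Proof.
by apply/eqP => e0; have := nm_fib_unit w; rewrite e0 nm0 => /eqP; rewrite eq_sym oner_eq0.
Qed.

Definition bundle_sections : set (psection X) :=
  [set c | exists2 x : U, x \in ubd & c = (fun w => Some (fib w x))].
Local Notation L := bundle_sections.

Lemma bundle_measurable : measurable_bundle mu L.
Proof.
split.
- by move=> w; exists (fib w e); exact/eqP/fib_unit_neq0.
- by move=> _ [x hx ->]; apply: aeW.
- move=> _ _ [x hx ->] [y hy ->]; exists (x + y).
    exact: rpredD.
  by apply: functional_extensionality_dep => w; rewrite /sec_add /= fibD.
- move=> a _ [x hx ->]; exists (L0_cst mu a *: x); first exact: ubd_cstZ.
  by apply: functional_extensionality_dep => w; rewrite /sec_scale /= fibZc.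
- move=> _ _ [x hx ->] [y hy ->]; exists (mul x y); first exact: ubdM.
  by apply: functional_extensionality_dep => w; rewrite /sec_mul /= fibM.
- move=> _ [x hx ->]; exists (star x); first exact: ubd_star.
  by apply: functional_extensionality_dep => w; rewrite /sec_star /= fib_star.
- move=> _ [x hx ->]; apply: (in_M_ae mu_complete (cmeasurable_real (measurable_nrmf x))).
  by apply: filterS (fib_nm UG GN GA hx) => w hw; rewrite /sec_norm /= nmE hw.
- move=> w O [u Ou] _; exists u; split=> //; have [x hx <-] := fib_surj u.
  by exists (fun w => Some (fib w x)) => //; exists x.
Qed.

Lemma measurable_section_ae (u v : psection X) : measurable_section mu L u ->
  (\forall w \ae mu, u w = v w) -> measurable_section mu L v.
Proof.
by move=> [s [hs hu]] uv; exists s; split=> //; apply: filterS2 hu uv => w hw <-.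
Qed.

Lemma simple_fib (x : U) : x \in ubd -> simple_section mu L (fun w => Some (fib w x)).
Proof.
move=> hx; exists 1%N, (fun=> setT), (fun=> (fun w => Some (fib w x))); split.
- by move=> _; exact: measurableT.
- by move=> _; exists x.
- by apply: aeW => w; rewrite big_ord_recl big_ord0 /= indicT scale1r addr0.
Qed.

(** The truncations of x to the sets where |x| <= n are bounded, and at almost every w their classes
    equal [sec x w] as soon as n exceeds |x|(w). *)
Lemma measurable_sec (x : U) : measurable_section mu L (fun w => Some (sec x w)).
Proof.
pose A n := [set w | nrmf x w <= n%:R].
have mA n : measurable (A n).
  have -> : A n = setT `&` nrmf x @^-1` `]-oo, n%:R].
    by apply/seteqP; split=> t /=; rewrite in_itv/= => // -[].
  by apply: measurable_nrmf => //; exact: measurable_itv.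
have /choice[a ha] : forall n, exists a : L0,
    \forall w \ae mu, (A n w -> a w = 1) /\ (~ A n w -> a w = 0).
  by move=> n; exact: indicator.
have a1 n : \forall w \ae mu, nm (a n w) <= 1.
  apply: filterS (ha n) => w [h1 h2].
  have [/h1->|/h2->] := pselect (A n w); last by rewrite nm0.
  by rewrite /nm normr1.
have ax n : a n *: x \in ubd.
  apply: (@ubd_intro _ _ _ _ _ _ n%:R); apply: filterS2 (ha n) (nrmfZ (a n) x) => w [h1 h2] ->.
  have [Aw|/h2->] := pselect (A n w); last by rewrite nm0 mul0r.
  by rewrite h1// /nm normr1 mul1r.
exists (fun n w => Some (fib w (a n *: x))); split; first by move=> n; exact: simple_fib.
have h1 : \forall w \ae mu, forall n, a n w *: sec x w = fib w (a n *: x).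
  by apply/ae_foralln => n; exact: (sec_key UG GN GA (a1 n) (ax n)).
have h2 : \forall w \ae mu, forall n, (A n w -> a n w = 1) /\ (~ A n w -> a n w = 0).
  exact/ae_foralln.
apply: filterS2 h1 h2 => w h1 h2; exists (sec x w) => //=.
apply: cvg_near_cst; exists (Num.bound (nrmf x w)) => // n /= Nn.
rewrite -h1 (h2 n).1 ?scale1r// /A /=.
apply: le_trans (ltW (archi_boundP (nrmf_ge0 x w))) _.
by rewrite ler_nat.
Qed.

Lemma simple_section_fib (s : psection X) : simple_section mu L s ->
  exists2 y : U, y \in ubd & \forall w \ae mu, s w = Some (fib w y).
Proof.
move=> [n [A [c [mA Lc hs]]]].
have /choice[x hx] : forall i, exists x : U, x \in ubd /\ c i = (fun w => Some (fib w x)).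
  by move=> i; have [x hx ->] := Lc i; exists x.
have /choice[a ha] : forall i, exists a : L0,
    \forall w \ae mu, (A i w -> a w = 1) /\ (~ A i w -> a w = 0).
  by move=> i; exact: indicator.
have key (r : seq 'I_n) : exists2 y : U, y \in ubd & \forall w \ae mu,
    fib w y = \sum_(i <- r) \1_(A i) w *: odflt 0 (c i w).
  elim: r => [|i r [y hy IH]].
    exists 0; first by apply: ubd_intro; exact: bnd0.
    by apply: aeW => w; rewrite big_nil fib0.
  have a1 : \forall w \ae mu, nm (a i w) <= 1.
    apply: filterS (ha i) => w [h1 h2].
    have [/h1->|/h2->] := pselect (A i w); last by rewrite nm0.
    by rewrite /nm normr1.
  have [hxi ci] := hx i; have hax := ubdZ a1 hxi.
  exists (a i *: x i + y).
    exact: rpredD.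
  apply: filterS3 IH (fibZ UG GN GA a1 hxi) (ha i) => w IH h1 [h2 h3].
  rewrite big_cons fibD// IH h1 ci /=; congr (_ *: _ + _).
  have [Aw|Aw] := pselect (A i w); first by rewrite h2// indicE mem_set.
  by rewrite h3// indicE memNset.
have [y hy hyw] := key (index_enum 'I_n).
by exists y => //; apply: filterS2 hs hyw => w -> ->.
Qed.

(** Surjectivity of the isomorphism. The approximating simple sections come from bounded elements y
    n, whose pointwise Cauchy property gives majorants by [cauchy_dominated]; the limit of the y n
    in [U] then has u as its section. *)
Lemma measurable_section_sec (u : psection X) : measurable_section mu L u ->
  exists x : U, \forall w \ae mu, u w = Some (sec x w).
Proof.
move=> [s [hs hu]].
have /choice[y hy] : forall n, exists y : U, y \in ubd /\ \forall w \ae mu, s n w = Some (fib w y).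
  by move=> n; have [y hy h] := simple_section_fib (hs n); exists y.
have sy : \forall w \ae mu, forall n, s n w = Some (fib w (y n)).
  by apply/ae_foralln => n; exact: (hy n).2.
have yB p q : y p - y q \in ubd.
  by apply: rpredB; [exact: (hy p).1|exact: (hy q).1].
have fy : \forall w \ae mu, forall p q, nm (fib w (y p) - fib w (y q)) = nrmf (y p - y q) w.
  apply/ae_foralln => p; apply/ae_foralln => q.
  by apply: filterS (fib_nm UG GN GA (yB p q)) => w <-; rewrite fibB//; [exact: (hy p).1|exact: (hy q).1].
have [||| D [mD hD Dmono D0]] := cauchy_dominated mu_complete (f := fun p q => nrmf (y p - y q)).
- by move=> p q; exact: measurable_nrmf.
- apply: filterS fy => w h p q r; rewrite -!h.
  have := nmD (fib w (y p) - fib w (y r)) (fib w (y r) - fib w (y q)).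
  by rewrite addrA subrK.
- apply: filterS3 fy sy hu => w h1 h2 [x _ /cvgrPdist_lt hx] r r0.
  have r2 : (0 : R[i]) < (r / 2)%:C by rewrite ltcR divr_gt0.
  have [N _ hN] := hx _ r2; exists N => p q Np Nq.
  have := hN p Np; have := hN q Nq; rewrite /= !h2 /= !nmE !ltcR -h1 => hq hp.
  rewrite -(subrK x (fib w (y p))) -addrA; apply: le_trans (nmD _ _) _.
  by rewrite nmB (splitr r) lerD// ltW.
have [l hl] := L0_complete mD hD Dmono D0.
exists l.
have hl' : \forall w \ae mu, forall n, nm (fib w (y n) - sec l w) <= D n w.
  apply/ae_foralln => n.
  apply: filterS3 (filterI (hl n) (sec_nm UG GN GA (y n - l))) (secB UG GN GA (y n) l)
    (sec_fib UG GN GA (hy n).1) => w [h1 h2] h3 h4.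
  by rewrite -h4 -h3 h2.
have Dm : \forall w \ae mu, forall m k, D (m + k)%N w <= D m w.
  by apply/ae_foralln => m; apply/ae_foralln => k; apply: Dmono; exact: leq_addr.
apply: filterS3 (filterI sy hl') hu (filterI D0 Dm) => w [h1 h2] [x -> /cvgrPdist_lt hx] [D0w Dmw].
congr Some; apply/eqP; rewrite -subr_eq0; apply/eqP/nm_eq0/eqP.
rewrite eq_le nm_ge0 andbT; apply/ler_addgt0Pr => r r0; rewrite add0r.
have r2 : 0 < r / 2 by rewrite divr_gt0.
have r2' : (0 : R[i]) < (r / 2)%:C by rewrite ltcR.
have [n0 hn0] := D0w _ r2; have [N _ hN] := hx _ r2'.
have := hN (n0 + N)%N (leq_addl _ _); rewrite /= h1 /= nmE ltcR => /ltW hs2.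
have hl2 := le_trans (le_trans (h2 (n0 + N)%N) (Dmw n0 N)) hn0.
rewrite -(subrK (fib w (y (n0 + N)%N)) x) -addrA; apply: le_trans (nmD _ _) _.
by rewrite (splitr r) lerD.
Qed.

Definition sec_msection (x : U) : msection mu L := MSection (measurable_sec x).
Definition bundle_iso (x : U) : L0_sections mu L := L0_sections_class (sec_msection x).
Local Notation J := bundle_iso.

Lemma represents_iso (u : psection X) (x : U) : represents u (J x) <->
  measurable_section mu L u /\ \forall w \ae mu, u w = Some (sec x w).
Proof.
split=> [[v <- /eqP]|[mu_ hu]].
  rewrite /bundle_iso /L0_sections_class => /eqP/eqquotP/asboolP h.
  by split; [exact: msectionP|exact: h].
exists (MSection mu_) => //; apply/eqquotP/asboolP; exact: hu.
Qed.

Lemma represents_sec (u : psection X) (x : U) :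
  (\forall w \ae mu, u w = Some (sec x w)) -> represents u (J x).
Proof.
move=> hu; apply/represents_iso; split=> //; apply: (measurable_section_ae (measurable_sec x)).
by apply: filterS hu => w ->.
Qed.

Lemma bundle_iso_bij : bijective J.
Proof.
have inj : injective J.
  move=> x y /eqquotP/asboolP h; apply/eqP; rewrite -subr_eq0; apply/eqP/nrmf_eq0.
  apply: filterS3 h (secB UG GN GA x y) (sec_nm UG GN GA (x - y)) => w [h1] h2 <-.
  by rewrite h2 h1 subrr nm0.
have surj a : exists x, J x = a.
  have [x hx] := measurable_section_sec (msectionP (repr a)).
  exists x; rewrite -(reprK a); apply/eqquotP/asboolP.
  by apply: filterS hx => w ->.
have [K hK] := choice surj; exists K => // x; exact: inj.
Qed.

Lemma bundle_isometric : isometric_star_isomorphism J.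
Proof.
split.
- exact: bundle_iso_bij.
- move=> x y u v /represents_iso[_ hu] /represents_iso[_ hv]; apply: represents_sec.
  by apply: filterS3 hu hv (secD UG GN GA x y) => w; rewrite /sec_add => -> -> ->.
- move=> a x g u [_ hg] /represents_iso[_ hu]; apply: represents_sec.
  by apply: filterS3 hg hu (secZ UG GN GA a x) => w -> -> ->.
- move=> x y u v /represents_iso[_ hu] /represents_iso[_ hv]; apply: represents_sec.
  by apply: filterS3 hu hv (secM UG GN GA x y) => w; rewrite /sec_mul => -> -> ->.
- move=> x u /represents_iso[_ hu]; apply: represents_sec.
  by apply: filterS2 hu (sec_adjoint UG GN GA x) => w; rewrite /sec_star => -> ->.
- move=> x u /represents_iso[_ hu].
  have h : \forall w \ae mu, sec_norm u w = Some (csL_norm x w).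
    apply: filterS3 hu (sec_nm UG GN GA x) (nrmfE x) => w; rewrite /sec_norm => -> h ->.
    by rewrite /= nmE h.
  by split=> //; apply: in_M_ae h => //; exact: L0_meas.
Qed.

End bundle_of_module.

(** * The Markov operators and the states of the fibers *)

Section systems_of_module.
Context (R : realType) (d : measure_display) (T : measurableType d).
Context (mu : {measure set T -> \bar R}) (U : cstar_algebra_L0 mu).
Hypothesis mu_complete : measure_is_complete mu.
Local Notation L0 := (L0 mu).
Local Notation mul := (@csL_mul _ _ _ _ U).
Local Notation star := (@csL_star _ _ _ _ U).
Local Notation ubd := (@ubd _ _ _ _ U).
Let hU := csL_star_algebra U.

Variable G : T -> set_system T.
Hypothesis UG : forall w, UltraFilter (G w).
Hypothesis GN : forall w A, mu.-negligible (~` A) -> G w A.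
Hypothesis GA : forall A, measurable A -> \forall w \ae mu, G w A <-> A w.

Local Notation X := (fiber U UG GN).
Local Notation fib := (fib (U := U) UG GN).
Local Notation sec := (sec (U := U) UG GN).

Variable e : U.
Hypothesis ue : is_unit mul e.
Hypothesis e1 : csL_norm e = 1.
Local Notation L := (bundle_sections (U := U) (UG := UG) (GN := GN)).

Definition fiber_unital w : unital_cstar R :=
  UnitalCstar (@fib_unit _ _ _ _ _ _ UG GN _ ue e1 w) (fib_unit_neq0 UG GN e1 w).

Section markov.
Variable S : {linear U -> U}.
Hypothesis S_pos : forall x, positive mul star x -> positive mul star (S x).
Hypothesis S_unit : S e = e.

(* A positive unital map sends a self-adjoint x with |x| <= 3/4 into the order
   interval [-e, e], since e - x and e + x are squares of self-adjoint elements. *)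
Let S_sa_bound (x : U) : star x = x -> bnd x (3 / 4) -> bnd (S x) 10.
Proof.
move=> sx bx.
have h01 : 0 < (2^-1 : R) <= 1 by lra.
have b1 : bnd x (1 - 2^-1 ^+ 2) by apply: bnd_le bx; rewrite expr2; lra.
have b2 := bndN b1.
have [p [pp sp]] := L0_sqrt ue h01 b1 sx.
have [q [qq sq]] := L0_sqrt ue h01 b2 (etrans (sa_starN hU x) (congr1 -%R sx)).
rewrite opprK in qq.
have [a ha] : positive mul star (S (e - x)).
  by apply: S_pos; exists p; rewrite sp pp.
have [b hb] : positive mul star (S (e + x)).
  by apply: S_pos; exists q; rewrite sq qq.
rewrite linearB S_unit in ha; rewrite linearD S_unit in hb.
(* Almost every fiber inherits e - Sx = aa* and e + Sx = bb*, so [norm_order_unit] applies there. As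
   a, b and Sx are not yet known to be bounded, [sec] is used instead of [fib]. *)
have sa := sec_adjoint UG GN GA a; have sb := sec_adjoint UG GN GA b.
apply: filterS3 (filterI (filterI (secB UG GN GA e (S x)) (secD UG GN GA e (S x)))
   (filterI (secM UG GN GA a (star a)) (secM UG GN GA b (star b))))
   (filterI (filterI sa sb) (sec_fib UG GN GA (ubd_unit e1))) (sec_nm UG GN GA (S x)).
move=> w [[h1 h2] [h3 h4]] [[h5 h6] h7] <-.
rewrite ha h3 h5 h7 in h1; rewrite hb h4 h6 h7 in h2.
by apply: (@norm_order_unit R (fiber_unital w) (sec (S x) w) (sec b w) (sec a w)).
Qed.

(** Apply the self-adjoint case to y and z, where x = y - iz. *)
Let S_bound34 (x : U) : bnd x (3 / 4) -> bnd (S x) 20.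
Proof.
move=> bx.
pose hf : L0 := L0_cst mu (2^-1)%:C; pose ih : L0 := L0_cst mu ((2^-1)%:C * Complex 0 1).
have chf : L0_conj hf = hf by rewrite L0_conj_cst conjc_real.
have cih : L0_conj ih = - ih.
  rewrite L0_conj_cst; apply/L0_eqP.
  apply: filterS3 (L0NE ih) (L0_cstE mu (conjc ((2^-1)%:C * Complex 0 1)))
    (L0_cstE mu ((2^-1)%:C * Complex 0 1)) => w -> -> ->.
  by apply/eqP; rewrite eq_complex /= !(mulr0, mul0r) subrr oppr0 !eqxx.
pose y := hf *: (x + star x); pose z := ih *: (x - star x).
have sy : star y = y by rewrite (sa_starZ hU) chf (sa_starD hU) (sa_starK hU) addrC.
have sz : star z = z.
  by rewrite (sa_starZ hU) cih (sa_starD hU) (sa_starN hU) (sa_starK hU) scaleNr -scalerN opprB.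
have by_ : bnd y (3 / 4).
  have := bnd_cstZ (2^-1)%:C (bndD bx (bnd_star bx)).
  by apply: bnd_le; rewrite nm_real ger0_norm; lra.
have bz : bnd z (3 / 4).
  have := bnd_cstZ ((2^-1)%:C * Complex 0 1) (bndD bx (bndN (bnd_star bx))).
  by apply: bnd_le; rewrite nmM_C nm_iC nm_real ger0_norm; lra.
pose iN : L0 := L0_cst mu (- Complex 0 1).
have xE : x = y + iN *: z.
  rewrite /y /z scalerA -L0_cstM mulrCA mulNr iC2 opprK mulr1 -/hf.
  rewrite -scalerDr addrACA subrr addr0 -mulr2n -scaler_nat scalerA.
  rewrite -[LHS]scale1r; congr (_ *: _); apply/L0_eqP.
  rewrite mulr_natr mulr2n.
  apply: filterS3 (L01E mu) (L0DE hf hf) (L0_cstE mu (2^-1)%:C) => w -> -> ->.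
  by rewrite -rmorphD/= -[LHS](rmorph1 (real_complex R)); congr (_%:C); lra.
clearbody y z; rewrite xE linearD linearZ /=.
have := bndD (S_sa_bound sy by_) (bnd_cstZ (- Complex 0 1) (S_sa_bound sz bz)).
by apply: bnd_le; rewrite nmN nm_iC; lra.
Qed.

(** Scale x by (3/4) / (|x| + r) and apply the previous bound, as 20 / (3/4) <= 27. The positive r
    keeps the divisor away from 0 where |x| vanishes. *)
Lemma markov_bound (x : U) (r : R) : 0 < r ->
  \forall w \ae mu, nrmf (S x) w <= 27 * (nrmf x w + r).
Proof.
move=> r0; pose f t := nrmf x t + r.
have mf : measurable_fun setT f.
  by apply: measurable_funD; [exact: measurable_nrmf|exact: measurable_cst].
have f0 t : 0 < f t by have := nrmf_ge0 x t; rewrite /f; lra.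
have hb := mult_ofE mu mf (fun t => ltW (f0 t)); set b := mult_of mu mf in hb.
pose c : L0 := L0_cst mu (3 / 4)%:C.
have bnx : \forall w \ae mu, nrmf (b *: x) w <= 1.
  apply: filterS2 hb (nrmfZ b x) => w -> ->.
  rewrite nm_real gtr0_norm ?invr_gt0// ler_pdivrMl// mulr1 /f; lra.
have b34 : bnd (c *: (b *: x)) (3 / 4).
  apply: bnd_le (bnd_cstZ (3 / 4)%:C bnx); rewrite nm_real ger0_norm; lra.
have := S_bound34 b34; rewrite scalerA linearZ /= -scalerA => h.
apply: filterS3 (filterI h hb) (nrmf_cstZ (3 / 4)%:C (b *: S x)) (nrmfZ b (S x)).
move=> w [h1 h2] h3 h4; move: h1; rewrite h3 h4 h2 !nm_real ger0_norm; last lra.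
rewrite gtr0_norm ?invr_gt0// mulrCA ler_pdivrMl// => h1.
by have := f0 w; rewrite -/(f w); lra.
Qed.

Lemma markov_ubd (x : U) : x \in ubd -> S x \in ubd.
Proof.
move=> /ubdP[M hM]; apply: (@ubd_intro _ _ _ _ _ _ (27 * (M + 1))).
by apply: filterS2 hM (markov_bound x ltr01) => w h1 h2; lra.
Qed.

Definition bmarkov (x : bsub U) : bsub U := Bsub (markov_ubd (bvalP x)).

Let bmarkov_lin w a (x y : bsub U) :
  fcls UG GN w (bmarkov (a *: x + y)) = a *: fcls UG GN w (bmarkov x) + fcls UG GN w (bmarkov y).
Proof.
have -> : bmarkov (a *: x + y) = a *: bmarkov x + bmarkov y.
  by apply: val_inj; rewrite /= linearD linearZ.
by rewrite /fcls pclsD pclsZ.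
Qed.

Let bmarkov_ker w (x : bsub U) : bsnorm (G w) x = 0 -> fcls UG GN w (bmarkov x) = 0.
Proof.
move=> x0; apply/nm_eq0/eqP; rewrite nm_pcls eq_le; apply/andP; split; last exact: bsnorm_ge0 (UG w) (GN w) _.
apply/ler_addgt0Pr => r r0; rewrite add0r; have r1 : 0 < r / 27 by rewrite divr_gt0.
have PG : ProperFilter (G w) by exact: ultra_proper.
apply: (bsnorm_le (UG w) (GN w) (f := fun t => 27 * (nrmf (bval x) t + r / 27))).
  by apply: GN; exact: markov_bound.
have h := ccvgZ PG (27%:R)%:C (ccvgD PG (bsnorm_ccvg (UG w) (GN w) x) (ccvg_cst PG (r / 27)%:C)).
have -> : r%:C = (27%:R)%:C * ((bsnorm (G w) x)%:C + (r / 27)%:C).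
  by rewrite x0 add0r -rmorphM; congr (_%:C); field.
apply: ccvg_near h; apply: nearW => t; rewrite [RHS]rmorphM; congr (_ * _).
by rewrite -rmorphD.
Qed.

Definition fiber_markov w : {linear X w -> X w} := 
  pc_lift_lin (P := bsub_pre U (UG w) (GN w)) (f := fun x => fcls UG GN w (bmarkov x))
    (bmarkov_lin w) (@bmarkov_ker w).

Lemma fiber_markovE w (x : U) : x \in ubd -> fiber_markov w (fib w x) = fib w (S x).
Proof.
move=> hx; rewrite -[x in LHS]/(bval (Bsub hx)) fibE.
rewrite -[S x]/(bval (bmarkov (Bsub hx))) fibE.
exact: (@pc_lift_linE _ (bsub_pre U (UG w) (GN w))).
Qed.

Lemma fiber_markovP w : is_markov (@cs_mul R (X w)) (@cs_star R (X w)) (fiber_markov w).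
Proof.
split; last first.
  exists (fib w e); first exact: fib_unit.
  by rewrite fiber_markovE ?S_unit// ubd_unit.
move=> _ [v ->]; have [y hy <-] := fib_surj v.
have hsy := ubd_star hy; have hyy := ubdM hy hsy.
rewrite -fib_star// -fibM// fiber_markovE//.
have [z hz] : positive mul star (S (mul y (star y))) by apply: S_pos; exists y.
(* The root z is bounded because |z|^2 = |zz*| is, and z <= 1 + z^2. *)
have hz' : z \in ubd.
  have /ubdP[M hM] := markov_ubd hyy; apply: (@ubd_intro _ _ _ _ _ _ (1 + M)).
  rewrite hz in hM; apply: filterS2 hM (nrmfV' z) => w' /[swap] <- h.
  by have := sqr_ge0 (nrmf z w' - 1); nra.
by exists (fib w z); rewrite hz fibM ?fib_star//; exact: ubd_star.
Qed.

Lemma markov_sec (x : U) : \forall w \ae mu, fiber_markov w (sec x w) = sec (S x) w.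
Proof.
have [b [mb bx bSx _]] := exists_mult x (S x) 0.
apply: filterS3 (sec_mult UG GN GA mb bx) (sec_mult UG GN GA mb bSx) mb => w h1 h2 bw.
apply: (mult_inj bw); rewrite -linearZ h1 fiber_markovE// h2.
by congr (fib _ _); rewrite linearZ.
Qed.

Lemma markov_bundle : measurable_bundle_of_markov mu L fiber_markov.
Proof.
split; last by apply: aeW => w; exact: fiber_markovP.
move=> u hu; have [x hx] := measurable_section_sec mu_complete GA hu.
apply: (measurable_section_ae (measurable_sec UG GN GA (S x))).
by apply: filterS2 hx (markov_sec x) => w -> <-.
Qed.

End markov.
End systems_of_module.

(* Cauchy--Schwarz for the vectors x and 1 when |x| <= 1: here z = f(x), k = f(1), p = f(xx* ),
   and the hypothesis is the positivity of f on yy* for y = (k + r)x - z. *)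
Lemma state_quad_bound (R : realType) (z : R[i]) (k p r : R) : 0 < r -> 0 <= k -> 0 <= p <= 1 ->
  0 <= (k%:C + r%:C) * conjc (k%:C + r%:C) * p%:C + (k%:C + r%:C) * conjc (- z) * z +
    (- z * conjc (k%:C + r%:C) * conjc z + - z * conjc (- z) * k%:C) ->
  nm z <= (1 + (k + r)) / 2.
Proof.
move=> r0 k0 /andP[p0 p1]; case: z => x y.
have : nm (Complex x y) ^+ 2 = x ^+ 2 + y ^+ 2.
  by rewrite /nm normc_def /= sqr_sqrtr// addr_ge0// sqr_ge0.
have t0 := nm_ge0 (Complex x y).
rewrite lecE /=; set t := nm _ in t0 *; move=> tE /andP[_ h].
have mt : (k + r) * t ^+ 2 <= (k + r) * ((k + r) * p).
  rewrite tE; have : 0 <= k * (x ^+ 2 + y ^+ 2) by rewrite mulr_ge0// addr_ge0 ?sqr_ge0.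
  have : 0 <= r * (x ^+ 2 + y ^+ 2) by rewrite mulr_ge0 ?(ltW r0)// addr_ge0 ?sqr_ge0.
  move: h; rewrite !expr2; nra.
have m0 : 0 < k + r by lra.
rewrite ler_pM2l// in mt.
have : t ^+ 2 <= k + r by apply: le_trans mt _; rewrite -[leRHS]mulr1 ler_pM2l.
by have := sqr_ge0 (t - 1); rewrite !expr2; nra.
Qed.

Section states_of_module.
Context (R : realType) (d : measure_display) (T : measurableType d).
Context (mu : {measure set T -> \bar R}) (U : cstar_algebra_L0 mu).
Hypothesis mu_complete : measure_is_complete mu.
Local Notation L0 := (L0 mu).
Local Notation mul := (@csL_mul _ _ _ _ U).
Local Notation star := (@csL_star _ _ _ _ U).
Local Notation ubd := (@ubd _ _ _ _ U).
Let hU := csL_star_algebra U.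

Variable e : U.
Hypothesis ue : is_unit mul e.
Hypothesis e1 : csL_norm e = 1.

Variable phi : {scalar U}.
Hypothesis phi_pos : forall x, 0 <= phi (mul x (star x)).
Hypothesis phi_sup : supremums [set L0_abs (phi x) | x in [set x | csL_norm x <= 1]] 1.

Local Notation f x := (L0_fun (phi x)).

Lemma norm_le1P (x : U) : csL_norm x <= 1 <-> \forall w \ae mu, nrmf x w <= 1.
Proof.
split=> [/L0_leP|] h; last apply/L0_leP.
  by apply: filterS3 (nrmfE x) (L01E mu) h => w -> ->; rewrite lecR.
by apply: filterS3 (nrmfE x) (L01E mu) h => w -> ->; rewrite lecR.
Qed.

Lemma state_le1 (x : U) : (\forall w \ae mu, nrmf x w <= 1) ->
  \forall w \ae mu, nm (f x w) <= 1.
Proof.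
move=> /norm_le1P x1; have [hu _] := phi_sup.
have /L0_leP := hu (L0_abs (phi x)) (ex_intro2 _ _ x x1 erefl).
by apply: filterS3 (L0_absE (phi x)) (L01E mu) => w -> ->; rewrite nmE lecR.
Qed.

Lemma state_bound (x : U) (r : R) : 0 < r ->
  \forall w \ae mu, nm (f x w) <= nrmf x w + r.
Proof.
move=> r0; pose g t := nrmf x t + r.
have mf : measurable_fun setT g.
  by apply: measurable_funD; [exact: measurable_nrmf|exact: measurable_cst].
have g0 t : 0 < g t by have := nrmf_ge0 x t; rewrite /g; lra.
have hb := mult_ofE mu mf (fun t => ltW (g0 t)); set b := mult_of mu mf in hb.
have bnx : \forall w \ae mu, nrmf (b *: x) w <= 1.
  apply: filterS2 hb (nrmfZ b x) => w -> ->.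
  rewrite nm_real gtr0_norm ?invr_gt0// ler_pdivrMl// mulr1 /g; lra.
have := state_le1 bnx; rewrite linearZ /= => h.
apply: filterS3 hb (L0ME b (phi x)) h => w h1 h2; rewrite h2 h1 nmM_C nm_real.
by rewrite gtr0_norm ?invr_gt0// ler_pdivrMl// mulr1.
Qed.

Lemma state_quad (c a : L0) (x : U) : \forall w \ae mu,
  0 <= c w * conjc (c w) * f (mul x (star x)) w + c w * conjc (a w) * f x w
     + (a w * conjc (c w) * f (star x) w + a w * conjc (a w) * f e w).
Proof.
have se := star_unit ue.
have := phi_pos (c *: x + a *: e).
rewrite (sa_starD hU) !(sa_starZ hU) se (sa_mulDl hU) !(sa_mulDr hU).
rewrite -!(sa_scaleAl hU) -!(sa_scaleAr hU) (ue x).2 (ue (star x)).1 (ue e).1.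
rewrite !scalerA !linearD !linearZ /= => /L0_leP h.
have E (a' c' p : L0) : \forall w \ae mu, (a' * L0_conj c' * p : L0) w = a' w * conjc (c' w) * p w.
  by apply: filterS3 (L0ME (a' * L0_conj c') p) (L0ME a' (L0_conj c')) (L0_conjE c') => w -> -> ->.
have h1 := E c c (phi (mul x (star x))); have h2 := E c a (phi x).
have h3 := E a c (phi (star x)); have h4 := E a a (phi e).
set p1 := c * _ * _ in h h1; set p2 := c * _ * _ in h h2.
set p3 := a * _ * _ in h h3; set p4 := a * _ * _ in h h4.
apply: filterS3 (filterI h (L00E mu)) (filterI (filterI h1 h2) (filterI h3 h4))
  (filterI (L0DE (p1 + p2) (p3 + p4)) (filterI (L0DE p1 p2) (L0DE p3 p4))).
by move=> w [h' w0] [[e1w e2w] [e3w e4w]] [h5 [h6 h7]]; rewrite w0 h5 h6 h7 e1w e2w e3w e4w in h'.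
Qed.

(** The form of [state_quad] is real for c = 1 and a = 1, and for c = 1 and a = i; the vanishing of
    its imaginary part in these two cases determines the value at x*. *)
Lemma state_star (x : U) : \forall w \ae mu, f (star x) w = conjc (f x w).
Proof.
have h0 (c : R[i]) := state_quad (L0_cst mu 1) (L0_cst mu c) x.
have hx : \forall w \ae mu, 0 <= f (mul x (star x)) w.
  by have /L0_leP := phi_pos x; apply: filterS2 (L00E mu) => w ->.
have he : \forall w \ae mu, 0 <= f e w.
  have := phi_pos e; rewrite (star_unit ue) (ue e).1 => /L0_leP.
  by apply: filterS2 (L00E mu) => w ->.
apply: filterS3 (filterI (filterI hx he) (L0_cstE mu 1)) (filterI (h0 1) (L0_cstE mu 1))
  (filterI (h0 (Complex 0 1)) (L0_cstE mu (Complex 0 1))) => w [[h1 h2] h3] [h4 h5] [h6 h7].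
move: h1 h2 h4 h6; rewrite h3 h7 => {h3 h5 h7}.
case: (f x w) (f (star x) w) (f (mul x (star x)) w) (f e w) => [a b] [a' b'] [p p'] [k k'].
rewrite !lecE /= => /andP[/eqP p0 _] /andP[/eqP k0 _] /andP[/eqP h1 _] /andP[/eqP h2 _].
by congr Complex; lra.
Qed.

(** On the unit ball Cauchy-Schwarz gives |phi x| <= (1 + phi e + r) / 2, where the arithmetic mean
    replaces a square root so that the majorant is built from the operations of L0. As 1 is the
    least upper bound of the |phi x|, it lies below this majorant, hence phi e >= 1 - r. *)
Lemma state_unit : \forall w \ae mu, f e w = 1.
Proof.
have he : \forall w \ae mu, 0 <= f e w.
  have := phi_pos e; rewrite (star_unit ue) (ue e).1 => /L0_leP.
  by apply: filterS2 (L00E mu) => w ->.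
have key (r : R) : 0 < r -> \forall w \ae mu, 1 <= nm (f e w) + r.
  move=> r0; pose c : L0 := phi e + L0_cst mu r%:C.
  pose b : L0 := L0_cst mu (2^-1)%:C * (L0_cst mu 1 + c).
  have hb : \forall w \ae mu, b w = ((1 + (nm (f e w) + r)) / 2)%:C.
    apply: filterS3 (filterI (L0ME (L0_cst mu (2^-1)%:C) (L0_cst mu 1 + c)) (L0_cstE mu (2^-1)%:C))
      (filterI (filterI (L0DE (L0_cst mu 1) c) (L0_cstE mu 1)) (L0DE (phi e) (L0_cst mu r%:C)))
      (filterI he (L0_cstE mu r%:C)) => w [-> ->] [[-> ->] ->] [/ge0_nm h ->].
    by rewrite {1}h mulrC rmorphM !rmorphD rmorph1.
  have [_ hl] := phi_sup; have /L0_leP : (1 : L0) <= b.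
    apply: hl => _ [x /norm_le1P x1 <-]; apply/L0_leP.
    have xx1 : \forall w \ae mu, nrmf (mul x (star x)) w <= 1.
      by apply: filterS2 x1 (nrmfV' x) => w h <-; rewrite expr_le1// nrmf_ge0.
    have hx : \forall w \ae mu, 0 <= f (mul x (star x)) w.
      by have /L0_leP := phi_pos x; apply: filterS2 (L00E mu) => w ->.
    apply: filterS3 (filterI (filterI (state_quad c (- phi x) x) (L0DE (phi e) (L0_cst mu r%:C)))
        (filterI (L0_cstE mu r%:C) (L0NE (phi x))))
      (filterI (filterI hx (state_le1 xx1)) (filterI (state_star x) he))
      (filterI hb (L0_absE (phi x))).
    move=> w [[h1 h2] [h3 h4]] [[h5 h6] [h7 h8]] [-> ->].
    rewrite h2 h3 h4 h7 in h1; rewrite nmE lecR.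
    rewrite (ge0_nm h5) (ge0_nm h8) in h1.
    move: h1 h6 (nm_ge0 (f e w)) (nm_ge0 (f (mul x (star x)) w)).
    by move=> h1 h6 k0 p0; apply: state_quad_bound h1 => //; rewrite p0.
  apply: filterS3 hb (L01E mu) => w -> ->; rewrite -(rmorph1 (real_complex R)) lecR => h; lra.
have h1 : \forall w \ae mu, nm (f e w) <= 1.
  by apply: state_le1; apply/norm_le1P; rewrite e1.
(* Each r has its own exceptional set, so only the countably many values 1 / (n + 1) are used. *)
have h2 : \forall w \ae mu, forall n : nat, 1 <= nm (f e w) + n.+1%:R^-1.
  by apply/ae_foralln => n; apply: key; rewrite invr_gt0.
apply: filterS3 he h1 h2 => w /ge0_nm h l1 l2; rewrite h; congr (_%:C); apply/eqP.
rewrite eq_le l1; apply/ler_addgt0Pr => r r0.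
have ri0 : 0 <= r^-1 by rewrite invr_ge0 ltW.
have hn := archi_boundP ri0; apply: le_trans (l2 (Num.bound r^-1)) _.
rewrite lerD2l invf_ple ?posrE//; apply: le_trans (ltW hn) _.
by rewrite ler_nat.
Qed.

Variable G : T -> set_system T.
Hypothesis UG : forall w, UltraFilter (G w).
Hypothesis GN : forall w A, mu.-negligible (~` A) -> G w A.
Hypothesis GA : forall A, measurable A -> \forall w \ae mu, G w A <-> A w.

Local Notation X := (fiber U UG GN).
Local Notation fib := (fib (U := U) UG GN).
Local Notation sec := (sec (U := U) UG GN).
Local Notation L := (bundle_sections (U := U) (UG := UG) (GN := GN)).
Local Notation PG := (fun w => @ultra_proper _ _ (UG w)).

Let state_ccvg w (x : U) : x \in ubd -> ccvg (G w) (f x) (clim (G w) (f x)).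
Proof.
move=> /ubdP[M hM]; apply: (@ultra_ccvg _ _ _ _ (M + 1)) => //; apply: GN.
by apply: filterS2 hM (state_bound x ltr01) => t h1 h2; apply: le_trans h2 _; rewrite lerD2r.
Qed.

Let bstate w (x : bsub U) : R[i] := clim (G w) (f (bval x)).

Let bstate_lin w a (x y : bsub U) : bstate w (a *: x + y) = a * bstate w x + bstate w y.
Proof.
apply: (climE (PG w)).
apply: (ccvg_near (PG w) _ (ccvgD (PG w) (ccvgZ (PG w) a (state_ccvg w (bvalP x)))
  (state_ccvg w (bvalP y)))).
apply: GN; rewrite bvalD bvalZ linearD linearZ /=.
apply: filterS3 (L0DE (L0_cst mu a * phi (bval x)) (phi (bval y)))
  (L0ME (L0_cst mu a) (phi (bval x))) (L0_cstE mu a) => t -> -> ->.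
by [].
Qed.

Let state_nm_le w (x : bsub U) : nm (bstate w x) <= bsnorm (G w) x.
Proof.
apply/ler_addgt0Pr => r r0.
apply: (ccvg_le (PG w) (ccvg_nm (PG w) (state_ccvg w (bvalP x)))
  (b := bsnorm (G w) x + r) (g := fun t => (nrmf (bval x) t + r)%:C)).
  rewrite rmorphD; apply: (ccvg_near (PG w) _ (ccvgD (PG w) (bsnorm_ccvg (UG w) (GN w) x) (ccvg_cst (PG w) r%:C))).
  by apply: nearW => t; rewrite rmorphD.
by apply: GN; exact: state_bound.
Qed.

Let bstate_ker w (x : bsub U) : bsnorm (G w) x = 0 -> bstate w x = 0.
Proof.
by move=> x0; apply/nm_eq0/eqP; rewrite eq_le nm_ge0 andbT -x0 state_nm_le.
Qed.

Definition fiber_state w : {scalar X w} :=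
  pc_lift_scalar (P := bsub_pre U (UG w) (GN w)) (f := bstate w) (@bstate_lin w) (@bstate_ker w).

Let fiber_stateb w (x : bsub U) : fiber_state w (fib w (bval x)) = bstate w x.
Proof. rewrite fibE; exact: (@pc_lift_scalarE _ (bsub_pre U (UG w) (GN w))). Qed.

Lemma fiber_stateE w (x : U) : x \in ubd -> fiber_state w (fib w x) = clim (G w) (f x).
Proof. by move=> hx; rewrite -[x in LHS]/(bval (Bsub hx)) fiber_stateb. Qed.

Lemma fiber_state_unit w : fiber_state w (fib w e) = 1.
Proof.
rewrite fiber_stateE ?(ubd_unit e1)//; apply: (climE (PG w)).
apply: (ccvg_near (PG w) _ (ccvg_cst (PG w) 1)).
by apply: GN; apply: filterS state_unit => t ->.
Qed.

Lemma fiber_stateP w : is_state (fiber_state w).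
Proof.
split.
  move=> v; have [x hx <-] := fib_surj v.
  rewrite -fib_star// -fibM//; last exact: ubd_star.
  have hxx := ubdM hx (ubd_star hx); rewrite fiber_stateE//.
  apply: (ccvg_ge0 (PG w) (state_ccvg w hxx)); apply: GN.
  by have /L0_leP := phi_pos x; apply: filterS2 (L00E mu) => t ->.
split.
  move=> _ [v v1 <-]; have [x hx xv] := fib_surj v; rewrite -xv in v1 *.
  rewrite -[x]/(bval (Bsub hx)) fiber_stateb.
  move: v1; rewrite /= !nmE -!(rmorph1 (real_complex R)) !lecR.
  rewrite -[x]/(bval (Bsub hx)) fibE nm_pcls; apply: le_trans; exact: state_nm_le.
move=> r /(_ 1); apply; exists (fib w e); last by rewrite fiber_state_unit normr1.
by rewrite /= nmE (nm_fib_unit UG GN e1).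
Qed.

Lemma state_sec (x : U) : \forall w \ae mu, fiber_state w (sec x w) = f x w.
Proof.
have [b [mb bx _ _]] := exists_mult x 0 0.
have h : \forall w \ae mu, fiber_state w (fib w (b *: x)) = f (b *: x) w.
  apply: filterS (ae_lifting UG GA (L0_meas (phi (b *: x)))) => w hw.
  by rewrite fiber_stateE//; exact: (climE (PG w)).
apply: filterS3 (filterI (sec_mult UG GN GA mb bx) h) (L0ME b (phi x)) mb.
move=> w [h1 h2] h3 [r [br r0 _]]; move: h2; rewrite -h1.
have -> : fiber_state w (b w *: sec x w) = b w * fiber_state w (sec x w) by exact: linearZ.
have -> : phi (b *: x) = b * phi x by exact: linearZ.
rewrite h3 br.
by apply: mulfI; rewrite eq_complex /= gt_eqF.
Qed.

Lemma states_bundle : measurable_bundle_of_states mu L fiber_state.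
Proof.
split; first exact: fiber_stateP.
move=> u hu; have [x hx] := measurable_section_sec mu_complete GA hu.
apply: (in_M_ae mu_complete (L0_meas (phi x))).
by apply: filterS2 hx (state_sec x) => w -> <-.
Qed.

End states_of_module.

(** * The case of a null measure *)

Section complex_numbers.
Context (R : realType).
Local Notation C := (R[i]^o).

Let mulC (x y : C) : C := x * y.
Let conjC (x : C) : C := conjc x.

Let complex_star_algebra : is_star_algebra (@conjc R) mulC conjC.
Proof.
split; rewrite /mulC /conjC.
- exact: mulrA.
- exact: mulrDl.
- exact: mulrDr.
- exact: scalerAl.
- exact: scalerAr.
- exact: conjcK.
- by move=> x y; rewrite rmorphD.
- by move=> a x; rewrite [LHS]rmorphM.
- by move=> x y; rewrite rmorphM mulrC.
Qed.

(** The sequence is bounded, so it has a limit along an ultrafilter finer than convergence to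
    infinity; the geometric tail bound makes it an ordinary limit. *)
Let complex_complete (u : nat -> C) :
  (forall n, nm (u n.+1 - u n) <= 2^-1 ^+ n) ->
  exists l, forall e, 0 < e -> exists N, forall n, (N <= n)%N -> nm (u n - l) <= e.
Proof.
move=> hu.
have uk n k : nm (u (n + k)%N - u n) <= 2 * (2^-1 ^+ n - 2^-1 ^+ (n + k)).
  elim: k => [|k IH]; first by rewrite addn0 subrr nm0 subrr mulr0.
  rewrite addnS -(subrK (u (n + k)%N) (u (n + k).+1)) -addrA.
  apply: le_trans (nmD _ _) _; have := hu (n + k)%N; rewrite exprS => h.
  by lra.
have uk' n k : nm (u (n + k)%N - u n) <= 2 * 2^-1 ^+ n.
  apply: le_trans (uk n k) _; rewrite ler_pM2l// gerBl exprn_ge0//; lra.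
have [F [UF nF]] := ultraFilterLemma (eventually_filter : ProperFilter (\oo : set_system nat)).
have PF : ProperFilter F by exact: ultra_proper.
have F_ge n : F [set p | (n <= p)%N] by apply: nF; exists n.
have uF : ccvg F u (clim F u).
  apply: (@ultra_ccvg _ _ _ _ (2 + nm (u 0%N))) => //; apply: nearW => p.
  rewrite -(subrK (u 0%N) (u p)); apply: le_trans (nmD _ _) _.
  by rewrite lerD2r; have := uk' 0%N p; rewrite add0n expr0 mulr1.
exists (clim F u) => e e0; have h01 : 0 <= (2^-1 : R) < 1 by lra.
have [N hN] := geometric_small 2 h01 e0; exists N => n Nn.
have h : nm (clim F u - u n) <= 2 * 2^-1 ^+ n.
  apply: (ccvg_le PF (ccvg_nm PF (ccvgD PF uF (ccvg_cst PF (- u n)))) (ccvg_cst PF (2 * 2^-1 ^+ n)%:C)).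
  by apply: filterS (F_ge n) => p /= np; rewrite -(subnKC np); exact: uk'.
rewrite nmB; apply: le_trans h _; apply: le_trans (ltW hN); rewrite ler_pM2l//.
by apply: ler_wiXn2l => //; lra.
Qed.

Definition complex_pre : pre_cstar R.
Proof.
apply: (@PreCstar R C mulC conjC (@nm R C)).
- exact: complex_star_algebra.
- exact: nmD.
- by move=> a x; rewrite nmZ.
- by move=> x y; rewrite /mulC nmM_C.
- by move=> x; rewrite /mulC nmM_C /conjC nm_conj.
- exact: complex_complete.
Defined.

Definition complex_cstar : cstar_algebra R := pc_cstar complex_pre.

Definition complex_cls (z : R[i]) : complex_cstar := pcls (P := complex_pre) z.

Lemma complex_unit : is_unit (@cs_mul R complex_cstar) (complex_cls 1).
Proof.
move=> u; have [x <-] := @pcls_surj _ complex_pre u.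
by rewrite -!pclsM /= /mulC mul1r mulr1.
Qed.

Lemma complex_unit_neq0 : complex_cls 1 <> 0.
Proof.
move=> h; have := nm_pcls (P := complex_pre) 1; rewrite -[pcls _]/(complex_cls 1) h nm0 /=.
by rewrite /nm normr1 => /eqP; rewrite eq_sym oner_eq0.
Qed.

Let id_lin (a : R[i]) (x y : complex_pre) : id (a *: x + y : R[i]) = a * x + y.
Proof. by []. Qed.
Let id_ker (x : complex_pre) : pc_nrm x = 0 -> x = 0 :> R[i].
Proof. exact: nm_eq0. Qed.

Definition complex_state : {scalar complex_cstar} :=
  pc_lift_scalar (P := complex_pre) (f := id) id_lin id_ker.

Lemma complex_stateE (z : R[i]) : complex_state (complex_cls z) = z.
Proof. exact: (@pc_lift_scalarE _ complex_pre). Qed.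

Lemma complex_stateP : is_state complex_state.
Proof.
split.
  move=> u; have [x <-] := @pcls_surj _ complex_pre u.
  rewrite -pcls_star -pclsM complex_stateE /= /mulC /conjC; exact: mulcJ_ge0.
have nE z : `|complex_cls z| = `|z| by rewrite !nmE nm_pcls.
split.
  move=> _ [u u1 <-]; have [x xu] := @pcls_surj _ complex_pre u.
  by rewrite -xu in u1 *; rewrite complex_stateE -nE.
move=> r /(_ 1); apply; exists (complex_cls 1); last by rewrite complex_stateE normr1.
by rewrite /= nE normr1.
Qed.

Lemma complex_system : is_state_preserving_system complex_state idfun.
Proof.
split=> //; first by exists (complex_cls 1); exact: complex_unit.
  exact: complex_stateP.
by split=> //; exists (complex_cls 1) => //; exact: complex_unit.
Qed.
End complex_numbers.

Definition bundle_representation (R : realType) (d : measure_display) (T : measurableType d)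
    (mu : {measure set T -> \bar R}) (U : cstar_algebra_L0 mu) (phi : {scalar U})
    (S : {linear U -> U}) : Prop :=
  exists (X : T -> cstar_algebra R) (L : set (psection X))
         (phi_ : forall w, {scalar X w}) (T_ : forall w, {linear X w -> X w}),
    [/\ measurable_bundle mu L,
        measurable_bundle_of_systems mu L phi_ T_ &
        exists J : U -> L0_sections mu L,
          [/\ isometric_star_isomorphism J,
              (forall (a : U) (x : psection X), represents x (J a) ->
                 represents (fun w => omap (T_ w) (x w)) (J (S a))) &
              (forall (a : U) (x : psection X), represents x (J a) ->
                 represents_L0 (fun w => omap (phi_ w) (x w)) (phi a))]].

Section null_measure.
Context (R : realType) (d : measure_display) (T : measurableType d).
Context (mu : {measure set T -> \bar R}) (U : cstar_algebra_L0 mu).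
Hypothesis mu_complete : measure_is_complete mu.
Hypothesis mu0 : mu setT = 0%E.

Let ae0 (P : T -> Prop) : \forall w \ae mu, P w.
Proof. by exists setT; split. Qed.

Let X (w : T) := complex_cstar R.
Let L : set (psection X) := setT.

Let in_M0 (g : T -> option R[i]) : in_M mu g.
Proof. by apply: (in_M_ae mu_complete (cmeasurable_cst T 0)); exact: ae0. Qed.

Let msec (u : psection X) : measurable_section mu L u.
Proof.
exists (fun=> u); split; last exact: ae0.
by move=> n; exists 0%N, (fun=> set0), (fun=> u); split=> //; exact: ae0.
Qed.

Let J (x : U) : L0_sections mu L := L0_sections_class (MSection (msec (fun=> None))).

Let repJ (u : psection X) (x : U) : represents u (J x).
Proof.
exists (MSection (msec u)) => //; apply/eqquotP/asboolP; exact: ae0.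
Qed.

Let repL0 g (a : L0 mu) : represents_L0 g a.
Proof. by split; [exact: in_M0|exact: ae0]. Qed.

(** Every property holds almost everywhere and all quotients are one point. Only the conditions
    imposed at every w have content, and the complex numbers with the identity map satisfy them. *)
Lemma null_bundle_representation (phi : {scalar U}) (S : {linear U -> U}) :
  bundle_representation phi S.
Proof.
exists X, L, (fun=> complex_state R), (fun=> idfun); split.
- split=> //.
  + by move=> w; exists (complex_cls 1); exact: complex_unit_neq0.
  + by move=> c _; exact: ae0.
  + move=> w O [u Ou] _; exists u; split=> //.
    by exists (fun=> Some u).
- split; first by move=> w; exact: complex_system.
    by split=> //; exact: ae0.
  by split=> // w; exact: complex_stateP.
- exists J; split=> //; split=> //.
  exists (fun=> 0) => [x|a]; first by apply/esym/nrmf_eq0; exact: ae0.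
  by rewrite -(reprK a); apply/eqquotP/asboolP; exact: ae0.
Qed.
End null_measure.

(** * The case of a nonzero measure *)

Section nonnull_measure.
Context (R : realType) (d : measure_display) (T : measurableType d).
Context (mu : {finite_measure set T -> \bar R}) (U : cstar_algebra_L0 mu).
Hypothesis mu_complete : measure_is_complete mu.
Hypothesis mu_neq0 : mu setT != 0%E.

Lemma nonnull_bundle_representation (phi : {scalar U}) (S : {linear U -> U}) :
  is_L0_state_preserving_system phi S -> bundle_representation phi S.
Proof.
move=> [[e ue e1] [phi_pos _ phi_sup] [S_pos [e' ue' Se']] phiS].
(* [is_markov] fixes some unit, and units are unique. *)
have S_unit : S e = e.
  have <- : e' = e by rewrite -[LHS](ue e').2 (ue' e).1.
  exact: Se'.
have [G [UG GN GA]] := lifting mu_complete mu_neq0.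
pose phi_ := fiber_state phi_sup UG GN.
pose T_ := fiber_markov UG GN GA ue e1 S_pos S_unit.
exists (fiber U UG GN), (bundle_sections (U := U) (UG := UG) (GN := GN)), phi_, T_.
split.
- exact: (bundle_measurable mu_complete UG GN GA e1).
- split.
  + move=> w; split.
    * by exists (fib UG GN w e); exact: fib_unit.
    * exact: fiber_stateP.
    * exact: fiber_markovP.
    * move=> u; have [x hx <-] := fib_surj u.
      (* Invariance holds at every w: phi (S x) and phi x are the same element of L0, so the two
         limits along G w coincide. *)
      rewrite fiber_markovE// !fiber_stateE ?phiS//; exact: markov_ubd.
  + exact: markov_bundle.
  + exact: states_bundle.
- exists (bundle_iso (U := U) UG GN GA); split.
  + exact: bundle_isometric.
  + move=> a x /represents_iso[_ hx]; apply: represents_sec.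
    by apply: filterS2 hx (markov_sec UG GN GA ue e1 S_pos S_unit a) => w -> <-.
  + move=> a x /represents_iso[_ hx].
    have h : \forall w \ae mu, omap (phi_ w) (x w) = Some (L0_fun (phi a) w).
      by apply: filterS2 hx (state_sec phi_sup UG GN GA a) => w -> <-.
    by split=> //; apply: (in_M_ae mu_complete _ h); exact: L0_meas.
Qed.
End nonnull_measure.

Local Close Scope complex_scope.

Theorem theorem5p2 (R : realType) (d : measure_display)
    (Omega : measurableType d)
    (lambda : {finite_measure set Omega -> \bar R})
    (lambda_complete : measure_is_complete lambda)
    (U : cstar_algebra_L0 lambda)
    (phi : {scalar U}) (T : {linear U -> U}) :
  is_L0_state_preserving_system phi T ->
  exists (X : Omega -> cstar_algebra R) (L : set (psection X))
         (phi_ : forall w, {scalar X w}) (T_ : forall w, {linear X w -> X w}),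
    [/\ measurable_bundle lambda L,
        measurable_bundle_of_systems lambda L phi_ T_ &
        exists J : U -> L0_sections lambda L,
          [/\ isometric_star_isomorphism J,
              (forall (a : U) (x : psection X), represents x (J a) ->
                 represents (fun w => omap (T_ w) (x w)) (J (T a))) &
              (forall (a : U) (x : psection X), represents x (J a) ->
                 represents_L0 (fun w => omap (phi_ w) (x w)) (phi a))]].
Proof.
have [mu0|mu_neq0] := eqVneq (lambda setT) 0%E.
  by move=> _; exact: null_bundle_representation.
exact: nonnull_bundle_representation.
Qed.
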